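(* Let $X$ be a separable real Banach space. The following are equivalent: (i) $X$ has property (au) and the weak alternating Banach–Saks property (WABS); (ii) for every $\delta>0$ there exist a Banach space $Y$ with a shrinking 1-unconditional basis and a subspace $X_\delta$ of $Y$ with $d(X,X_\delta)<1+\delta$.
   Context: A separable Banach space $X$ has property (au) if for every $x\in X$ and $\delta>0$ there is a closed subspace $W\subseteq X$ of finite codimension such that $\|x-w\|\le(1+\delta)\|x+w\|$ for all $w\in W$. $X$ has property (WABS) if every bounded sequence $(x_n)$ in $X$ has a convex block sequence $(y_n)$ (i.e. $y_n=\sum_{j=p_{n-1}+1}^{p_n}\lambda_jx_j$ with $0=p_0<p_1<\cdots$, $\lambda_j\ge0$, $\sum_{j=p_{n-1}+1}^{p_n}\lambda_j=1$) such that $\lim_{n\to\infty}\sup_{r_1<r_2<\dots<r_n}\|\frac1n\sum_{j=1}^n(-1)^jy_{r_j}\|=0$. $d(X,Z)=\inf\{\|T\|\|T^{-1}\|: T:X\to Z\text{ an onto isomorphism}\}$. A basis $(e_j)$ is 1-unconditional if $\|\sum\epsilon_ja_je_j\|\le\|\sum a_je_j\|$ for all finitely supported scalars and signs $\epsilon_j=\pm1$; it is shrinking if its biorthogonal functionals form a basis of $Y^*$. *)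

(* Defs.v *)
From Stdlib Require Import Reals Lra ClassicalEpsilon.
Open Scope R_scope.

Record NSpace := {
  car :> Type;
  vzero : car;
  vadd : car -> car -> car;
  vopp : car -> car;
  vscal : R -> car -> car;
  vnorm : car -> R }.

Arguments vzero {n}.
Arguments vadd {n}.
Arguments vopp {n}.
Arguments vscal {n}.
Arguments vnorm {n}.

Definition vsub {V : NSpace} (x y : V) : V := vadd x (vopp y).

Definition is_normed (V : NSpace) : Prop :=
  (forall x y z : V, vadd x (vadd y z) = vadd (vadd x y) z) /\
  (forall x y : V, vadd x y = vadd y x) /\
  (forall x : V, vadd x vzero = x) /\
  (forall x : V, vadd x (vopp x) = vzero) /\
  (forall (a : R) (x y : V), vscal a (vadd x y) = vadd (vscal a x) (vscal a y)) /\
  (forall (a b : R) (x : V), vscal (a + b) x = vadd (vscal a x) (vscal b x)) /\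
  (forall (a b : R) (x : V), vscal a (vscal b x) = vscal (a * b) x) /\
  (forall x : V, vscal 1 x = x) /\
  (forall x : V, 0 <= vnorm x) /\
  (forall x : V, vnorm x = 0 -> x = vzero) /\
  (forall (a : R) (x : V), vnorm (vscal a x) = Rabs a * vnorm x) /\
  (forall x y : V, vnorm (vadd x y) <= vnorm x + vnorm y).

Definition converges_to {V : NSpace} (u : nat -> V) (l : V) : Prop :=
  forall eps, 0 < eps -> exists N, forall n, (N <= n)%nat -> vnorm (vsub (u n) l) < eps.

Definition cauchy {V : NSpace} (u : nat -> V) : Prop :=
  forall eps, 0 < eps -> exists N, forall m n, (N <= m)%nat -> (N <= n)%nat ->
    vnorm (vsub (u m) (u n)) < eps.

Definition Banach (V : NSpace) : Prop :=
  is_normed V /\ forall u : nat -> V, cauchy u -> exists l, converges_to u l.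

Definition separable (V : NSpace) : Prop :=
  exists d : nat -> V, forall (x : V) eps, 0 < eps -> exists n, vnorm (vsub x (d n)) < eps.

Fixpoint vsum {V : NSpace} (f : nat -> V) (n : nat) : V :=
  match n with
  | O => vzero
  | S k => vadd (vsum f k) (f k)
  end.

Fixpoint rsum (f : nat -> R) (n : nat) : R :=
  match n with
  | O => 0
  | S k => rsum f k + f k
  end.

Definition series_to {V : NSpace} (f : nat -> V) (y : V) : Prop :=
  converges_to (fun n => vsum f n) y.

Definition linear_map {V W : NSpace} (T : V -> W) : Prop :=
  (forall x y, T (vadd x y) = vadd (T x) (T y)) /\
  (forall a x, T (vscal a x) = vscal a (T x)).

Definition subspace {V : NSpace} (S : V -> Prop) : Prop :=
  S vzero /\ (forall x y, S x -> S y -> S (vadd x y)) /\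
  (forall a x, S x -> S (vscal a x)).

Definition closed_set {V : NSpace} (S : V -> Prop) : Prop :=
  forall (u : nat -> V) (l : V), (forall n, S (u n)) -> converges_to u l -> S l.

Definition finite_codim {V : NSpace} (W : V -> Prop) : Prop :=
  exists (m : nat) (v : nat -> V), forall x : V,
    exists (w : V) (a : nat -> R), W w /\ x = vadd w (vsum (fun j => vscal (a j) (v j)) m).

Definition prop_au (X : NSpace) : Prop :=
  forall (x : X) (delta : R), 0 < delta ->
    exists W : X -> Prop, subspace W /\ closed_set W /\ finite_codim W /\
      forall w, W w -> vnorm (vsub x w) <= (1 + delta) * vnorm (vadd x w).

Definition convex_block {X : NSpace} (x : nat -> X) (y : nat -> X) : Prop :=
  exists (p : nat -> nat) (lam : nat -> R),
    p O = O /\ (forall n, (p n < p (S n))%nat) /\ (forall j, 0 <= lam j) /\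
    (forall n, rsum (fun k => lam (p n + k)%nat) (p (S n) - p n) = 1) /\
    (forall n, y n = vsum (fun k => vscal (lam (p n + k)%nat) (x (p n + k)%nat)) (p (S n) - p n)).

(** Weak alternating Banach-Saks property (WABS).  The condition
    lim_n sup_{r_1<...<r_n} || (1/n) sum_{j=1}^n (-1)^j y_{r_j} || = 0
    is written out (0-based j, r_j := r j). *)
Definition WABS (X : NSpace) : Prop :=
  forall x : nat -> X, (exists M, forall n, vnorm (x n) <= M) ->
    exists y : nat -> X, convex_block x y /\
      forall eps, 0 < eps -> exists N, forall n, (1 <= n)%nat -> (N <= n)%nat ->
        forall r : nat -> nat, (forall j, (S j < n)%nat -> (r j < r (S j))%nat) ->
          vnorm (vscal (/ INR n) (vsum (fun j => vscal ((-1) ^ (S j)) (y (r j))) n)) <= eps.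

Definition is_basis (V : NSpace) (e : nat -> V) : Prop :=
  forall y : V, exists! a : nat -> R, series_to (fun j => vscal (a j) (e j)) y.

Definition one_unconditional (V : NSpace) (e : nat -> V) : Prop :=
  is_basis V e /\
  forall (n : nat) (a eps : nat -> R), (forall j, eps j = 1 \/ eps j = -1) ->
    vnorm (vsum (fun j => vscal (eps j * a j) (e j)) n)
      <= vnorm (vsum (fun j => vscal (a j) (e j)) n).

Definition bounded_functional {V : NSpace} (f : V -> R) : Prop :=
  (forall x y, f (vadd x y) = f x + f y) /\ (forall a x, f (vscal a x) = a * f x) /\
  exists M, forall x, Rabs (f x) <= M * vnorm x.

Definition dual_car (V : NSpace) : Type := { f : V -> R | bounded_functional f }.

Lemma bf_zero (V : NSpace) : @bounded_functional V (fun _ => 0).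
Proof.
  split; [intros; ring|split; [intros; ring|]].
  exists 0; intros x; rewrite Rabs_R0; lra.
Qed.

Lemma bf_add (V : NSpace) (f g : V -> R) :
  bounded_functional f -> bounded_functional g -> bounded_functional (fun x => f x + g x).
Proof.
  intros [f1 [f2 [M1 HM1]]] [g1 [g2 [M2 HM2]]].
  split; [intros; rewrite f1, g1; ring|split; [intros; rewrite f2, g2; ring|]].
  exists (M1 + M2); intros x.
  eapply Rle_trans; [apply Rabs_triang|].
  specialize (HM1 x); specialize (HM2 x); lra.
Qed.

Lemma bf_scal (V : NSpace) (a : R) (f : V -> R) :
  bounded_functional f -> bounded_functional (fun x => a * f x).
Proof.
  intros [f1 [f2 [M1 HM1]]].
  split; [intros; rewrite f1; ring|split; [intros; rewrite f2; ring|]].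
  exists (Rabs a * M1); intros x. rewrite Rabs_mult, Rmult_assoc.
  apply Rmult_le_compat_l; [apply Rabs_pos|apply HM1].
Qed.

Lemma bf_opp (V : NSpace) (f : V -> R) :
  bounded_functional f -> bounded_functional (fun x => - f x).
Proof.
  intros [f1 [f2 [M1 HM1]]].
  split; [intros; rewrite f1; ring|split; [intros; rewrite f2; ring|]].
  exists M1; intros x. rewrite Rabs_Ropp. apply HM1.
Qed.

(** Operator norm  ||f|| = sup { |f x| : ||x|| <= 1 }  (0 if the sup does not exist,
    which never happens for bounded functionals on a normed space). *)
Definition opnorm_set {V : NSpace} (f : V -> R) (t : R) : Prop :=
  exists x : V, vnorm x <= 1 /\ t = Rabs (f x).

Definition opnorm {V : NSpace} (f : V -> R) : R :=
  match excluded_middle_informative (bound (opnorm_set f) /\ exists t, opnorm_set f t) with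
  | left H => proj1_sig (completeness (opnorm_set f) (proj1 H) (proj2 H))
  | right _ => 0
  end.

Definition Dual (V : NSpace) : NSpace := {|
  car := dual_car V;
  vzero := exist _ (fun _ => 0) (bf_zero V);
  vadd := fun f g => exist _ (fun x => proj1_sig f x + proj1_sig g x)
                        (bf_add V _ _ (proj2_sig f) (proj2_sig g));
  vopp := fun f => exist _ (fun x => - proj1_sig f x) (bf_opp V _ (proj2_sig f));
  vscal := fun a f => exist _ (fun x => a * proj1_sig f x) (bf_scal V a _ (proj2_sig f));
  vnorm := fun f => opnorm (proj1_sig f) |}.

Definition shrinking (V : NSpace) (e : nat -> V) : Prop :=
  is_basis V e /\
  exists estar : nat -> Dual V,
    (forall i j, proj1_sig (estar i) (e j) = if Nat.eqb i j then 1 else 0) /\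
    is_basis (Dual V) estar.

(** d(X, Z) < c for a subspace Z of Y: there is an onto isomorphism T : X -> Z with
    ||T|| ||T^{-1}|| < c, expressed via bounds ||T x|| <= a ||x||, ||x|| <= b ||T x||. *)
Definition banach_mazur_lt (X Y : NSpace) (Z : Y -> Prop) (c : R) : Prop :=
  exists (T : X -> Y) (a b : R),
    linear_map T /\ (forall x, Z (T x)) /\ (forall z, Z z -> exists x, T x = z) /\
    0 <= a /\ 0 <= b /\
    (forall x, vnorm (T x) <= a * vnorm x) /\
    (forall x, vnorm x <= b * vnorm (T x)) /\
    a * b < c.

(* Main.v *)
(** (ii) => (i). Changing the sign of a tail of a 1-unconditional expansion preserves the norm, which
    gives (au). For (WABS), pass to a subsequence whose coordinates converge to some [xi]; up to small
    errors its terms are truncations of [xi] plus disjoint blocks. As the basis is shrinking, the blocks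
    have small convex combinations, and an alternating sum of the remaining (averaged) truncations of
    [xi] has coordinates in [[-1, 1] * xi], so it stays bounded.

    (i) => (ii). By Hahn-Banach, (au) lets one reflect a functional: keep it on a finite dimensional
    space [F] and change its sign on a subspace [W] of finite codimension, at the cost of a correction
    supported between the two. If [norm (p - q) > (1 + delta) * norm (p + q)] for [q] vanishing on ever
    larger spaces, repeated reflections of [p + q] produce bounded functionals containing more and more
    corrections, whose values on an alternating sum add up linearly; this contradicts (WABS). Hence
    [norm (p - q)] is almost at most [norm (p + q)] whenever [q] is weak* small: property (au* ).

    Choose [F 0 <= F 1 <= ...] with dense union and [W 0 >= W 1 >= ...] such that (au) and (au* ) hold
    along the chain. By (WABS) again, bounded vectors [w j] in the gaps [W j] meet [F (j + 1)] have small
    convex combinations, so each [x] is almost normed by a functional that vanishes on one gap in each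
    of infinitely many prescribed blocks of indices. Its successive pieces are 1-unconditional up to a
    small error by (au* ), and they lie in prescribed finite dimensional spaces, so finite nets of these
    spaces form a sequence [f k] in the dual of [X]. The norm dual to [max norm (sum (+-) c k * f k)]
    defines [Y], and [x] is mapped to [(f k x)]. The basis of [Y] is shrinking because (WABS) prevents
    the dual of [X] from containing [c_0]: weakly unconditionally Cauchy series converge there. *)

From Stdlib Require Import ZArith Reals Lra Lia List Cantor.
From Stdlib Require Import ClassicalEpsilon FunctionalExtensionality ProofIrrelevance PropExtensionality.
From mathcomp Require classical_sets.
Require Import Defs.
Import ListNotations.
Open Scope R_scope.

(* Two orders of choice shape the proof. For the dual property, a reflection costs a factor [1 + s].
   Only [2 * N] reflections are made, with [N] given by (WABS), and [s] is fixed after [N]. So the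
   total cost stays below [1 + delta / 2], half of the assumed excess, and the other half is the
   gain of each round. The indices of the alternating sum are fixed before [q], because [q] has to
   vanish at all its vectors. In the construction of [Y], the system of functionals must be
   countable, whereas the gap where a functional can be cut depends on it. Fixing the blocks of
   indices in advance confines the cut number [i] to the block number [i]. The [i]-th piece of every
   functional then lies in one finite dimensional space depending on [i] only, where finite nets
   with summable errors suffice. Projections alone give no bound on the pieces, since the norms of
   the [pj] are not controlled. Unconditionality comes from almost isometric changes of sign, and
   these need the functional to vanish on the gap that separates two consecutive pieces. *)
Existing Class is_normed.

Ltac now_axiom := match goal with H : is_normed _ |- _ => unfold is_normed in H; intuition auto end.

(** * Normed spaces and finite sums of vectors *)

Section VectorSpace.
Context {V : NSpace} {HV : is_normed V}.

Lemma vaddA (x y z : V) : vadd x (vadd y z) = vadd (vadd x y) z.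
Proof. now_axiom. Qed.
Lemma vaddC (x y : V) : vadd x y = vadd y x.
Proof. now_axiom. Qed.
Lemma vadd0 (x : V) : vadd x vzero = x.
Proof. now_axiom. Qed.
Lemma vaddN (x : V) : vadd x (vopp x) = vzero.
Proof. now_axiom. Qed.
Lemma vscalDr a (x y : V) : vscal a (vadd x y) = vadd (vscal a x) (vscal a y).
Proof. now_axiom. Qed.
Lemma vscalDl a b (x : V) : vscal (a + b) x = vadd (vscal a x) (vscal b x).
Proof. now_axiom. Qed.
Lemma vscalA a b (x : V) : vscal a (vscal b x) = vscal (a * b) x.
Proof. now_axiom. Qed.
Lemma vscal1 (x : V) : vscal 1 x = x.
Proof. now_axiom. Qed.
Lemma nrm_ge0 (x : V) : 0 <= vnorm x.
Proof. now_axiom. Qed.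
Lemma nrm_eq0 (x : V) : vnorm x = 0 -> x = vzero.
Proof. now_axiom. Qed.
Lemma nrm_scal a (x : V) : vnorm (vscal a x) = Rabs a * vnorm x.
Proof. now_axiom. Qed.
Lemma nrm_add (x y : V) : vnorm (vadd x y) <= vnorm x + vnorm y.
Proof. now_axiom. Qed.

Lemma vscal0 (x : V) : vscal 0 x = vzero.
Proof.
  rewrite <- (vaddN (vscal 0 x)) at 1.
  assert (H : vscal 0 x = vadd (vscal 0 x) (vscal 0 x)) by (rewrite <- vscalDl; f_equal; ring).
  rewrite H at 2. rewrite <- vaddA, vaddN, vadd0. reflexivity.
Qed.

Lemma vscalN1 (x : V) : vscal (-1) x = vopp x.
Proof.
  rewrite <- (vadd0 (vopp x)), <- (vscal0 x), <- (vadd0 (vscal (-1) x)), <- (vaddN x).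
  rewrite vaddA. rewrite <- (vscal1 x) at 2. rewrite <- vscalDl.
  rewrite vaddC. f_equal. f_equal. ring.
Qed.

Lemma vscalr0 a : vscal a (vzero : V) = vzero.
Proof. rewrite <- (vscal0 vzero), vscalA. f_equal. ring. Qed.

Lemma vaddAC (a b c d : V) : vadd (vadd a b) (vadd c d) = vadd (vadd a c) (vadd b d).
Proof. rewrite !vaddA. f_equal. rewrite <- !vaddA. f_equal. apply vaddC. Qed.

Lemma vsum_add (f g : nat -> V) n :
  vsum (fun k => vadd (f k) (g k)) n = vadd (vsum f n) (vsum g n).
Proof.
  induction n as [|n IH]; simpl; [now rewrite vadd0|].
  rewrite IH. apply vaddAC.
Qed.

Lemma vsum_scal a (f : nat -> V) n : vsum (fun k => vscal a (f k)) n = vscal a (vsum f n).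
Proof.
  induction n as [|n IH]; simpl; [now rewrite vscalr0|]. now rewrite IH, vscalDr.
Qed.

Lemma vsum_ext (f g : nat -> V) n : (forall k, (k < n)%nat -> f k = g k) -> vsum f n = vsum g n.
Proof.
  induction n as [|n IH]; simpl; intros H; [reflexivity|].
  rewrite IH, (H n); auto with arith.
Qed.

Lemma vsum_0 (f : nat -> V) n : (forall k, (k < n)%nat -> f k = vzero) -> vsum f n = vzero.
Proof.
  induction n as [|n IH]; simpl; intros H; [reflexivity|].
  rewrite IH, (H n), vadd0; auto with arith.
Qed.
End VectorSpace.

(* Linear identities between vectors are decided by comparing the coefficients of the atoms. *)
Inductive vex := vxZ | vxV (n : nat) | vxA (a b : vex) | vxO (a : vex) | vxS (r : R) (a : vex).

Fixpoint vden {V : NSpace} (env : list V) (e : vex) : V :=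
  match e with
  | vxZ => vzero
  | vxV n => nth n env vzero
  | vxA a b => vadd (vden env a) (vden env b)
  | vxO a => vopp (vden env a)
  | vxS r a => vscal r (vden env a)
  end.

Fixpoint vcf (e : vex) (n : nat) : R :=
  match e with
  | vxZ => 0
  | vxV m => if Nat.eqb m n then 1 else 0
  | vxA a b => vcf a n + vcf b n
  | vxO a => - vcf a n
  | vxS r a => r * vcf a n
  end.

Fixpoint same_coefs (a b : vex) (n : nat) : Prop :=
  match n with O => True | S n => vcf a n = vcf b n /\ same_coefs a b n end.

Lemma vsum_single {V : NSpace} {HV : is_normed V} (f : nat -> V) m n :
  vsum (fun k => vscal (if Nat.eqb m k then 1 else 0) (f k)) n = if Nat.ltb m n then f m else vzero.
Proof.
  induction n as [|n IH]; [reflexivity|]. cbn [vsum]. rewrite IH.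
  destruct (Nat.ltb_spec m n), (Nat.ltb_spec m (S n)), (Nat.eqb_spec m n); try lia; subst;
    rewrite ?vscal0, ?vscal1, ?vadd0; try reflexivity.
  rewrite vaddC, vadd0. reflexivity.
Qed.

Lemma vden_coefs {V : NSpace} {HV : is_normed V} (env : list V) e :
  vden env e = vsum (fun n => vscal (vcf e n) (nth n env vzero)) (length env).
Proof.
  induction e as [|m|a IHa b IHb|a IHa|r a IHa]; simpl.
  - symmetry. apply vsum_0. intros. apply vscal0.
  - rewrite vsum_single. destruct (Nat.ltb_spec m (length env)); [reflexivity|].
    now apply nth_overflow.
  - rewrite IHa, IHb, <- vsum_add. apply vsum_ext. intros. now rewrite vscalDl.
  - rewrite IHa, <- vscalN1, <- vsum_scal. apply vsum_ext. intros. rewrite vscalA. f_equal. ring.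
  - rewrite IHa, <- vsum_scal. apply vsum_ext. intros. now rewrite vscalA.
Qed.

Lemma vden_eq {V : NSpace} {HV : is_normed V} (env : list V) a b :
  same_coefs a b (length env) -> vden env a = vden env b.
Proof.
  intros H. rewrite !vden_coefs. revert H. generalize (length env). intros n.
  intros H. apply vsum_ext. revert H. induction n as [|n IH]; [lia|].
  intros [H1 H2] k Hk. destruct (Nat.eq_dec k n) as [->|]; [now rewrite H1|].
  apply IH; [exact H2|lia].
Qed.

Ltac vinsert x l :=
  let rec mem l' := match l' with
    | nil => constr:(cons x l)
    | cons x _ => l
    | cons _ ?t => mem t end in mem l.
Ltac vatoms e l := lazymatch e with
  | vzero => l
  | vadd ?a ?b => let l := vatoms a l in vatoms b l
  | vsub ?a ?b => let l := vatoms a l in vatoms b l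
  | vopp ?a => vatoms a l
  | vscal _ ?a => vatoms a l
  | _ => vinsert e l end.
Ltac vindex x l := lazymatch l with
  | cons x _ => constr:(O)
  | cons _ ?t => let n := vindex x t in constr:(S n) end.
Ltac vreify e l := lazymatch e with
  | vzero => constr:(vxZ)
  | vadd ?a ?b => let a := vreify a l in let b := vreify b l in constr:(vxA a b)
  | vsub ?a ?b => let a := vreify a l in let b := vreify b l in constr:(vxA a (vxO b))
  | vopp ?a => let a := vreify a l in constr:(vxO a)
  | vscal ?r ?a => let a := vreify a l in constr:(vxS r a)
  | _ => let n := vindex e l in constr:(vxV n) end.
Ltac vcoefs :=
  match goal with
  | |- @eq (car ?V) ?a ?b =>
    let l := vatoms a (@nil (car V)) in let l := vatoms b l in
    let ra := vreify a l in let rb := vreify b l in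
    change (@vden V l ra = @vden V l rb); apply vden_eq;
    cbn [same_coefs vcf length Nat.eqb]; repeat split
  end.
Ltac vlin := vcoefs; try ring; try lra.

Lemma Rabs_m1 : Rabs (-1) = 1.
Proof. unfold Rabs. destruct Rcase_abs; lra. Qed.

Lemma Rabs_le_iff x a : Rabs x <= a <-> - a <= x <= a.
Proof. split; [|apply Rabs_le]. unfold Rabs. destruct Rcase_abs; lra. Qed.

Section Norm.
Context {V : NSpace} {HV : is_normed V}.

Lemma nrm_0 : vnorm (vzero : V) = 0.
Proof. rewrite <- (vscal0 vzero), nrm_scal, Rabs_R0. ring. Qed.
Lemma nrm_opp (x : V) : vnorm (vopp x) = vnorm x.
Proof. rewrite <- vscalN1, nrm_scal, Rabs_m1. ring. Qed.
Lemma nrm_sub (x y : V) : vnorm (vsub x y) <= vnorm x + vnorm y.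
Proof. unfold vsub. rewrite <- (nrm_opp y). apply nrm_add. Qed.
Lemma nrm_subC (x y : V) : vnorm (vsub x y) = vnorm (vsub y x).
Proof. rewrite <- nrm_opp. f_equal. vlin. Qed.
Lemma nrm_le_sub (x y : V) : vnorm x <= vnorm y + vnorm (vsub x y).
Proof. replace x with (vadd y (vsub x y)) at 1 by vlin. apply nrm_add. Qed.
Lemma nrm_sub_tri (x y z : V) : vnorm (vsub x z) <= vnorm (vsub x y) + vnorm (vsub y z).
Proof. replace (vsub x z) with (vadd (vsub x y) (vsub y z)) by vlin. apply nrm_add. Qed.
Lemma nrm_scal_pos a (x : V) : 0 <= a -> vnorm (vscal a x) = a * vnorm x.
Proof. intros. rewrite nrm_scal, Rabs_pos_eq; auto. Qed.
Lemma nrm_sign a (x : V) : a = 1 \/ a = -1 -> vnorm (vscal a x) = vnorm x.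
Proof.
  intros [-> | ->]; rewrite nrm_scal, ?Rabs_R1, ?Rabs_m1; ring.
Qed.
Lemma nrm_normalize (x : V) : vnorm x <> 0 -> 0 < / vnorm x /\ vnorm (vscal (/ vnorm x) x) = 1.
Proof.
  intros H. assert (Hn := nrm_ge0 x). assert (Hi : 0 < / vnorm x) by (apply Rinv_0_lt_compat; lra).
  split; [exact Hi|]. rewrite nrm_scal_pos, Rinv_l; lra.
Qed.
Lemma vsub_eq0 (x y : V) : vsub x y = vzero -> x = y.
Proof. intros H. replace x with (vadd (vsub x y) y) by vlin. rewrite H. vlin. Qed.

Lemma vsum_sub (f g : nat -> V) n :
  vsum (fun k => vsub (f k) (g k)) n = vsub (vsum f n) (vsum g n).
Proof. induction n as [|n IH]; simpl; [|rewrite IH]; vlin. Qed.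

Lemma nrm_vsum (f : nat -> V) n : vnorm (vsum f n) <= rsum (fun k => vnorm (f k)) n.
Proof.
  induction n as [|n IH]; simpl; [rewrite nrm_0; lra|].
  eapply Rle_trans; [apply nrm_add|lra].
Qed.

Lemma vsum_split (f : nat -> V) n m :
  vsum f (n + m) = vadd (vsum f n) (vsum (fun k => f (n + k)%nat) m).
Proof.
  induction m as [|m IH]; simpl; [rewrite Nat.add_0_r; vlin|].
  rewrite Nat.add_succ_r. cbn [vsum]. rewrite IH. vlin.
Qed.

(** The tail is padded with zeros instead of being shifted, so that signs and indices keep their
    names when a tail is reflected. *)
Lemma vsum_split_at (f : nat -> V) k n : (k <= n)%nat ->
  vsum f n = vadd (vsum f k) (vsum (fun i => if Nat.ltb i k then vzero else f i) n).
Proof.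
  intros H. induction n as [|n IH].
  - replace k with O by lia. simpl. vlin.
  - destruct (Nat.eq_dec k (S n)) as [->|].
    + rewrite (vsum_0 (fun i => if Nat.ltb i (S n) then vzero else f i)); [vlin|].
      intros i Hi. destruct (Nat.ltb_spec i (S n)); [reflexivity|lia].
    + cbn [vsum]. rewrite IH by lia. destruct (Nat.ltb_spec n k); [lia|]. vlin.
Qed.
End Norm.

(** * Finite sums of reals *)

Lemma rsum_ext f g n : (forall k, (k < n)%nat -> f k = g k) -> rsum f n = rsum g n.
Proof. induction n as [|n IH]; simpl; intros H; [easy|]. rewrite IH, (H n); auto with arith. Qed.
Lemma rsum_le f g n : (forall k, (k < n)%nat -> f k <= g k) -> rsum f n <= rsum g n.
Proof.
  induction n as [|n IH]; simpl; intros H; [lra|].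
  assert (f n <= g n) by auto. assert (rsum f n <= rsum g n) by auto with arith. lra.
Qed.
Lemma rsum_add f g n : rsum (fun k => f k + g k) n = rsum f n + rsum g n.
Proof. induction n as [|n IH]; simpl; [ring|rewrite IH; ring]. Qed.
Lemma rsum_scal a f n : rsum (fun k => a * f k) n = a * rsum f n.
Proof. induction n as [|n IH]; simpl; [ring|rewrite IH; ring]. Qed.
Lemma rsum_const a n : rsum (fun _ => a) n = INR n * a.
Proof. induction n as [|n IH]; [simpl; ring|]. cbn [rsum]. rewrite IH, S_INR. ring. Qed.
Lemma rsum_0 f n : (forall k, (k < n)%nat -> f k = 0) -> rsum f n = 0.
Proof. intros H. rewrite (rsum_ext _ (fun _ => 0)), rsum_const by exact H. ring. Qed.
Lemma rsum_ge0 f n : (forall k, (k < n)%nat -> 0 <= f k) -> 0 <= rsum f n.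
Proof.
  intros H. rewrite <- (rsum_0 (fun _ => 0) n) by reflexivity. now apply rsum_le.
Qed.
Lemma rsum_abs f n : Rabs (rsum f n) <= rsum (fun k => Rabs (f k)) n.
Proof.
  induction n as [|n IH]; simpl; [rewrite Rabs_R0; lra|].
  eapply Rle_trans; [apply Rabs_triang|lra].
Qed.
Lemma rsum_split f n m : rsum f (n + m) = rsum f n + rsum (fun k => f (n + k)%nat) m.
Proof.
  induction m as [|m IH]; simpl; [rewrite Nat.add_0_r; ring|].
  rewrite Nat.add_succ_r. cbn [rsum]. rewrite IH. ring.
Qed.
Lemma rsum_mono f n m : (forall k, 0 <= f k) -> (n <= m)%nat -> rsum f n <= rsum f m.
Proof.
  intros H Hnm. replace m with (n + (m - n))%nat by lia. rewrite rsum_split.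
  assert (0 <= rsum (fun k => f (n + k)%nat) (m - n)) by now apply rsum_ge0. lra.
Qed.
Lemma rsum_swap (f : nat -> nat -> R) n m :
  rsum (fun i => rsum (f i) m) n = rsum (fun j => rsum (fun i => f i j) n) m.
Proof.
  induction n as [|n IH]; simpl.
  - symmetry. now apply rsum_0.
  - rewrite IH, <- rsum_add. reflexivity.
Qed.
Lemma rsum_single m (f : nat -> R) n :
  rsum (fun k => (if Nat.eqb m k then 1 else 0) * f k) n = if Nat.ltb m n then f m else 0.
Proof.
  induction n as [|n IH]; [reflexivity|]. cbn [rsum]. rewrite IH.
  destruct (Nat.ltb_spec m n), (Nat.ltb_spec m (S n)), (Nat.eqb_spec m n); try lia; subst; ring.
Qed.
Lemma rsum_term f n k : (forall i, 0 <= f i) -> (k < n)%nat -> f k <= rsum f n.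
Proof.
  intros H Hk. apply Rle_trans with (rsum f (S k)); [|apply rsum_mono; auto].
  cbn [rsum]. assert (0 <= rsum f k) by now apply rsum_ge0. lra.
Qed.

Lemma small_multiple c eps : 0 <= c -> 0 < eps -> exists eta, 0 < eta /\ c * eta < eps.
Proof.
  intros Hc He. exists (eps / (c + 1)). assert (H : 0 < eps / (c + 1)) by (apply Rdiv_lt_0_compat; lra).
  split; [exact H|]. assert (eps / (c + 1) * (c + 1) = eps) by (field; lra). lra.
Qed.

(** The missing inequality is the given one for [/ t], applied to [vscal t x]. *)
Lemma norm_homogeneous (V : NSpace) : (forall x : V, 0 <= vnorm x) ->
  (forall t (x : V), t <> 0 -> vscal (/ t) (vscal t x) = x) ->
  (forall t (x : V), vnorm (vscal t x) <= Rabs t * vnorm x) -> forall t (x : V), vnorm (vscal t x) = Rabs t * vnorm x.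
Proof.
  intros H0 HI Hs t x. apply Rle_antisym; [apply Hs|].
  destruct (Req_dec t 0) as [->|Ht]; [rewrite Rabs_R0, Rmult_0_l; apply H0|].
  assert (H := Hs (/ t) (vscal t x)). rewrite (HI t x Ht), Rabs_inv in H. assert (Hp := Rabs_pos_lt _ Ht).
  apply Rmult_le_compat_l with (r := Rabs t) in H; [|lra].
  rewrite <- Rmult_assoc, Rinv_r, Rmult_1_l in H; lra.
Qed.

(** * Functionals *)

Definition ap {V : NSpace} (f : Dual V) (x : V) : R := proj1_sig f x.

Arguments ap : simpl never.

Lemma ap_ext {V : NSpace} (f g : Dual V) : (forall x, ap f x = ap g x) -> f = g.
Proof.
  destruct f as [f Hf], g as [g Hg]. unfold ap; simpl; intros H.
  assert (f = g) by now apply functional_extensionality. subst g.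
  f_equal. apply proof_irrelevance.
Qed.

Lemma ap_vadd {V : NSpace} (f g : Dual V) x : ap (vadd f g) x = ap f x + ap g x.
Proof. reflexivity. Qed.
Lemma ap_vscal {V : NSpace} a (f : Dual V) x : ap (vscal a f) x = a * ap f x.
Proof. reflexivity. Qed.
Lemma ap_vopp {V : NSpace} (f : Dual V) x : ap (vopp f) x = - ap f x.
Proof. reflexivity. Qed.
Lemma ap_vsub {V : NSpace} (f g : Dual V) x : ap (vsub f g) x = ap f x - ap g x.
Proof. reflexivity. Qed.
Lemma ap_vzero {V : NSpace} (x : V) : ap vzero x = 0.
Proof. reflexivity. Qed.
Lemma ap_vsum {V : NSpace} (f : nat -> Dual V) n x : ap (vsum f n) x = rsum (fun k => ap (f k) x) n.
Proof. induction n as [|n IH]; [reflexivity|]. cbn [vsum rsum]. now rewrite ap_vadd, IH. Qed.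
Lemma ap_add {V : NSpace} (f : Dual V) x y : ap f (vadd x y) = ap f x + ap f y.
Proof. apply (proj2_sig f). Qed.
Lemma ap_scal {V : NSpace} (f : Dual V) a x : ap f (vscal a x) = a * ap f x.
Proof. apply (proj2_sig f). Qed.

Section Functionals.
Context {V : NSpace} {HV : is_normed V}.
Implicit Types f g : Dual V.

Lemma ap_opp f x : ap f (vopp x) = - ap f x.
Proof. rewrite <- vscalN1, ap_scal. ring. Qed.
Lemma ap_sub f x y : ap f (vsub x y) = ap f x - ap f y.
Proof. unfold vsub. rewrite ap_add, ap_opp. ring. Qed.
Lemma ap_0 f : ap f vzero = 0.
Proof. rewrite <- (vscal0 vzero), ap_scal. ring. Qed.
Lemma ap_sum f u n : ap f (vsum u n) = rsum (fun k => ap f (u k)) n.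
Proof. induction n as [|n IH]; [apply ap_0|]. cbn [vsum rsum]. now rewrite ap_add, IH. Qed.

Lemma opnorm_set_ne (f : V -> R) : exists t, opnorm_set f t.
Proof. exists (Rabs (f vzero)), vzero. rewrite nrm_0. split; [lra|reflexivity]. Qed.

Lemma opnorm_bound f : bound (opnorm_set (ap f)).
Proof.
  destruct (proj2 (proj2 (proj2_sig f))) as [M HM]. exists (Rmax M 0).
  intros t [x [Hx ->]]. eapply Rle_trans; [apply HM|].
  assert (Hn := nrm_ge0 x). assert (H1 := Rmax_l M 0). assert (H2 := Rmax_r M 0).
  apply Rle_trans with (Rmax M 0 * vnorm x); nra.
Qed.

Lemma opnorm_lub f : is_lub (opnorm_set (ap f)) (vnorm f).
Proof.
  simpl. unfold opnorm. fold (ap f). destruct excluded_middle_informative as [H|H].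
  - exact (proj2_sig (completeness _ (proj1 H) (proj2 H))).
  - exfalso. apply H. split; [apply opnorm_bound|apply opnorm_set_ne].
Qed.

Lemma ap_le f x : Rabs (ap f x) <= vnorm f * vnorm x.
Proof.
  destruct (Req_dec (vnorm x) 0) as [H|H].
  - apply nrm_eq0 in H. subst x. rewrite ap_0, nrm_0, Rabs_R0. lra.
  - destruct (nrm_normalize x H) as [Hi H1].
    assert (H0 : Rabs (ap f (vscal (/ vnorm x) x)) <= vnorm f).
    { apply opnorm_lub. exists (vscal (/ vnorm x) x). split; [lra|reflexivity]. }
    rewrite ap_scal, Rabs_mult, (Rabs_pos_eq (/ _)) in H0 by lra. assert (Hn := nrm_ge0 x).
    apply Rmult_le_compat_r with (r := vnorm x) in H0; [|lra].
    replace (/ vnorm x * Rabs (ap f x) * vnorm x) with (Rabs (ap f x)) in H0 by (field; lra).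
    exact H0.
Qed.

Lemma dnorm_le f M : 0 <= M -> (forall x, ap f x <= M * vnorm x) -> vnorm f <= M.
Proof.
  intros HM H. apply opnorm_lub. intros t [x [Hx ->]].
  assert (Rabs (ap f x) <= M * vnorm x).
  { apply Rabs_le. split; [|apply H].
    specialize (H (vopp x)). rewrite ap_opp, nrm_opp in H. lra. }
  assert (Hn := nrm_ge0 x). nra.
Qed.

Lemma dnorm_ge0 f : 0 <= vnorm f.
Proof.
  apply Rle_trans with (Rabs (ap f vzero)); [apply Rabs_pos|].
  apply opnorm_lub. exists vzero. rewrite nrm_0. split; [lra|reflexivity].
Qed.

Lemma ap_le_l f x : ap f x <= vnorm f * vnorm x.
Proof. eapply Rle_trans; [apply Rle_abs|apply ap_le]. Qed.

Lemma ap_le_bd f x M N : vnorm f <= M -> vnorm x <= N -> Rabs (ap f x) <= M * N.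
Proof.
  intros. eapply Rle_trans; [apply ap_le|].
  apply Rmult_le_compat; auto using dnorm_ge0, nrm_ge0.
Qed.

Global Instance dual_normed : is_normed (Dual V).
Proof.
  assert (Hs : forall (a : R) f, vnorm (vscal a f) <= Rabs a * vnorm f).
  { intros a f. apply dnorm_le; [apply Rmult_le_pos; [apply Rabs_pos|apply dnorm_ge0]|].
    intros x. rewrite ap_vscal. eapply Rle_trans; [apply Rle_abs|].
    rewrite Rabs_mult, Rmult_assoc. apply Rmult_le_compat_l; [apply Rabs_pos|apply ap_le]. }
  unfold is_normed. repeat match goal with |- _ /\ _ => split end.
  1-8: intros; apply ap_ext; intros; rewrite ?ap_vadd, ?ap_vopp, ?ap_vscal, ?ap_vadd, ?ap_vopp, ?ap_vscal, ?ap_vzero; ring.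
  - exact dnorm_ge0.
  - intros f Hf. apply ap_ext. intros x. assert (H := ap_le f x). rewrite Hf, Rmult_0_l in H.
    rewrite ap_vzero. assert (H1 := Rabs_pos (ap f x)).
    destruct (Req_dec (ap f x) 0) as [|Hn]; [auto|apply Rabs_no_R0 in Hn; lra].
  - apply norm_homogeneous; [exact dnorm_ge0| |exact Hs].
    intros t f Ht. apply ap_ext. intros x. rewrite !ap_vscal. field. exact Ht.
  - intros f g. apply dnorm_le.
    + assert (H1 := dnorm_ge0 f). assert (H2 := dnorm_ge0 g). lra.
    + intros x. rewrite ap_vadd, Rmult_plus_distr_r.
      assert (H1 := ap_le_l f x). assert (H2 := ap_le_l g x). lra.
Qed.
End Functionals.

(** * Choice principles and increasing sequences of indices *)

Lemma func_choice {A B} (P : A -> B -> Prop) :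
  (forall x, exists y, P x y) -> exists f, forall x, P x (f x).
Proof.
  intros H. exists (fun x => proj1_sig (constructive_indefinite_description _ (H x))).
  intros x. apply proj2_sig.
Qed.

(** Successors exist only where the invariant [Q] holds; elsewhere the step function returns its
    argument, so that it is total and iterating it needs no proof terms. *)
Lemma dep_choice {A} (Q : nat -> A -> Prop) (S' : nat -> A -> A -> Prop) a0 :
  Q O a0 -> (forall n a, Q n a -> exists b, Q (S n) b /\ S' n a b) ->
  exists f : nat -> A, f O = a0 /\ forall n, Q n (f n) /\ S' n (f n) (f (S n)).
Proof.
  intros H0 H.
  destruct (func_choice (fun (p : nat * A) b => Q (fst p) (snd p) -> Q (S (fst p)) b /\ S' (fst p) (snd p) b))
    as [g Hg].
  { intros [n a]. destruct (classic (Q n a)) as [Hq|Hq].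
    - destruct (H n a Hq) as [b Hb]. now exists b.
    - now exists a. }
  set (f := fix f n := match n with O => a0 | S n => g (n, f n) end).
  assert (HQ : forall n, Q n (f n)).
  { induction n as [|n IH]; [exact H0|]. apply (Hg (n, f n) IH). }
  exists f. split; [reflexivity|]. intros n. split; [apply HQ|]. apply (Hg (n, f n) (HQ n)).
Qed.

Lemma incr_lt (s : nat -> nat) : (forall n, (s n < s (S n))%nat) -> forall m n, (m < n)%nat -> (s m < s n)%nat.
Proof. intros H m n Hmn. induction Hmn; [apply H|]. specialize (H m0). lia. Qed.
Lemma incr_le (s : nat -> nat) : (forall n, (s n < s (S n))%nat) -> forall m n, (m <= n)%nat -> (s m <= s n)%nat.
Proof. intros H m n Hmn. destruct (Nat.eq_dec m n) as [->|]; [lia|]. assert (s m < s n)%nat by (apply incr_lt; auto; lia). lia. Qed.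
Lemma incr_ge (s : nat -> nat) : (forall n, (s n < s (S n))%nat) -> forall n, (n <= s n)%nat.
Proof. intros H n. induction n; [lia|]. specialize (H n). lia. Qed.

Lemma inv_INR_pos n : 0 < / INR (S n).
Proof. apply Rinv_0_lt_compat. apply lt_0_INR. lia. Qed.

Lemma inv_INR_small eps : 0 < eps -> exists N, forall n, (N <= n)%nat -> / INR (S n) < eps.
Proof.
  intros H. destruct (archimed_cor1 eps H) as [N [HN HN0]]. exists N. intros n Hn.
  eapply Rle_lt_trans; [|apply HN]. apply Rinv_le_contravar; [apply lt_0_INR; lia|apply le_INR; lia].
Qed.

(** * Diagonal extraction of a subsequence *)

Section Diagonal.
Variable a : nat -> nat -> R.
Hypothesis Ha : forall k, exists M, forall n, Rabs (a k n) <= M.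

(** The first [k] coordinates of [l] form a cluster point of the first [k] rows of [a], taken
    jointly. *)
Let freq k (l : nat -> R) := forall eta N, 0 < eta ->
  exists n, (N <= n)%nat /\ forall i, (i < k)%nat -> Rabs (a i n - l i) < eta.
Let upd (l : nat -> R) k t := fun i => if Nat.eqb i k then t else l i.

(* The new coordinate is the largest value that [a k] reaches infinitely often while the first [k]
   coordinates stay close to [l]. *)
Lemma freq_step k l : freq k l -> exists t, freq (S k) (upd l k t).
Proof.
  intros Hl. destruct (Ha k) as [M HM].
  set (E := fun t => forall eta N, 0 < eta -> exists n, (N <= n)%nat /\
     (forall i, (i < k)%nat -> Rabs (a i n - l i) < eta) /\ t <= a k n).
  destruct (completeness E) as [t [Ht1 Ht2]].
  - exists M. intros t Ht. destruct (Ht 1 O) as [n [_ [_ Hn]]]; [lra|].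
    specialize (HM n). apply Rabs_le_iff in HM. lra.
  - exists (- M). intros eta N Heta. destruct (Hl eta N Heta) as [n [Hn Hn']].
    exists n. repeat split; auto. specialize (HM n). apply Rabs_le_iff in HM. lra.
  - exists t. intros eta N Heta.
    assert (H1 : exists t', E t' /\ t - eta < t').
    { apply NNPP. intros H. assert (t <= t - eta); [|lra]. apply Ht2. intros t' Ht'.
      apply Rnot_lt_le. intros Hlt. apply H. now exists t'. }
    destruct H1 as [t' [Ht' Hlt]].
    (* As [t + eta / 2] is not in [E], beyond some [N'] the values [a k n] stay below it whenever
       the other coordinates are within [eta']. An index taken beyond both bounds, with the
       tolerance [Rmin eta eta'], has its new coordinate close to [t]. *)
    assert (H2 : ~ E (t + eta / 2)). { intros H. apply Ht1 in H. lra. }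
    apply not_all_ex_not in H2. destruct H2 as [eta' H2].
    apply not_all_ex_not in H2. destruct H2 as [N' H2].
    apply imply_to_and in H2. destruct H2 as [Heta' H2].
    destruct (Ht' (Rmin eta eta') (max N N')) as [n [Hn [Hn1 Hn2]]]; [now apply Rmin_pos|].
    exists n. split; [lia|]. intros i Hi. unfold upd.
    destruct (Nat.eqb_spec i k) as [->|Hik].
    + apply Rabs_def1; [|lra]. apply Rnot_le_lt. intros Hle. apply H2. exists n.
      split; [lia|]. split; [|lra]. intros i Hi'. eapply Rlt_le_trans; [now apply Hn1|apply Rmin_r].
    + eapply Rlt_le_trans; [apply Hn1; lia|apply Rmin_l].
Qed.

(** The coordinates of the cluster point are chosen one after the other and never revised. The index
    [s n] is then taken beyond the previous one, with the coordinates up to [n] within [/ INR (S n)]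
    of the limit. *)
Lemma diag_reals : exists (s : nat -> nat) (l : nat -> R),
  (forall n, (s n < s (S n))%nat) /\ forall k, Un_cv (fun n => a k (s n)) (l k).
Proof.
  destruct (dep_choice freq (fun k l l' => forall i, (i < k)%nat -> l' i = l i) (fun _ => 0)) as [L [_ HL]].
  { intros eta N _. exists N. split; [lia|]. intros; lia. }
  { intros k l Hl. destruct (freq_step k l Hl) as [t Ht]. exists (upd l k t). split; [exact Ht|].
    intros i Hi. unfold upd. destruct (Nat.eqb_spec i k); [lia|reflexivity]. }
  assert (HLs : forall i k, (i < k)%nat -> L k i = L (S i) i).
  { intros i k Hk. induction Hk as [|k Hk IH]; [reflexivity|]. rewrite <- IH. apply HL. lia. }
  assert (HF : forall p : nat * nat, exists n, (snd p <= n)%nat /\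
     forall i, (i <= fst p)%nat -> Rabs (a i n - L (S i) i) < / INR (S (fst p))).
  { intros [k N]. destruct (proj1 (HL (S k)) (/ INR (S k)) N (inv_INR_pos k)) as [n [Hn Hn']].
    exists n. split; [exact Hn|]. intros i Hi. rewrite <- (HLs i (S k)) by (simpl in Hi; lia).
    apply Hn'. simpl in Hi. lia. }
  destruct (func_choice _ HF) as [F HF'].
  set (s := fix s n := match n with O => F (O, O) | S n => F (S n, S (s n)) end).
  exists s, (fun k => L (S k) k). split.
  - intros n. cbn [s]. destruct (HF' (S n, S (s n))) as [H _]. simpl in H. exact H.
  - intros k eps Heps. destruct (inv_INR_small eps Heps) as [N HN].
    exists (max k N). intros n Hn. unfold R_dist.
    assert (Rabs (a k (s n) - L (S k) k) < / INR (S n)).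
    { destruct n as [|n]; [apply (HF' (O, O)); simpl; lia|].
      apply (HF' (S n, S (s n))). simpl. lia. }
    eapply Rlt_trans; [eassumption|apply HN; lia].
Qed.
End Diagonal.

Definition dmk {V : NSpace} (f : V -> R) (H : bounded_functional f) : Dual V := exist _ f H.

(** * The Hahn-Banach theorem *)

Section HahnBanach.
Context {V : NSpace} {HV : is_normed V}.

(* Partial functionals are given by their graphs: the bound [r <= C * vnorm x] alone makes a linear
   subspace of [V * R] single-valued. *)
Definition lin_graph (C : R) (G : V -> R -> Prop) : Prop :=
  G vzero 0 /\ (forall x r y s, G x r -> G y s -> G (vadd x y) (r + s)) /\
  (forall a x r, G x r -> G (vscal a x) (a * r)) /\ (forall x r, G x r -> r <= C * vnorm x).

Lemma lin_graph_fun C G x r s : lin_graph C G -> G x r -> G x s -> r = s.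
Proof.
  intros (H0 & HA & HS & HN) H1 H2.
  assert (HD : forall r s, G x r -> G x s -> r <= s).
  { clear r s H1 H2. intros r s H1 H2. assert (H : G vzero (r - s)).
    { replace vzero with (vadd x (vscal (-1) x)) by vlin.
      replace (r - s) with (r + (-1) * s) by ring. apply HA; auto. }
    apply HN in H. rewrite nrm_0 in H. lra. }
  apply Rle_antisym; auto.
Qed.

(** The value [c] at [z] must lie above all [s - C * vnorm (vsub y z)] and below all
    [C * vnorm (vadd y z) - s] for [(y, s)] in [G]. The triangle inequality puts each lower bound
    under each upper bound, and [c] is the supremum of the lower ones. *)
Lemma lin_graph_step C G z : 0 <= C -> lin_graph C G ->
  exists c, lin_graph C (fun x r => exists y s t, G y s /\ x = vadd y (vscal t z) /\ r = s + t * c).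
Proof.
  intros HC (H0 & HA & HS & HN).
  set (E := fun t => exists y s, G y s /\ t = s - C * vnorm (vsub y z)).
  assert (HE : forall y s, G y s -> forall t, E t -> t <= C * vnorm (vadd y z) - s).
  { intros y s Hy t [y' [s' [Hy' ->]]].
    assert (H := HN _ _ (HA _ _ _ _ Hy Hy')).
    assert (vnorm (vadd y y') <= vnorm (vadd y z) + vnorm (vsub y' z)).
    { replace (vadd y y') with (vadd (vadd y z) (vsub y' z)) by vlin. apply nrm_add. }
    nra. }
  destruct (completeness E) as [c [Hc1 Hc2]].
  - exists (C * vnorm (vadd vzero z) - 0). intros t Ht. now apply HE.
  - exists (0 - C * vnorm (vsub vzero z)), vzero, 0. now split.
  - exists c. split; [|split; [|split]].
    + exists vzero, 0, 0. repeat split; [exact H0|vlin|ring].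
    + intros x r x' r' [y [s [t [Hy [-> ->]]]]] [y' [s' [t' [Hy' [-> ->]]]]].
      exists (vadd y y'), (s + s'), (t + t'). repeat split; [now apply HA|vlin|ring].
    + intros a x r [y [s [t [Hy [-> ->]]]]].
      exists (vscal a y), (a * s), (a * t). repeat split; [now apply HS|vlin|ring].
    + intros x r [y [s [t [Hy [-> ->]]]]].
      (* Dividing by the absolute value of [t] reduces to the coefficient [-1], where [c] is above
         the lower bounds, or [1], where it is below the upper bounds. *)
      destruct (Rtotal_order t 0) as [Ht|[->|Ht]].
      * assert (Hb : E ((/ -t) * s - C * vnorm (vsub (vscal (/ - t) y) z))).
        { exists (vscal (/ - t) y), (/ - t * s). split; [now apply HS|reflexivity]. }
        apply Hc1 in Hb.
        assert (He : vnorm (vadd y (vscal t z)) = - t * vnorm (vsub (vscal (/ - t) y) z)).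
        { rewrite <- nrm_scal_pos by lra. f_equal. vcoefs; field; lra. }
        rewrite He. apply Rmult_le_compat_l with (r := - t) in Hb; [|lra].
        rewrite Rmult_minus_distr_l, <- Rmult_assoc, Rinv_r in Hb by lra. lra.
      * replace (vadd y (vscal 0 z)) with y by vlin. apply HN in Hy. lra.
      * assert (Hb : c <= C * vnorm (vadd (vscal (/ t) y) z) - / t * s).
        { apply Hc2. intros u Hu. apply HE; [now apply HS|exact Hu]. }
        assert (He : vnorm (vadd y (vscal t z)) = t * vnorm (vadd (vscal (/ t) y) z)).
        { rewrite <- nrm_scal_pos by lra. f_equal. vcoefs; field; lra. }
        rewrite He. apply Rmult_le_compat_l with (r := t) in Hb; [|lra].
        rewrite Rmult_minus_distr_l, <- Rmult_assoc, <- Rmult_assoc, Rinv_r in Hb by lra. lra.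
Qed.

Lemma hahn_banach C G : 0 <= C -> lin_graph C G ->
  exists f : Dual V, (forall x r, G x r -> ap f x = r) /\ vnorm f <= C.
Proof.
  intros HC HG.
  (* Zorn's lemma is applied to the set [A] of pairs added to [G], not to the graph itself: the
     chain may be empty, and its empty union must still satisfy the property. *)
  set (ext := fun (A : V * R -> Prop) x r => A (x, r) \/ G x r).
  destruct (classical_sets.Zorn_bigcup (T := V * R) (P := fun A => lin_graph C (ext A))) as [A [HA Hmax]].
  { intros F HF Htot.
    assert (Hcase : forall x r, ext (classical_sets.bigcup F (fun X => X)) x r ->
              G x r \/ exists A, F A /\ A (x, r)).
    { intros x r [[A HA HAx]|H]; [right; now exists A|now left]. }
    assert (Hin : forall A x r, F A -> ext A x r -> ext (classical_sets.bigcup F (fun X => X)) x r).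
    { intros A x r HA [H|H]; [left; now exists A|now right]. }
    split; [|split; [|split]].
    - right. apply HG.
    - intros x r y s Hx Hy.
      destruct (Hcase _ _ Hx) as [Hx'|[A [HA HAx]]], (Hcase _ _ Hy) as [Hy'|[B [HB HBy]]].
      + right. now apply HG.
      + apply (Hin B); auto. apply (HF B HB); [now right|now left].
      + apply (Hin A); auto. apply (HF A HA); [now left|now right].
      + destruct (Htot A B HA HB) as [H|H].
        * apply (Hin B); auto. apply (HF B HB); left; auto.
        * apply (Hin A); auto. apply (HF A HA); left; auto.
    - intros a x r Hx. destruct (Hcase _ _ Hx) as [Hx'|[A [HA HAx]]].
      + right. now apply HG.
      + apply (Hin A); auto. apply (HF A HA). now left.
    - intros x r Hx. destruct (Hcase _ _ Hx) as [Hx'|[A [HA HAx]]].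
      + now apply HG.
      + apply (HF A HA). now left. }
  assert (Hdom : forall z, exists r, ext A z r).
  { intros z. apply NNPP. intros Hz.
    destruct (lin_graph_step C (ext A) z HC HA) as [c Hc].
    set (B := fun p : V * R => exists y s t, ext A y s /\ fst p = vadd y (vscal t z) /\ snd p = s + t * c).
    assert (HsB : forall x r, ext A x r -> B (x, r)).
    { intros x r Hx. exists x, r, 0. repeat split; simpl; [exact Hx|vlin|ring]. }
    apply (Hmax B).
    - split.
      + intros [x r] Hx. apply HsB. now left.
      + intros H. apply Hz. exists c. left. apply H.
        exists vzero, 0, 1. repeat split; simpl; [apply HA|vlin|ring].
    - assert (He : ext B = fun x r => B (x, r)).
      { apply functional_extensionality; intros x. apply functional_extensionality; intros r.
        apply propositional_extensionality. unfold ext at 1. split; [|now left].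
        intros [H|H]; [exact H|]. apply HsB. now right. }
      rewrite He. exact Hc. }
  destruct (func_choice _ Hdom) as [f Hf].
  destruct HA as (H0 & HAd & HS & HN) eqn:EA. clear EA.
  assert (HA' : lin_graph C (ext A)) by (repeat split; assumption).
  assert (Hb : bounded_functional f).
  { split; [|split].
    - intros x y. eapply lin_graph_fun; [exact HA'|apply Hf|]. apply HAd; apply Hf.
    - intros a x. eapply lin_graph_fun; [exact HA'|apply Hf|]. apply HS; apply Hf.
    - exists C. intros x. apply Rabs_le. split; [|apply HN, Hf].
      assert (H := HN _ _ (HS (-1) _ _ (Hf x))). rewrite nrm_scal, Rabs_m1 in H. lra. }
  exists (dmk f Hb). split.
  - intros x r Hx. eapply lin_graph_fun; [exact HA'|apply Hf|]. now right.
  - apply dnorm_le; [exact HC|]. intros x. apply HN, Hf.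
Qed.

Lemma closed_dist (W : V -> Prop) v : closed_set W -> ~ W v ->
  exists d, 0 < d /\ forall w, W w -> d <= vnorm (vsub v w).
Proof.
  intros Hc Hv. apply NNPP. intros H. apply Hv.
  assert (H' : forall n, exists w, W w /\ vnorm (vsub v w) < / INR (S n)).
  { intros n. apply NNPP. intros Hn. apply H. exists (/ INR (S n)).
    split; [apply inv_INR_pos|]. intros w Hw. apply Rnot_lt_le. intros Hlt. apply Hn. now exists w. }
  destruct (func_choice _ H') as [u Hu]. apply (Hc u); [apply Hu|].
  intros eps Heps. destruct (inv_INR_small eps Heps) as [N HN]. exists N. intros n Hn.
  rewrite nrm_subC. eapply Rlt_trans; [apply Hu|now apply HN].
Qed.

(** If [d] bounds the distance from [v] to [W] from below, then sending [w + r * v] to [r] is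
    bounded by [/ d], so Hahn-Banach applies. *)
Lemma hb_separate (W : V -> Prop) v : subspace W -> closed_set W -> ~ W v ->
  exists f : Dual V, (forall w, W w -> ap f w = 0) /\ ap f v = 1.
Proof.
  intros (W0 & WA & WS) Hc Hv. destruct (closed_dist W v Hc Hv) as [d [Hd HdW]].
  destruct (hahn_banach (/ d) (fun x r => exists w, W w /\ x = vadd w (vscal r v))) as [f [Hf _]].
  - left. now apply Rinv_0_lt_compat.
  - split; [|split; [|split]].
    + exists vzero. split; [exact W0|vlin].
    + intros x r y s [w [Hw ->]] [w' [Hw' ->]]. exists (vadd w w'). split; [now apply WA|vlin].
    + intros a x r [w [Hw ->]]. exists (vscal a w). split; [now apply WS|vlin].
    + intros x r [w [Hw ->]]. destruct (Rle_lt_dec r 0) as [Hr|Hr].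
      * apply Rle_trans with 0; [exact Hr|]. apply Rmult_le_pos; [left; now apply Rinv_0_lt_compat|apply nrm_ge0].
      * assert (H := HdW _ (WS (- / r) _ Hw)).
        assert (He : vnorm (vadd w (vscal r v)) = r * vnorm (vsub v (vscal (- / r) w))).
        { rewrite <- nrm_scal_pos by lra. f_equal. vcoefs; field; lra. }
        rewrite He. replace r with (/ d * (r * d)) at 1 by (field; lra).
        apply Rmult_le_compat_l; [left; now apply Rinv_0_lt_compat|]. nra.
  - exists f. split.
    + intros w Hw. apply Hf. exists w. split; [exact Hw|vlin].
    + apply Hf. exists vzero. split; [exact W0|vlin].
Qed.

Lemma zero_closed : closed_set (fun x : V => x = vzero).
Proof.
  intros u l Hu Hl. apply nrm_eq0. apply Rle_antisym; [|apply nrm_ge0].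
  apply le_epsilon. intros eps Heps. destruct (Hl eps Heps) as [N HN].
  specialize (HN N (le_n N)). rewrite Hu in HN. rewrite Rplus_0_l. left.
  replace (vnorm l) with (vnorm (vsub vzero l)); [exact HN|]. rewrite nrm_subC. f_equal. vlin.
Qed.

Lemma zero_subspace : subspace (fun x : V => x = vzero).
Proof. split; [reflexivity|split]; intros; subst; vlin. Qed.
End HahnBanach.

(** * Finite rank projections *)

Definition frame (V : NSpace) := list (Dual V * V).

Fixpoint pj {V : NSpace} (l : frame V) (x : V) : V :=
  match l with
  | nil => vzero
  | c :: l => vadd (vscal (ap (fst c) x) (snd c)) (pj l x)
  end.

(* For [good l], [pj l] is a bounded projection onto [rg l] with kernel [kr l]. *)
Definition good {V : NSpace} (l : frame V) : Prop :=
  forall c, In c l -> forall x, ap (fst c) (pj l x) = ap (fst c) x.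
Definition rg {V : NSpace} (l : frame V) (x : V) : Prop := pj l x = x.
Definition kr {V : NSpace} (l : frame V) (x : V) : Prop := pj l x = vzero.

Section Frames.
Context {V : NSpace} {HV : is_normed V}.
Implicit Types (l : frame V) (x y v w : V) (f : Dual V).

Lemma pj_add l x y : pj l (vadd x y) = vadd (pj l x) (pj l y).
Proof. induction l as [|c l IH]; simpl; [vlin|]. rewrite IH, ap_add. vlin. Qed.
Lemma pj_scal l a x : pj l (vscal a x) = vscal a (pj l x).
Proof. induction l as [|c l IH]; simpl; [vlin|]. rewrite IH, ap_scal. vlin. Qed.
Lemma pj_sub l x y : pj l (vsub x y) = vsub (pj l x) (pj l y).
Proof. unfold vsub. rewrite <- !vscalN1, pj_add, pj_scal. reflexivity. Qed.
Lemma pj_0 l : pj l vzero = vzero.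
Proof. rewrite <- (vscal0 vzero), pj_scal. vlin. Qed.

Lemma pj_bound l : exists C, 0 < C /\ forall x, vnorm (pj l x) <= C * vnorm x.
Proof.
  induction l as [|c l [C [HC IH]]]; simpl.
  - exists 1. split; [lra|]. intros x. rewrite nrm_0. assert (H := nrm_ge0 x). lra.
  - assert (H1 := dnorm_ge0 (fst c)). assert (H2 := nrm_ge0 (snd c)).
    exists (vnorm (fst c) * vnorm (snd c) + C). split; [nra|]. intros x.
    eapply Rle_trans; [apply nrm_add|]. rewrite nrm_scal, Rmult_plus_distr_r.
    apply Rplus_le_compat; [|apply IH].
    replace (vnorm (fst c) * vnorm (snd c) * vnorm x) with (vnorm (fst c) * vnorm x * vnorm (snd c)) by ring.
    apply Rmult_le_compat_r; [exact H2|apply ap_le].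
Qed.

Lemma pj_agree l x y : (forall c, In c l -> ap (fst c) x = ap (fst c) y) -> pj l x = pj l y.
Proof.
  induction l as [|c l IH]; simpl; intros H; [reflexivity|].
  rewrite (H c), IH; auto.
Qed.

Lemma pj_idem l x : good l -> pj l (pj l x) = pj l x.
Proof. intros H. apply pj_agree. intros c Hc. now apply H. Qed.
Lemma kr_res l x : good l -> kr l (vsub x (pj l x)).
Proof. intros H. unfold kr. rewrite pj_sub, pj_idem by exact H. vlin. Qed.
Lemma kr_ap l x c : good l -> kr l x -> In c l -> ap (fst c) x = 0.
Proof. intros H Hx Hc. rewrite <- (H c Hc x), Hx. apply ap_0. Qed.

Lemma rg_subspace l : subspace (rg l).
Proof.
  unfold rg. split; [apply pj_0|split].
  - intros x y Hx Hy. now rewrite pj_add, Hx, Hy.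
  - intros a x Hx. now rewrite pj_scal, Hx.
Qed.
Lemma kr_subspace l : subspace (kr l).
Proof.
  unfold kr. split; [apply pj_0|split].
  - intros x y Hx Hy. rewrite pj_add, Hx, Hy. vlin.
  - intros a x Hx. rewrite pj_scal, Hx. vlin.
Qed.
Lemma rg_sub l x y : rg l x -> rg l y -> rg l (vsub x y).
Proof. unfold rg. intros Hx Hy. now rewrite pj_sub, Hx, Hy. Qed.
Lemma subspace_pj (S : V -> Prop) l x : subspace S -> (forall c, In c l -> S (snd c)) -> S (pj l x).
Proof.
  intros (S0 & SA & SS). induction l as [|c l IH]; simpl; intros H; [exact S0|].
  apply SA; [apply SS; auto|auto].
Qed.

Definition comp_pj l f : V -> R := fun x => ap f (pj l x).
Lemma comp_pj_bounded l f : bounded_functional (comp_pj l f).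
Proof.
  split; [|split]; unfold comp_pj.
  - intros x y. now rewrite pj_add, ap_add.
  - intros a x. now rewrite pj_scal, ap_scal.
  - destruct (pj_bound l) as [C [HC H]]. exists (vnorm f * C). intros x.
    eapply Rle_trans; [apply ap_le|]. rewrite Rmult_assoc.
    apply Rmult_le_compat_l; [apply dnorm_ge0|apply H].
Qed.
Definition adj l f : Dual V := dmk (comp_pj l f) (comp_pj_bounded l f).
Lemma ap_adj l f x : ap (adj l f) x = ap f (pj l x).
Proof. reflexivity. Qed.

Lemma good_nil : good (nil : frame V).
Proof. intros c []. Qed.

(** One construction with two uses: with [W] zero it enlarges the range of a frame, and with [W] of
    finite codimension it builds a frame whose kernel lies in [W]. If the residue of [v] is not in
    [W], a functional separating it from [W] supplies the new pair. *)
Lemma frame_add_vector (W : V -> Prop) l v : subspace W -> closed_set W -> good l ->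
  (forall c, In c l -> forall w, W w -> ap (fst c) w = 0) ->
  exists l', good l' /\ (forall c, In c l' -> forall w, W w -> ap (fst c) w = 0) /\
    (forall x, W (vsub x (pj l x)) -> W (vsub x (pj l' x))) /\ W (vsub v (pj l' v)).
Proof.
  intros HW Wc Hl Hl0.
  assert (HlW : forall w, W w -> pj l w = vzero).
  { intros w Hw. rewrite <- (pj_0 l). apply pj_agree. intros c Hc. rewrite ap_0. now apply Hl0. }
  destruct (classic (W (vsub v (pj l v)))) as [Hv|Hv]; [now exists l|].
  destruct (hb_separate W _ HW Wc Hv) as [f [Hf0 Hf1]].
  (* [g] is [f] made to vanish on the range of [pj l], and [v'] lies in the kernel of [pj l]. The
     new pair is thus biorthogonal to the old ones, and [good] is preserved. *)
  set (g := vsub f (adj l f)). set (v' := vsub v (pj l v)).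
  assert (Hg : forall x, ap g x = ap f (vsub x (pj l x))).
  { intros x. unfold g. now rewrite ap_vsub, ap_adj, ap_sub. }
  assert (Hv' : pj l v' = vzero) by now apply kr_res.
  assert (Hgv : ap g v' = 1).
  { rewrite Hg, Hv'. rewrite <- Hf1. f_equal. unfold v'. vlin. }
  assert (Hgp : forall x, ap g (pj l x) = 0).
  { intros x. rewrite Hg, pj_idem by exact Hl. rewrite <- (ap_0 f). f_equal. vlin. }
  exists ((g, v') :: l). split; [|split; [|split]].
  - intros c [<-|Hc] x; cbn [pj fst snd]; rewrite ap_add, ap_scal.
    + rewrite Hgv, Hgp. ring.
    + unfold v'. rewrite ap_sub, !Hl by exact Hc. ring.
  - intros c [<-|Hc] w Hw; cbn [pj fst snd]; [|now apply Hl0].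
    rewrite Hg. apply Hf0. rewrite HlW by exact Hw. replace (vsub w vzero) with w by vlin. exact Hw.
  - intros x Hx. cbn [pj fst snd]. rewrite Hg, Hf0 by exact Hx.
    replace (vsub x _) with (vsub x (pj l x)) by vlin. exact Hx.
  - cbn [pj fst snd]. rewrite Hg, Hf1. unfold v'.
    replace (vsub v _) with (vzero : V) by vlin. apply HW.
Qed.

Lemma frame_add_vectors (W : V -> Prop) l (L : list V) : subspace W -> closed_set W -> good l ->
  (forall c, In c l -> forall w, W w -> ap (fst c) w = 0) ->
  exists l', good l' /\ (forall c, In c l' -> forall w, W w -> ap (fst c) w = 0) /\
    (forall x, W (vsub x (pj l x)) -> W (vsub x (pj l' x))) /\ forall v, In v L -> W (vsub v (pj l' v)).
Proof.
  intros HW Wc Hl Hl0. induction L as [|v L (l1 & H1 & H2 & H3 & H4)].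
  - exists l. repeat split; auto. intros v [].
  - destruct (frame_add_vector W l1 v HW Wc H1 H2) as (l2 & K1 & K2 & K3 & K4).
    exists l2. repeat split; auto. intros x [<-|Hx]; auto.
Qed.

(** The case where [W] is zero: a residue in [W] then means membership in the range. *)
Lemma frame_span l (L : list V) : good l ->
  exists l', good l' /\ (forall x, rg l x -> rg l' x) /\ forall v, In v L -> rg l' v.
Proof.
  intros Hl. destruct (frame_add_vectors _ l L zero_subspace zero_closed Hl) as (l' & H1 & _ & H2 & H3).
  - intros c _ w ->. apply ap_0.
  - exists l'. split; [exact H1|]. split.
    + intros x Hx. symmetry. apply vsub_eq0, H2. rewrite Hx. vlin.
    + intros v Hv. symmetry. apply vsub_eq0. auto.
Qed.

Lemma frame_span_frame l l2 : good l ->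
  exists l', good l' /\ (forall x, rg l x -> rg l' x) /\ forall x, rg l' (pj l2 x).
Proof.
  intros Hl. destruct (frame_span l (map snd l2) Hl) as (l' & H1 & H2 & H3).
  exists l'. repeat split; auto. intros x. apply subspace_pj; [apply rg_subspace|].
  intros c Hc. apply H3. now apply in_map.
Qed.

Lemma vsum_in (S : V -> Prop) (u : nat -> V) n : subspace S -> (forall k, (k < n)%nat -> S (u k)) -> S (vsum u n).
Proof.
  intros (S0 & SA & SS). induction n as [|n IH]; simpl; intros H; [exact S0|]. apply SA; auto.
Qed.

(** The residue [x - pj l x] lies in [W] for each vector spanning a complement, by construction, and
    for each [x] in [W], where all the functionals of the frame vanish. By linearity it lies in [W]
    for every [x], and on the kernel the residue is [x] itself. *)
Lemma frame_of_finite_codim (W : V -> Prop) : subspace W -> closed_set W -> finite_codim W ->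
  exists l, good l /\ forall x, kr l x -> W x.
Proof.
  intros HW Wc (m & v & Hv).
  destruct (frame_add_vectors W nil (map v (seq 0 m)) HW Wc good_nil) as (l & H1 & H2 & _ & H3).
  - intros c [].
  - exists l. split; [exact H1|]. intros x Hx.
    assert (HSW : subspace (fun y => W (vsub y (pj l y)))).
    { destruct HW as (W0 & WA & WS). split; [|split].
      - rewrite pj_0. replace (vsub vzero vzero) with (vzero : V) by vlin. exact W0.
      - intros a b Ha Hb. rewrite pj_add.
        replace (vsub _ _) with (vadd (vsub a (pj l a)) (vsub b (pj l b))) by vlin. now apply WA.
      - intros t a Ha. rewrite pj_scal.
        replace (vsub _ _) with (vscal t (vsub a (pj l a))) by vlin. now apply WS. }
    assert (H : W (vsub x (pj l x))).
    { destruct (Hv x) as (w & a & Hw & ->). apply HSW.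
      - replace (pj l w) with (vzero : V).
        + replace (vsub w vzero) with w by vlin. exact Hw.
        + symmetry. rewrite <- (pj_0 l). apply pj_agree. intros c Hc. rewrite ap_0. now apply H2.
      - apply (vsum_in _ _ _ HSW). intros k Hk. apply HSW. apply H3.
        apply in_map, in_seq. lia. }
    rewrite Hx in H. replace (vsub x vzero) with x in H by vlin. exact H.
Qed.

(** Only the part [g] of [f] that vanishes on the range of [pj l] matters. If it is zero, then [f]
    vanishes on the kernel already; otherwise [g] and a vector of the kernel where it equals 1 are
    added. *)
Lemma frame_add_functional l f : good l ->
  exists l', good l' /\ (forall x, kr l' x -> kr l x) /\ (forall x, kr l' x -> ap f x = 0).
Proof.
  intros Hl. set (g := vsub f (adj l f)).
  assert (Hg : forall x, ap g x = ap f (vsub x (pj l x))).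
  { intros x. unfold g. now rewrite ap_vsub, ap_adj, ap_sub. }
  destruct (classic (exists u, ap g u <> 0)) as [[u0 Hu0]|Hz].
  - set (u := vscal (/ ap g u0) u0).
    assert (Hu : ap g u = 1) by (unfold u; rewrite ap_scal; field; exact Hu0).
    assert (Hgp : forall x, ap g (pj l x) = 0).
    { intros x. rewrite Hg, pj_idem by exact Hl. rewrite <- (ap_0 f). f_equal. vlin. }
    set (l' := (g, vsub u (pj l u)) :: l).
    assert (Hgood : good l').
    { intros c [<-|Hc] x; unfold l'; cbn [pj fst snd]; rewrite ap_add, ap_scal, ap_sub.
      - rewrite Hu, !Hgp. ring.
      - rewrite !Hl by exact Hc. ring. }
    exists l'. split; [exact Hgood|].
    assert (HK : forall x, kr l' x -> kr l x).
    { intros x Hx. unfold kr. rewrite <- (pj_0 l). apply pj_agree. intros c Hc. rewrite ap_0.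
      apply (kr_ap l'); auto. now right. }
    split; [exact HK|]. intros x Hx.
    assert (H := kr_ap l' x (g, vsub u (pj l u)) Hgood Hx (or_introl eq_refl)). cbn [fst] in H.
    rewrite Hg, (HK x Hx) in H. replace (vsub x vzero) with x in H by vlin. exact H.
  - exists l. repeat split; auto. intros x Hx.
    assert (H : ap g x = 0) by (apply NNPP; intros H; apply Hz; now exists x).
    rewrite Hg, Hx in H. replace (vsub x vzero) with x in H by vlin. exact H.
Qed.

Lemma frame_kr_inter l l2 : good l -> good l2 ->
  exists l', good l' /\ (forall x, kr l' x -> kr l x) /\ (forall x, kr l' x -> kr l2 x).
Proof.
  intros Hl Hl2.
  assert (H : forall L : list (Dual V), exists l', good l' /\ (forall x, kr l' x -> kr l x) /\
             forall f, In f L -> forall x, kr l' x -> ap f x = 0).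
  { induction L as [|f L (l1 & H1 & H2 & H3)].
    - exists l. repeat split; auto. intros f [].
    - destruct (frame_add_functional l1 f H1) as (l' & K1 & K2 & K3).
      exists l'. repeat split; auto. intros g [<-|Hg]; auto. }
  destruct (H (map fst l2)) as (l' & H1 & H2 & H3). exists l'. repeat split; auto.
  intros x Hx. unfold kr. rewrite <- (pj_0 l2). apply pj_agree. intros c Hc. rewrite ap_0.
  apply H3; auto. now apply in_map.
Qed.

(** A grid in each coordinate. The net approximates projections and need not meet the set of
    interest; [finite_net] corrects that. *)
Lemma frame_nets l C eps : 0 <= C -> 0 < eps ->
  exists L : list V, forall x, (forall c, In c l -> Rabs (ap (fst c) x) <= C) ->
    exists y, In y L /\ vnorm (vsub (pj l x) y) <= eps.
Proof.
  intros HC. revert eps. induction l as [|[f u] l IH]; intros eps Heps; cbn [pj fst snd].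
  - exists [vzero]. intros x _. exists vzero. split; [now left|].
    replace (vsub vzero vzero) with (vzero : V) by vlin. rewrite nrm_0. lra.
  - destruct (IH (eps / 2)) as [L HL]; [lra|].
    assert (Hu := nrm_ge0 u). destruct (small_multiple _ (eps / 2) Hu) as (eta & Heta & Hue); [lra|].
    set (N := Z.to_nat (up (2 * C / eta))).
    set (grid := map (fun k => - C + INR k * eta) (seq 0 (S N))).
    assert (Hgrid : forall a, Rabs a <= C -> exists b, In b grid /\ Rabs (a - b) <= eta).
    { intros a Ha. apply Rabs_le_iff in Ha.
      set (z := Int_part ((a + C) / eta)).
      destruct (base_Int_part ((a + C) / eta)) as [Hz1 Hz2]. fold z in Hz1, Hz2.
      assert (H0 : 0 <= (a + C) / eta).
      { apply Rmult_le_pos; [lra|]. left. now apply Rinv_0_lt_compat. }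
      assert (Hz0 : (0 <= z)%Z) by (assert (IZR (-1) < IZR z) by (simpl; lra); apply lt_IZR in H; lia).
      assert (H1 : (a + C) / eta <= 2 * C / eta).
      { apply Rmult_le_compat_r; [left; now apply Rinv_0_lt_compat|lra]. }
      destruct (archimed (2 * C / eta)) as [Hup _].
      assert (HzN : (z < up (2 * C / eta))%Z) by (apply lt_IZR; lra).
      exists (- C + INR (Z.to_nat z) * eta). split.
      - apply in_map_iff. exists (Z.to_nat z). split; [reflexivity|]. apply in_seq. unfold N. lia.
      - rewrite INR_IZR_INZ, Z2Nat.id by exact Hz0.
        assert (Ha' : (a + C) / eta * eta = a + C) by (field; lra).
        apply Rabs_le. split; nra. }
    exists (flat_map (fun b => map (fun y => vadd (vscal b u) y) L) grid).
    intros x Hx. destruct (HL x) as [y [Hy1 Hy2]]; [intros c Hc; apply Hx; now right|].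
    destruct (Hgrid (ap f x)) as [b [Hb1 Hb2]]; [apply (Hx (f, u)); now left|].
    exists (vadd (vscal b u) y). split.
    + apply in_flat_map. exists b. split; [exact Hb1|]. apply in_map_iff. now exists y.
    + replace (vsub _ _) with (vadd (vscal (ap f x - b) u) (vsub (pj l x) y)) by vlin.
      eapply Rle_trans; [apply nrm_add|]. rewrite nrm_scal.
      assert (Rabs (ap f x - b) * vnorm u <= eta * vnorm u) by (apply Rmult_le_compat_r; lra). lra.
Qed.

(** A net of mesh [eps / 2] is taken first, and each of its points close to some element of [S] is
    replaced by such an element, which doubles the mesh. *)
Lemma finite_net l C (S : V -> Prop) eps : 0 <= C -> (forall x, S x -> rg l x /\ vnorm x <= C) -> 0 < eps ->
  exists L : list V, (forall y, In y L -> S y) /\ forall x, S x -> exists y, In y L /\ vnorm (vsub x y) <= eps.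
Proof.
  intros HC HS Heps.
  assert (Hl : exists M, 0 <= M /\ forall c, In c l -> vnorm (fst c) <= M).
  { clear HS. induction l as [|c l' [M [HM IH]]]; [exists 0; split; [lra|intros c []]|].
    exists (M + vnorm (fst c)). assert (H := dnorm_ge0 (fst c)). split; [lra|].
    intros d [<-|Hd]; [lra|]. specialize (IH d Hd). lra. }
  destruct Hl as [M [HM HlM]].
  destruct (frame_nets l (M * C) (eps / 2)) as [L HL]; [nra|lra|].
  assert (HL' : forall x, S x -> exists y, In y L /\ vnorm (vsub x y) <= eps / 2).
  { intros x Hx. destruct (HS x Hx) as [Hr Hn]. destruct (HL x) as [y Hy].
    - intros c Hc. apply ap_le_bd; auto.
    - exists y. rewrite Hr in Hy. exact Hy. }
  clear HL. revert S HS HL'. induction L as [|y L IH]; intros S HS HL'.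
  - exists nil. split; [intros y []|]. intros x Hx. destruct (HL' x Hx) as [y [[] _]].
  (* The points of [S] near [y] are removed from [S], so that the rest of the net serves the
     remaining ones. *)
  - destruct (IH (fun x => S x /\ ~ vnorm (vsub x y) <= eps / 2)) as [L' [H1 H2]].
    + intros x [Hx _]. auto.
    + intros x [Hx Hxy]. destruct (HL' x Hx) as [z [[<-|Hz] Hxz]]; [contradiction|]. now exists z.
    + destruct (classic (exists z, S z /\ vnorm (vsub z y) <= eps / 2)) as [[z [Hz Hzy]]|Hno].
      * exists (z :: L'). split.
        -- intros x [<-|Hx]; [exact Hz|]. now apply H1.
        -- intros x Hx. destruct (Rle_dec (vnorm (vsub x y)) (eps / 2)) as [Hxy|Hxy].
           ++ exists z. split; [now left|]. eapply Rle_trans; [apply (nrm_sub_tri x y z)|].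
              rewrite (nrm_subC y z). lra.
           ++ destruct (H2 x (conj Hx Hxy)) as [y' [Hy' Hxy']]. exists y'. split; [now right|exact Hxy'].
      * exists L'. split; [intros x Hx; now apply H1|]. intros x Hx. apply H2. split; [exact Hx|].
        intros Hxy. apply Hno. now exists x.
Qed.

Lemma converges_unique (u : nat -> V) a b : converges_to u a -> converges_to u b -> a = b.
Proof.
  intros Ha Hb. apply vsub_eq0, nrm_eq0. apply Rle_antisym; [|apply nrm_ge0].
  apply le_epsilon. intros eps Heps. destruct (Ha (eps / 2)) as [N HN]; [lra|].
  destruct (Hb (eps / 2)) as [M HM]; [lra|].
  specialize (HN (max N M) ltac:(lia)). specialize (HM (max N M) ltac:(lia)).
  assert (H := nrm_sub_tri a (u (max N M)) b). rewrite (nrm_subC a (u _)) in H. lra.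
Qed.

Lemma converges_pj l (x : nat -> V) :
  (forall c, In c l -> exists t, Un_cv (fun n => ap (fst c) (x n)) t) ->
  exists z, converges_to (fun n => pj l (x n)) z.
Proof.
  induction l as [|[f u] l IH]; intros H; simpl.
  - exists vzero. intros eps Heps. exists O. intros n _.
    replace (vsub vzero vzero) with (vzero : V) by vlin. rewrite nrm_0. lra.
  - destruct IH as [z Hz]; [intros c Hc; apply H; now right|].
    destruct (H (f, u)) as [t Ht]; [now left|]. simpl in Ht.
    exists (vadd (vscal t u) z). intros eps Heps.
    assert (Hu := nrm_ge0 u). destruct (small_multiple _ (eps / 2) Hu) as (eta & Heta & Hue); [lra|].
    destruct (Hz (eps / 2)) as [N HN]; [lra|]. destruct (Ht eta Heta) as [M HM].
    exists (max N M). intros n Hn. specialize (HN n ltac:(lia)). specialize (HM n ltac:(lia)).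
    unfold R_dist in HM.
    replace (vsub _ _) with (vadd (vscal (ap f (x n) - t) u) (vsub (pj l (x n)) z)) by vlin.
    eapply Rle_lt_trans; [apply nrm_add|]. rewrite nrm_scal.
    assert (Rabs (ap f (x n) - t) * vnorm u <= eta * vnorm u) by (apply Rmult_le_compat_r; lra). lra.
Qed.

(** The extraction runs over the functionals of all frames at once, enumerated by Cantor's pairing,
    with a zero pair as default beyond the end of a list. *)
Lemma diag_frames (l : nat -> frame V) (x : nat -> nat -> V) :
  (forall j, exists M, forall n, vnorm (x j n) <= M) ->
  exists (s : nat -> nat) (z : nat -> V), (forall n, (s n < s (S n))%nat) /\
    forall j, converges_to (fun n => pj (l j) (x j (s n))) (z j).
Proof.
  intros Hb. set (d := (vzero, vzero) : Dual V * V).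
  destruct (diag_reals (fun k n => ap (fst (nth (snd (of_nat k)) (l (fst (of_nat k))) d)) (x (fst (of_nat k)) n)))
    as (s & t & Hs & Ht).
  { intros k. destruct (Hb (fst (of_nat k))) as [M HM].
    exists (vnorm (fst (nth (snd (of_nat k)) (l (fst (of_nat k))) d)) * M). intros n.
    apply ap_le_bd; [lra|apply HM]. }
  assert (H : forall j, exists z, converges_to (fun n => pj (l j) (x j (s n))) z).
  { intros j. apply converges_pj. intros c Hc. destruct (In_nth _ _ d Hc) as (i & Hi & Hic).
    exists (t (to_nat (j, i))). specialize (Ht (to_nat (j, i))). rewrite cancel_of_to in Ht.
    cbn [fst snd] in Ht. rewrite Hic in Ht. exact Ht. }
  destruct (func_choice _ H) as [z Hz]. now exists s, z.
Qed.

Lemma converges_sub_bound (u : nat -> V) a : converges_to u a ->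
  forall eps, 0 < eps -> exists N, forall m n, (N <= m)%nat -> (N <= n)%nat -> vnorm (vsub (u m) (u n)) <= eps.
Proof.
  intros H eps Heps. destruct (H (eps / 2)) as [N HN]; [lra|]. exists N. intros m n Hm Hn.
  assert (H1 := HN m Hm). assert (H2 := HN n Hn).
  assert (H3 := nrm_sub_tri (u m) a (u n)). rewrite (nrm_subC a (u n)) in H3. lra.
Qed.

Lemma rg_closed l : closed_set (rg l).
Proof.
  intros u x Hu Hx. destruct (pj_bound l) as [C [HC HlC]].
  apply (converges_unique u); [|exact Hx]. intros eps Heps.
  destruct (Hx (eps / C)) as [N HN]; [now apply Rdiv_lt_0_compat|]. exists N. intros n Hn.
  rewrite <- (Hu n), <- pj_sub. eapply Rle_lt_trans; [apply HlC|].
  specialize (HN n Hn). apply Rmult_lt_compat_l with (r := C) in HN; [|exact HC].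
  replace (C * (eps / C)) with eps in HN by (field; lra). exact HN.
Qed.
End Frames.

Arguments good_nil {V}.

(** * Convex blocks and alternating sums *)

(** A convex hull generated by mixing two points: properties of convex combinations follow by
    induction, and weights appear only in the translation from and to [convex_block]. *)
Inductive conv {V : NSpace} (A : V -> Prop) : V -> Prop :=
| conv_base x : A x -> conv A x
| conv_mix t x y : 0 <= t <= 1 -> conv A x -> conv A y -> conv A (vadd (vscal t x) (vscal (1 - t) y)).

Definition blk {V : NSpace} (x : nat -> V) (a b : nat) : V -> Prop :=
  conv (fun v => exists j, (a <= j < b)%nat /\ v = x j).

Section Conv.
Context {V : NSpace} {HV : is_normed V}.

Lemma conv_sub (A B : V -> Prop) x : (forall y, A y -> B y) -> conv A x -> conv B x.
Proof. intros H Hx. induction Hx; [apply conv_base; auto|now apply conv_mix]. Qed.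

Lemma blk_sub (x : nat -> V) a b a' b' y : (a' <= a)%nat -> (b <= b')%nat -> blk x a b y -> blk x a' b' y.
Proof. intros Ha Hb. apply conv_sub. intros z (j & Hj & ->). exists j. split; [lia|reflexivity]. Qed.

Lemma conv_in (A S : V -> Prop) x : subspace S -> (forall y, A y -> S y) -> conv A x -> S x.
Proof. intros (S0 & SA & SS) H Hx. induction Hx; auto. Qed.

Lemma conv_norm (A : V -> Prop) M x : (forall y, A y -> vnorm y <= M) -> conv A x -> vnorm x <= M.
Proof.
  intros H Hx. induction Hx; [auto|].
  eapply Rle_trans; [apply nrm_add|]. rewrite !nrm_scal_pos by lra. nra.
Qed.

(** Partial sums, normalized by their total weight, stay in the hull. Those whose weight is still
    zero cannot be normalized and form a separate case. *)
Lemma conv_of_weights (A : V -> Prop) (lam : nat -> R) (x : nat -> V) n :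
  (forall k, (k < n)%nat -> A (x k)) -> (forall k, 0 <= lam k) -> rsum lam n = 1 ->
  conv A (vsum (fun k => vscal (lam k) (x k)) n).
Proof.
  intros HA Hl H1.
  assert (H : forall m, (m <= n)%nat ->
    (rsum lam m = 0 /\ vsum (fun k => vscal (lam k) (x k)) m = vzero) \/
    (0 < rsum lam m /\ conv A (vscal (/ rsum lam m) (vsum (fun k => vscal (lam k) (x k)) m)))).
  { induction m as [|m IH]; intros Hm; [left; split; reflexivity|]. cbn [vsum rsum].
    assert (H0 := Hl m).
    destruct (IH ltac:(lia)) as [[E1 E2]|[E1 E2]].
    - rewrite E1, E2. destruct H0 as [H0|H0].
      + right. split; [lra|].
        replace (vscal _ _) with (x m) by (vcoefs; field; lra). apply conv_base. apply HA. lia.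
      + left. rewrite <- H0. split; [ring|vlin].
    - right. split; [lra|].
      set (s := rsum lam m) in *.
      replace (vscal (/ (s + lam m)) _) with
        (vadd (vscal (s / (s + lam m)) (vscal (/ s) (vsum (fun k => vscal (lam k) (x k)) m)))
              (vscal (1 - s / (s + lam m)) (x m))) by (vcoefs; field; lra).
      apply conv_mix; [|exact E2|apply conv_base, HA; lia].
      assert (Hp : 0 < / (s + lam m)) by (apply Rinv_0_lt_compat; lra).
      split; [apply Rmult_le_pos; lra|].
      apply Rmult_le_reg_r with (s + lam m); [lra|]. unfold Rdiv.
      rewrite Rmult_assoc, Rinv_l; lra. }
  destruct (H n (le_n n)) as [[E _]|[_ E]]; [lra|].
  rewrite H1, Rinv_1, vscal1 in E. exact E.
Qed.

Lemma weights_of_blk (x : nat -> V) a b y : blk x a b y ->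
  exists mu : nat -> R, (forall j, 0 <= mu j) /\ rsum (fun k => mu (a + k)%nat) (b - a) = 1 /\
    y = vsum (fun k => vscal (mu (a + k)%nat) (x (a + k)%nat)) (b - a).
Proof.
  intros H. induction H as [v (j & Hj & ->)|t v w Ht _ (mu & M1 & M2 & M3) _ (nu & N1 & N2 & N3)].
  - exists (fun i => if Nat.eqb j i then 1 else 0).
    assert (He : forall k, (if Nat.eqb j (a + k) then 1 else 0) = (if Nat.eqb (j - a) k then 1 else 0)).
    { intros k. destruct (Nat.eqb_spec j (a + k)), (Nat.eqb_spec (j - a) k); try lia; reflexivity. }
    assert (Hlt : Nat.ltb (j - a) (b - a) = true) by (apply Nat.ltb_lt; lia).
    split; [intros i; destruct (Nat.eqb j i); lra|]. split.
    + rewrite (rsum_ext _ (fun k => (if Nat.eqb (j - a) k then 1 else 0) * 1)).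
      * rewrite rsum_single, Hlt. reflexivity.
      * intros k _. rewrite He. ring.
    + rewrite (vsum_ext _ (fun k => vscal (if Nat.eqb (j - a) k then 1 else 0) (x (a + k)%nat))).
      * rewrite vsum_single, Hlt. f_equal. lia.
      * intros k _. now rewrite He.
  - exists (fun i => t * mu i + (1 - t) * nu i). split; [|split].
    + intros j. specialize (M1 j). specialize (N1 j).
      assert (0 <= t * mu j) by (apply Rmult_le_pos; lra).
      assert (0 <= (1 - t) * nu j) by (apply Rmult_le_pos; lra). lra.
    + rewrite rsum_add, !rsum_scal, M2, N2. ring.
    + rewrite M3, N3, <- !vsum_scal, <- vsum_add. apply vsum_ext. intros k _. vlin.
Qed.

Lemma convex_block_blk (x y : nat -> V) : convex_block x y ->
  exists p : nat -> nat, p O = O /\ (forall n, (p n < p (S n))%nat) /\ forall n, blk x (p n) (p (S n)) (y n).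
Proof.
  intros (p & lam & H0 & Hp & Hl & H1 & Hy). exists p. repeat split; auto. intros n. rewrite Hy.
  apply (conv_of_weights _ (fun k => lam (p n + k)%nat) (fun k => x (p n + k)%nat)); auto.
  intros k Hk. exists (p n + k)%nat. split; [lia|reflexivity].
Qed.

Lemma block_index (p : nat -> nat) : p O = O -> (forall n, (p n < p (S n))%nat) ->
  exists b : nat -> nat, forall n j, (p n <= j < p (S n))%nat -> b j = n.
Proof.
  intros H0 Hp.
  assert (H : forall j, exists n, (p n <= j < p (S n))%nat).
  { induction j as [|j [n Hn]].
    - exists O. specialize (Hp O). lia.
    - destruct (Nat.eq_dec (S j) (p (S n))) as [E|E]; [|exists n; lia].
      exists (S n). specialize (Hp (S n)). lia. }
  destruct (func_choice _ H) as [b Hb]. exists b. intros n j Hj. specialize (Hb j).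
  destruct (Nat.lt_trichotomy (b j) n) as [Hlt|[E|Hlt]]; [|exact E|].
  - assert (p (S (b j)) <= p n)%nat by (apply incr_le; auto; lia). lia.
  - assert (p (S n) <= p (b j))%nat by (apply incr_le; auto; lia). lia.
Qed.

Lemma blk_convex_block (x y : nat -> V) (p : nat -> nat) :
  p O = O -> (forall n, (p n < p (S n))%nat) -> (forall n, blk x (p n) (p (S n)) (y n)) -> convex_block x y.
Proof.
  intros H0 Hp Hy.
  destruct (func_choice _ (fun n => weights_of_blk _ _ _ _ (Hy n))) as [mu Hmu].
  destruct (block_index p H0 Hp) as [b Hb].
  exists p, (fun j => mu (b j) j). repeat split; auto.
  - intros j. apply Hmu.
  - intros n. rewrite <- (proj1 (proj2 (Hmu n))). apply rsum_ext. intros k Hk.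
    rewrite (Hb n) by lia. reflexivity.
  - intros n. rewrite (proj2 (proj2 (Hmu n))). apply vsum_ext. intros k Hk.
    rewrite (Hb n) by lia. reflexivity.
Qed.

Definition alt (y : nat -> V) (r : nat -> nat) (n : nat) : V :=
  vsum (fun j => vscal ((-1) ^ (S j)) (y (r j))) n.

Lemma sign_pow n : (-1) ^ n = 1 \/ (-1) ^ n = -1.
Proof. induction n as [|n [IH|IH]]; simpl; [left|right|left]; try rewrite IH; lra. Qed.

(** The limit only controls long sums. The constant [K] absorbs the sums of fewer than [N] terms, so
    that the estimate holds for every length and the length can be chosen later, in terms of [K]. *)
Lemma wabs_alternating (x : nat -> V) M : WABS V -> (forall n, vnorm (x n) <= M) ->
  exists (y : nat -> V) (p : nat -> nat), p O = O /\ (forall n, (p n < p (S n))%nat) /\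
    (forall n, blk x (p n) (p (S n)) (y n)) /\
    forall eta, 0 < eta -> exists K, 0 <= K /\ forall n r,
      (forall j, (S j < n)%nat -> (r j < r (S j))%nat) -> vnorm (alt y r n) <= eta * INR n + K.
Proof.
  intros HW Hx. destruct (HW x) as (y & Hy & Hlim); [now exists M|].
  destruct (convex_block_blk x y Hy) as (p & H0 & Hp & Hb). exists y, p. repeat split; auto.
  intros eta Heta. destruct (Hlim eta Heta) as [N HN].
  assert (HM : 0 <= M) by (eapply Rle_trans; [apply (nrm_ge0 (x O))|apply Hx]).
  assert (HyM : forall n, vnorm (y n) <= M).
  { intros n. eapply conv_norm; [|apply Hb]. intros z (j & _ & ->). apply Hx. }
  assert (HNp := pos_INR N).
  exists (INR N * M). split; [nra|]. intros n r Hr. assert (Hnp := pos_INR n).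
  destruct (le_lt_dec (max 1 N) n) as [Hn|Hn].
  - specialize (HN n ltac:(lia) ltac:(lia) r Hr). fold (alt y r n) in HN.
    assert (0 < INR n) by (apply lt_0_INR; lia).
    rewrite nrm_scal_pos in HN by (left; now apply Rinv_0_lt_compat).
    apply Rmult_le_compat_l with (r := INR n) in HN; [|lra].
    rewrite <- Rmult_assoc, Rinv_r, Rmult_1_l in HN by lra. nra.
  - assert (vnorm (alt y r n) <= INR n * M).
    { eapply Rle_trans; [apply nrm_vsum|]. rewrite <- rsum_const. apply rsum_le. intros k _.
      rewrite nrm_sign by apply sign_pow. apply HyM. }
    assert (INR n <= INR N) by (destruct n; [simpl; lra|apply le_INR; lia]). nra.
Qed.

(** As the pairs are interleaved, any selection of differences is an alternating sum along
    increasing indices. The first sign of [alt] is [-1], hence the smaller index [b i] carries the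
    minus sign. *)
Lemma alt_of_pairs (y : nat -> V) (I : nat -> bool) (a b : nat -> nat) :
  (forall i, (b i < a i < b (S i))%nat) -> forall n, exists k r, (k <= n)%nat /\
    (forall j, (S j < 2 * k)%nat -> (r j < r (S j))%nat) /\
    (forall j, (j < 2 * k)%nat -> (r j < b n)%nat) /\
    vsum (fun i => if I i then vsub (y (a i)) (y (b i)) else vzero) n = alt y r (2 * k).
Proof.
  intros Hab. induction n as [|n (k & r & Hk & Hr & Hb & IH)].
  - exists O, (fun _ => O). split; [lia|]. split; [intros; lia|]. split; [intros; lia|reflexivity].
  - cbn [vsum]. rewrite IH. destruct (I n).
    + set (r' := fun j => if Nat.ltb j (2 * k) then r j else if Nat.eqb j (2 * k) then b n else a n).
      assert (Hr1 : forall j, (j < 2 * k)%nat -> r' j = r j).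
      { intros j Hj. unfold r'. destruct (Nat.ltb_spec j (2 * k)); [reflexivity|lia]. }
      assert (Hr2 : r' (2 * k)%nat = b n).
      { unfold r'. rewrite Nat.ltb_irrefl, Nat.eqb_refl. reflexivity. }
      assert (Hr3 : r' (S (2 * k)) = a n).
      { unfold r'. destruct (Nat.ltb_spec (S (2 * k)) (2 * k)), (Nat.eqb_spec (S (2 * k)) (2 * k)); lia. }
      exists (S k), r'. assert (Hn := Hab n). split; [lia|]. split; [|split].
      * intros j Hj. destruct (Nat.lt_trichotomy (S j) (2 * k)) as [H|[H|H]].
        -- rewrite !Hr1 by lia. auto.
        -- rewrite H, Hr2, Hr1 by lia. apply Hb. lia.
        -- replace j with (2 * k)%nat by lia. rewrite Hr2, Hr3. lia.
      * intros j Hj. destruct (Nat.lt_trichotomy j (2 * k)) as [H|[H|H]].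
        -- rewrite Hr1 by lia. specialize (Hb j H). lia.
        -- rewrite H, Hr2. lia.
        -- replace j with (S (2 * k)) by lia. rewrite Hr3. lia.
      * replace (2 * S k)%nat with (S (S (2 * k))) by lia. unfold alt. cbn [vsum].
        rewrite Hr2, Hr3. rewrite (vsum_ext _ (fun j => vscal ((-1) ^ S j) (y (r' j))) (2 * k)).
        -- replace ((-1) ^ S (2 * k)) with (-1) by (cbn [pow]; rewrite pow_1_even; ring).
           replace ((-1) ^ S (S (2 * k))) with 1 by (cbn [pow]; rewrite pow_1_even; ring).
           vlin.
        -- intros j Hj. now rewrite Hr1.
    + exists k, r. assert (Hn := Hab n). split; [lia|]. split; [exact Hr|]. split.
      * intros j Hj. specialize (Hb j Hj). lia.
      * vlin.
Qed.

(** * Changing signs one block at a time *)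

Definition sgn_seq (e : nat -> R) := forall j, e j = 1 \/ e j = -1.

(** Reflecting the tail that starts at [k] costs a factor [1 + d k], whatever signs the terms
    already carry; [sign_change] iterates such reflections. *)
Definition flips (v : nat -> V) (n : nat) (d : nat -> R) : Prop :=
  forall (e : nat -> R) k, sgn_seq e -> (0 < k < n)%nat ->
    vnorm (vsub (vsum (fun i => vscal (e i) (v i)) k)
                (vsum (fun i => if Nat.ltb i k then vzero else vscal (e i) (v i)) n))
      <= (1 + d k) * vnorm (vsum (fun i => vscal (e i) (v i)) n).

(** The signs [e (min i k)] follow [e] up to [k] and are constant afterwards. For [k = 0] the sum is
    the original one up to a global sign. Passing from [k] to [k + 1] either changes nothing or
    reflects the tail starting at [k + 1]. *)
Lemma sign_change (v : nat -> V) n d theta : 0 < theta <= 1 ->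
  (forall k, 0 <= d k <= theta * (/ 2) ^ (k + 2)) -> flips v n d ->
  forall e, sgn_seq e -> vnorm (vsum (fun i => vscal (e i) (v i)) n) <= (1 + theta) * vnorm (vsum v n).
Proof.
  intros Hth Hd Hf e He.
  assert (Hv := nrm_ge0 (vsum v n)).
  assert (Hpow : forall k, 0 < (/ 2) ^ k <= 1).
  { induction k as [|k IH]; simpl; lra. }
  (* With [q = (/ 2) ^ (k + 1)], one step raises the factor by at most
     [d (S k) * 2 <= theta * q / 2], which is the increment of this bound. The factor 2 comes from
     [theta <= 1]. *)
  assert (H : forall k, vnorm (vsum (fun i => vscal (e (min i k)) (v i)) n)
             <= (1 + theta * (1 - (/ 2) ^ (k + 1))) * vnorm (vsum v n)).
  { induction k as [|k IH].
    - rewrite (vsum_ext _ (fun i => vscal (e O) (v i))), vsum_scal, nrm_sign by (auto; intros; now rewrite Nat.min_0_r).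
      simpl. nra.
    - eapply Rle_trans with ((1 + d (S k)) * vnorm (vsum (fun i => vscal (e (min i k)) (v i)) n)).
      + destruct (le_lt_dec n (S k)) as [Hn|Hn].
        * rewrite (vsum_ext _ (fun i => vscal (e (min i k)) (v i))).
          -- assert (H1 := nrm_ge0 (vsum (fun i => vscal (e (min i k)) (v i)) n)).
             specialize (Hd (S k)). nra.
          -- intros i Hi. f_equal. f_equal. lia.
        * assert (Hs : sgn_seq (fun i => e (min i k))) by (intros j; apply He).
          assert (Hfk := Hf _ (S k) Hs ltac:(lia)).
          rewrite (vsum_split_at _ (S k)) by lia.
          destruct (classic (e (S k) = e k)) as [E|E].
          -- rewrite (vsum_split_at (fun i => vscal (e (min i k)) (v i)) (S k) n) by lia.
             rewrite (vsum_ext (fun i => vscal (e (min i (S k))) (v i)) (fun i => vscal (e (min i k)) (v i)) (S k))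
               by (intros i Hi; f_equal; f_equal; lia).
             rewrite (vsum_ext (fun i => if Nat.ltb i (S k) then vzero else vscal (e (min i (S k))) (v i))
                (fun i => if Nat.ltb i (S k) then vzero else vscal (e (min i k)) (v i)) n).
             ++ specialize (Hd (S k)).
                match goal with |- vnorm ?z <= _ => assert (H1 := nrm_ge0 z) end. nra.
             ++ intros i Hi. destruct (Nat.ltb_spec i (S k)); [reflexivity|].
                rewrite !Nat.min_r by lia. now rewrite E.
          -- assert (E' : e (S k) = - e k).
             { destruct (He k) as [E1|E1], (He (S k)) as [E2|E2]; rewrite E1, E2 in *; lra. }
             eapply Rle_trans; [|apply Hfk]. apply Req_le. f_equal. unfold vsub. f_equal.
             ++ apply vsum_ext. intros i Hi. f_equal. f_equal. lia.
             ++ rewrite <- vscalN1, <- vsum_scal. apply vsum_ext. intros i Hi.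
                destruct (Nat.ltb_spec i (S k)); [vlin|]. rewrite !Nat.min_r by lia. rewrite E'. vlin.
      + specialize (Hd (S k)). replace (S k + 2)%nat with (S (S (k + 1))) in Hd by lia.
        replace (S k + 1)%nat with (S (k + 1)) by lia. cbn [pow] in Hd |- *.
        assert (Hp := Hpow (k + 1)%nat). set (q := (/ 2) ^ (k + 1)) in *.
        eapply Rle_trans; [apply Rmult_le_compat_l; [lra|apply IH]|].
        rewrite <- Rmult_assoc. apply Rmult_le_compat_r; [exact Hv|].
        assert (d (S k) * (1 + theta * (1 - q)) <= theta * (/ 2 * (/ 2 * q)) * 2).
        { apply Rmult_le_compat; try lra; try nra. }
        nra. }
  specialize (H n). rewrite (vsum_ext _ (fun i => vscal (e i) (v i))) in H.
  - specialize (Hpow (n + 1)%nat). eapply Rle_trans; [exact H|]. apply Rmult_le_compat_r; nra.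
  - intros i Hi. f_equal. f_equal. lia.
Qed.

(** * From single vectors to finite dimensional subspaces *)

(* Abstract in the family [F] of subspaces, so that it serves both (au) in [X] and (au* ) in its dual. *)
Lemma flip_finite_dim (F : (V -> Prop) -> Prop) :
  F (fun _ => True) ->
  (forall W1 W2, F W1 -> F W2 -> exists W3, F W3 /\ forall w, W3 w -> W1 w /\ W2 w) ->
  (forall W a w, F W -> W w -> W (vscal a w)) ->
  (forall x delta, 0 < delta -> exists W, F W /\ forall w, W w -> vnorm (vsub x w) <= (1 + delta) * vnorm (vadd x w)) ->
  forall l delta, 0 < delta -> exists W, F W /\
    forall x w, rg l x -> W w -> vnorm (vsub x w) <= (1 + delta) * vnorm (vadd x w).
Proof.
  intros FT FI FS H l delta' Hdelta'.
  set (delta := Rmin delta' 1).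
  assert (Hdelta : 0 < delta) by (apply Rmin_pos; lra).
  assert (Hd1 : delta <= 1) by apply Rmin_r. assert (Hd2 : delta <= delta') by apply Rmin_l.
  destruct (finite_net l 1 (fun x => rg l x /\ vnorm x = 1) (delta / 10)) as [L [HL1 HL2]];
    [lra|intros x [Hx1 Hx2]; split; [exact Hx1|lra]|lra|].
  assert (HW : exists W, F W /\ forall y w, In y L -> W w -> vnorm (vsub y w) <= (1 + delta / 2) * vnorm (vadd y w)).
  { clear HL1 HL2. induction L as [|y L (W1 & FW1 & HW1)].
    - exists (fun _ => True). split; [exact FT|]. intros y w [].
    - destruct (H y (delta / 2)) as (W2 & FW2 & HW2); [lra|].
      destruct (FI W1 W2 FW1 FW2) as (W3 & FW3 & HW3). exists W3. split; [exact FW3|].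
      intros z w [<-|Hz] Hw; [apply HW2|apply HW1]; auto; now apply HW3. }
  destruct HW as (W & FW & HW). exists W. split; [exact FW|].
  assert (H1 : forall x w, rg l x -> vnorm x = 1 -> W w -> vnorm (vsub x w) <= (1 + delta) * vnorm (vadd x w)).
  { intros x w Hx Hx1 Hw. destruct (HL2 x (conj Hx Hx1)) as [y [Hy Hxy]].
    assert (Hyw := HW y w Hy Hw). destruct (HL1 y Hy) as [_ Hy1].
    assert (A1 : vnorm (vsub x w) <= vnorm (vsub x y) + vnorm (vsub y w)) by apply nrm_sub_tri.
    assert (A2 : vnorm (vadd y w) <= vnorm (vsub x y) + vnorm (vadd x w)).
    { rewrite (nrm_subC x y). replace (vadd y w) with (vadd (vsub y x) (vadd x w)) by vlin. apply nrm_add. }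
    assert (A3 : 2 * vnorm y <= vnorm (vsub y w) + vnorm (vadd y w)).
    { rewrite <- nrm_scal_pos by lra. replace (vscal 2 y) with (vadd (vsub y w) (vadd y w)) by vlin. apply nrm_add. }
    rewrite Hy1 in A3.
    (* The additive errors coming from the net, at most [delta / 4] in all, are absorbed by
       [delta / 2 * vnorm (vadd x w)] because of this lower bound. *)
    assert (A4 : / 2 <= vnorm (vadd x w)) by nra.
    nra. }
  intros x w Hx Hw.
  assert (Hle : vnorm (vsub x w) <= (1 + delta) * vnorm (vadd x w)).
  { destruct (Req_dec (vnorm x) 0) as [E|E].
    - apply nrm_eq0 in E. subst x.
      replace (vsub vzero w) with (vopp w) by vlin. replace (vadd vzero w) with w by vlin.
      rewrite nrm_opp. assert (Hn := nrm_ge0 w). nra.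
    - destruct (nrm_normalize x E) as [Ht Ht1]. set (t := vnorm x) in *.
      assert (H2 : vnorm (vsub (vscal (/ t) x) (vscal (/ t) w)) <= (1 + delta) * vnorm (vadd (vscal (/ t) x) (vscal (/ t) w))).
      { apply H1; [now apply rg_subspace|exact Ht1|now apply FS]. }
      replace (vsub _ _) with (vscal (/ t) (vsub x w)) in H2 by vlin.
      rewrite <- vscalDr, !nrm_scal_pos in H2 by lra.
      apply Rmult_le_reg_l with (/ t); [exact Ht|]. lra. }
  assert (Hn := nrm_ge0 (vadd x w)). nra.
Qed.
End Conv.

(** Kernels of frames replace arbitrary closed subspaces of finite codimension: they are cofinal
    among these, stable under intersection, and can be taken inside a given kernel [kr l0], which
    makes decreasing chains possible. *)
Lemma au_frames {X : NSpace} {HX : is_normed X} : prop_au X ->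
  forall (l l0 : frame X) delta, good l0 -> 0 < delta -> exists l', good l' /\ (forall x, kr l' x -> kr l0 x) /\
    forall x w, rg l x -> kr l' w -> vnorm (vsub x w) <= (1 + delta) * vnorm (vadd x w).
Proof.
  intros Hau l l0 delta Hl0 Hdelta.
  destruct (flip_finite_dim (fun W => exists l', good l' /\ forall w, W w <-> kr l' w)) with (l := l) (delta := delta)
    as (W & (l1 & Hl1 & HW1) & HW).
  - exists nil. split; [apply good_nil|]. intros w. split; [intros _; reflexivity|auto].
  - intros W1 W2 (l1 & G1 & H1) (l2 & G2 & H2).
    destruct (frame_kr_inter l1 l2 G1 G2) as (l3 & G3 & H3 & H3').
    exists (kr l3). split; [exists l3; split; [exact G3|tauto]|]. intros w Hw. rewrite H1, H2. auto.
  - intros W a w (l1 & G1 & H1) Hw. rewrite H1 in *. now apply kr_subspace.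
  - intros x d Hd. destruct (Hau x d Hd) as (W & S1 & C1 & F1 & HW).
    destruct (frame_of_finite_codim W S1 C1 F1) as (l1 & G1 & H1).
    exists (kr l1). split; [exists l1; split; [exact G1|tauto]|]. intros w Hw. apply HW. auto.
  - exact Hdelta.
  - destruct (frame_kr_inter l0 l1 Hl0 Hl1) as (l' & G & H1 & H2). exists l'. repeat split; auto.
    intros x w Hx Hw. apply HW; auto. apply HW1. auto.
Qed.

Definition vanish {X : NSpace} (l : frame X) (q : Dual X) : Prop := forall x, rg l x -> ap q x = 0.

(** The analogue of (au) in the dual, for weak* closed subspaces of finite codimension, that is, the
    annihilators of finite dimensional spaces [rg l]. *)
Definition prop_au_star (X : NSpace) : Prop :=
  forall (p : Dual X) delta, 0 < delta -> exists l : frame X, good l /\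
    forall q, vanish l q -> vnorm (vsub p q) <= (1 + delta) * vnorm (vadd p q).

(** If [adj l f = f], then [f] is a combination of the functionals of [l]. Such functionals
    therefore lie in the range of one frame of the dual, as [flip_finite_dim] and [finite_net]
    require. *)
Lemma adj_frame {X : NSpace} {HX : is_normed X} (l : frame X) :
  exists L : frame (Dual X), forall f, adj l f = f -> rg L f.
Proof.
  destruct (frame_span (V := Dual X) nil (map fst l) good_nil) as (L & HL & _ & HL2).
  exists L. intros f Hf.
  assert (E : f = vsum (fun k => vscal (ap f (snd (nth k l (vzero, vzero)))) (fst (nth k l (vzero, vzero)))) (length l)).
  { rewrite <- Hf at 1. apply ap_ext. intros x. rewrite ap_adj. clear - HX.
    rewrite ap_vsum. revert x. induction l as [|c l IH] using rev_ind; intros x; [apply ap_0|].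
    rewrite length_app, Nat.add_1_r. cbn [rsum].
    rewrite (rsum_ext _ (fun k => ap (vscal (ap f (snd (nth k l (vzero, vzero)))) (fst (nth k l (vzero, vzero)))) x)).
    - rewrite <- IH, app_nth2, Nat.sub_diag by lia. cbn [nth]. rewrite ap_vscal.
      assert (Hp : pj (l ++ [c]) x = vadd (pj l x) (vscal (ap (fst c) x) (snd c))).
      { clear - HX. induction l as [|d l IH]; cbn [app pj]; [vlin|]. rewrite IH. vlin. }
      rewrite Hp, ap_add, ap_scal. ring.
    - intros k Hk. now rewrite app_nth1. }
  rewrite E. apply vsum_in; [apply rg_subspace|]. intros k Hk. apply rg_subspace. apply HL2.
  apply in_map. now apply nth_In.
Qed.

(* [adj l f = f] says that [f] vanishes on [kr l]. *)
Lemma au_star_frames {X : NSpace} {HX : is_normed X} : prop_au_star X ->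
  forall (l : frame X) delta, 0 < delta -> exists l', good l' /\
    forall f q, adj l f = f -> vanish l' q -> vnorm (vsub f q) <= (1 + delta) * vnorm (vadd f q).
Proof.
  intros Hau l delta Hdelta.
  destruct (adj_frame l) as [L HL2].
  destruct (flip_finite_dim (V := Dual X) (fun W => exists l', good l' /\ forall w, W w <-> vanish l' w)) with (l := L) (delta := delta)
    as (W & (l1 & Hl1 & HW1) & HW).
  - exists nil. split; [apply good_nil|]. intros w. split; [|auto]. intros _ x Hx.
    unfold rg in Hx. simpl in Hx. rewrite <- Hx. apply ap_0.
  - intros W1 W2 (l1 & G1 & H1) (l2 & G2 & H2).
    destruct (frame_span_frame l1 l2 G1) as (l3 & G3 & H3 & H3').
    exists (vanish l3). split; [exists l3; split; [exact G3|tauto]|]. intros w Hw. rewrite H1, H2.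
    split; intros x Hx; apply Hw; [auto|]. rewrite <- Hx. apply H3'.
  - intros W a w (l1 & G1 & H1) Hw. rewrite H1 in *. intros x Hx. rewrite ap_vscal, (Hw x Hx). ring.
  - intros p d Hd. destruct (Hau p d Hd) as (l1 & G1 & H1). exists (vanish l1).
    split; [exists l1; split; [exact G1|tauto]|exact H1].
  - exact Hdelta.
  - exists l1. split; [exact Hl1|]. intros f q Hf Hq. apply HW; [|now apply HW1].
    now apply HL2.
Qed.

(** * From (au) and (WABS) to the dual property *)

(** On the sum of [rg l] and [kr l'] the values are forced: [x + w] goes to [ap psi (vsub x w)]. The
    hypothesis is precisely the bound that Hahn-Banach needs; outside this sum nothing is
    controlled, and this is where corrections live. *)
Lemma flip_functional {X : NSpace} {HX : is_normed X} (l l' : frame X) d (psi : Dual X) :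
  0 <= d -> (forall x w, rg l x -> kr l' w -> vnorm (vsub x w) <= (1 + d) * vnorm (vadd x w)) ->
  exists phi : Dual X, vnorm phi <= (1 + d) * vnorm psi /\
    (forall x, rg l x -> ap phi x = ap psi x) /\ (forall w, kr l' w -> ap phi w = - ap psi w).
Proof.
  intros Hd H. assert (Hn := dnorm_ge0 psi).
  destruct (hahn_banach ((1 + d) * vnorm psi)
    (fun z r => exists x w, rg l x /\ kr l' w /\ z = vadd x w /\ r = ap psi (vsub x w))) as [phi [H1 H2]].
  - nra.
  - split; [|split; [|split]].
    + exists vzero, vzero. repeat split; try apply rg_subspace; try apply kr_subspace; [vlin|].
      replace (vsub vzero vzero) with (vzero : X) by vlin. symmetry. apply ap_0.
    + intros z r z' r' (x & w & Hx & Hw & -> & ->) (x' & w' & Hx' & Hw' & -> & ->).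
      exists (vadd x x'), (vadd w w'). split; [now apply rg_subspace|]. split; [now apply kr_subspace|].
      split; [vlin|]. rewrite !ap_sub, !ap_add. ring.
    + intros a z r (x & w & Hx & Hw & -> & ->).
      exists (vscal a x), (vscal a w). split; [now apply rg_subspace|]. split; [now apply kr_subspace|].
      split; [vlin|]. rewrite !ap_sub, !ap_scal. ring.
    + intros z r (x & w & Hx & Hw & -> & ->). eapply Rle_trans; [apply ap_le_l|].
      rewrite (Rmult_comm (1 + d)), Rmult_assoc. apply Rmult_le_compat_l; auto.
  - exists phi. split; [exact H2|]. split.
    + intros x Hx. apply H1. exists x, vzero. split; [exact Hx|]. split; [apply kr_subspace|].
      split; [vlin|]. f_equal. vlin.
    + intros w Hw. apply H1. exists vzero, w. split; [apply rg_subspace|]. split; [exact Hw|].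
      split; [vlin|]. rewrite <- ap_opp. f_equal. vlin.
Qed.

(** * Corrections accumulated by repeated reflections *)

Section Growth.
Context {X : NSpace} {HX : is_normed X}.
(** [B] bounds all reflected functionals and [K] all corrections; [M] is the number of places
    available for corrections, and at most [2 * N] reflections are made. In the application [p - q]
    exceeds [(1 + delta) * vnorm (vadd p q)] at [x], which yields [Hg]: a functional of norm at most
    [B] with sign [-1] on [q] needs a correction to lower its value at [x]. *)
Variables (p q : Dual X) (x : X) (D P : nat -> frame X) (s L B g K : R) (N M : nat).
Hypothesis HD : forall i j y, (i <= j)%nat -> rg (D i) y -> rg (D j) y.
Hypothesis HP : forall i j w, (i <= j)%nat -> kr (P j) w -> kr (P i) w.
Hypothesis Hp : forall w, kr (P 0%nat) w -> ap p w = 0.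
Hypothesis Hq : forall i, (i < M)%nat -> vanish (D i) q.
Hypothesis Hs : 0 <= s.
Hypothesis Hau : forall i y w, rg (D i) y -> kr (P i) w -> vnorm (vsub y w) <= (1 + s) * vnorm (vadd y w).
Hypothesis HL : vnorm (vadd p q) <= L.
Hypothesis HB : forall t, (t <= 2 * N)%nat -> (1 + s) ^ t * L <= B.
Hypothesis HK1 : 2 * B + 2 * vnorm q <= K.
Hypothesis HK2 : 2 * B + 2 * vnorm p <= K.
Hypothesis Hg : forall c, vnorm (vsub (vadd p c) q) <= B -> ap c x <= - g.
Hypothesis Hg0 : 0 <= g.

Definition fsum (c : nat -> Dual X) := vsum c M.
Definition asum (c : nat -> Dual X) := rsum (fun i => Rabs (ap (c i) x)) M.

(* The result of [t] reflections of [p + q]: [c i], for [lo <= i < hi], is the correction between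
   [D i] and [P i], and [tau] is the sign now carried by [q]. *)
Definition state (t lo hi : nat) (c : nat -> Dual X) (tau : R) : Prop :=
  (lo <= hi <= M)%nat /\ (tau = 1 \/ tau = -1) /\
  (forall i, (i < lo)%nat \/ (hi <= i)%nat -> c i = vzero) /\
  (forall i, (i < M)%nat -> vanish (D i) (c i) /\ (forall w, kr (P i) w -> ap (c i) w = 0) /\ vnorm (c i) <= K) /\
  vnorm (vadd (vadd p (fsum c)) (vscal tau q)) <= (1 + s) ^ t * L.

Definition upd (c : nat -> Dual X) k f := fun i => if Nat.eqb i k then f else c i.

Lemma fsum_upd c k f : (k < M)%nat -> c k = vzero -> fsum (upd c k f) = vadd (fsum c) f.
Proof.
  intros Hk Hc. unfold fsum.
  rewrite (vsum_ext _ (fun i => vadd (c i) (vscal (if Nat.eqb k i then 1 else 0) f))).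
  - rewrite vsum_add. f_equal. rewrite (vsum_single (fun _ => f)).
    destruct (Nat.ltb_spec k M); [reflexivity|lia].
  - intros i _. unfold upd. rewrite Nat.eqb_sym. destruct (Nat.eqb_spec k i) as [->|]; [rewrite Hc|]; vlin.
Qed.

Lemma asum_upd c k f : (k < M)%nat -> c k = vzero -> asum (upd c k f) = asum c + Rabs (ap f x).
Proof.
  intros Hk Hc. unfold asum.
  rewrite (rsum_ext _ (fun i => Rabs (ap (c i) x) + (if Nat.eqb k i then 1 else 0) * Rabs (ap f x))).
  - rewrite rsum_add. f_equal. rewrite (rsum_single k (fun _ => Rabs (ap f x))).
    destruct (Nat.ltb_spec k M); [reflexivity|lia].
  - intros i _. unfold upd. rewrite Nat.eqb_sym. destruct (Nat.eqb_spec k i) as [->|]; [|ring].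
    rewrite Hc, ap_vzero, Rabs_R0. ring.
Qed.

Lemma K_ge0 : 0 <= K.
Proof.
  assert (H := HB 0 ltac:(lia)). simpl in H. assert (H1 := dnorm_ge0 (vadd p q)). assert (H2 := dnorm_ge0 q). lra.
Qed.

Lemma state_bound t lo hi c tau : (t <= 2 * N)%nat -> state t lo hi c tau ->
  vnorm (vadd (vadd p (fsum c)) (vscal tau q)) <= B.
Proof. intros Ht (_ & _ & _ & _ & H). eapply Rle_trans; [exact H|now apply HB]. Qed.

(** On [D hi] the functional [q] vanishes, and on [kr (P hi)] so do [p] and all previous
    corrections. The reflection therefore changes the sign of [q] alone, up to a new correction [f]
    that vanishes on both spaces. *)
Lemma end_flip t lo hi c tau : state t lo hi c tau -> (hi < M)%nat -> (t < 2 * N)%nat ->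
  exists f, state (t + 1) lo (hi + 1) (upd c hi f) (- tau).
Proof.
  intros Hst Hhi Ht. assert (HB0 := state_bound t lo hi c tau ltac:(lia) Hst).
  destruct Hst as (H1 & H2 & H3 & H4 & H5).
  set (psi := vadd (vadd p (fsum c)) (vscal tau q)) in *.
  destruct (flip_functional (D hi) (P hi) s psi Hs (Hau hi)) as (phi & F1 & F2 & F3).
  set (f := vadd (vsub (vsub phi p) (fsum c)) (vscal tau q)).
  assert (Hphi : vnorm phi <= (1 + s) ^ (t + 1) * L).
  { eapply Rle_trans; [exact F1|]. rewrite pow_add, pow_1, (Rmult_comm (_ ^ t)), Rmult_assoc.
    apply Rmult_le_compat_l; lra. }
  assert (Hpsi : forall y, ap psi y = ap p y + ap (fsum c) y + tau * ap q y) by reflexivity.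
  assert (Hf : forall y, ap f y = ap phi y - ap p y - ap (fsum c) y + tau * ap q y) by reflexivity.
  exists f. split; [lia|]. split; [destruct H2; lra|]. split; [|split].
  - intros i Hi. unfold upd. destruct (Nat.eqb_spec i hi); [lia|]. apply H3. lia.
  - intros i Hi. unfold upd. destruct (Nat.eqb_spec i hi) as [->|Hne]; [|now apply H4]. split; [|split].
    + intros y Hy. rewrite Hf, F2, Hpsi by exact Hy. rewrite (Hq hi) by auto. ring.
    + intros w Hw. rewrite Hf, F3, Hpsi by exact Hw.
      assert (E1 : ap p w = 0) by (apply Hp; apply (HP 0 hi); [lia|exact Hw]).
      assert (E2 : ap (fsum c) w = 0).
      { unfold fsum. rewrite ap_vsum. apply rsum_0. intros i Hi'.
        destruct (le_lt_dec hi i) as [Hle|Hlt]; [rewrite H3 by lia; apply ap_vzero|].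
        apply H4; [lia|]. apply (HP i hi); [lia|exact Hw]. }
      rewrite E1, E2. ring.
    + replace f with (vadd (vsub phi psi) (vscal (2 * tau) q)) by (unfold f, psi; vlin).
      eapply Rle_trans; [apply nrm_add|].
      assert (vnorm (vscal (2 * tau) q) <= 2 * vnorm q).
      { rewrite nrm_scal. apply Rmult_le_compat_r; [apply dnorm_ge0|]. apply Rabs_le. destruct H2; lra. }
      assert (HBt := HB (t + 1) ltac:(lia)). assert (Ht' := nrm_sub phi psi). lra.
  - rewrite fsum_upd by (auto; apply H3; lia).
    replace (vadd _ _) with phi by (unfold f; vlin). exact Hphi.
Qed.

(** At an index before all corrections, only [p] is seen on [D b], and [p] vanishes on [kr (P b)].
    The reflection therefore changes the signs of [q] and of all previous corrections, up to a new
    one placed before them. *)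
Lemma begin_flip t lo hi c tau : state t lo hi c tau -> (0 < lo)%nat -> (t < 2 * N)%nat ->
  exists f, state (t + 1) (lo - 1) hi (upd (fun i => vopp (c i)) (lo - 1) f) (- tau).
Proof.
  intros Hst Hlo Ht. assert (HB0 := state_bound t lo hi c tau ltac:(lia) Hst).
  destruct Hst as (H1 & H2 & H3 & H4 & H5).
  set (psi := vadd (vadd p (fsum c)) (vscal tau q)) in *. set (b := (lo - 1)%nat).
  destruct (flip_functional (D b) (P b) s psi Hs (Hau b)) as (phi & F1 & F2 & F3).
  set (f := vadd (vadd (vsub phi p) (fsum c)) (vscal tau q)).
  assert (Hphi : vnorm phi <= (1 + s) ^ (t + 1) * L).
  { eapply Rle_trans; [exact F1|]. rewrite pow_add, pow_1, (Rmult_comm (_ ^ t)), Rmult_assoc.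
    apply Rmult_le_compat_l; lra. }
  assert (Hpsi : forall y, ap psi y = ap p y + ap (fsum c) y + tau * ap q y) by reflexivity.
  assert (Hf : forall y, ap f y = ap phi y - ap p y + ap (fsum c) y + tau * ap q y) by reflexivity.
  exists f. split; [unfold b; lia|]. split; [destruct H2; lra|]. split; [|split].
  - intros i Hi. unfold upd. destruct (Nat.eqb_spec i b); [unfold b in *; lia|].
    rewrite H3 by (unfold b in *; lia). vlin.
  - intros i Hi. unfold upd. destruct (Nat.eqb_spec i b) as [->|Hne].
    + split; [|split].
      * intros y Hy. rewrite Hf, F2, Hpsi by exact Hy. rewrite (Hq b) by auto.
        assert (E : ap (fsum c) y = 0).
        { unfold fsum. rewrite ap_vsum. apply rsum_0. intros i Hi'.
          destruct (lt_dec i lo) as [Hlt|Hge]; [rewrite H3 by lia; apply ap_vzero|].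
          apply (proj1 (H4 i Hi')). apply (HD b i); [unfold b; lia|exact Hy]. }
        rewrite E. ring.
      * intros w Hw. rewrite Hf, F3, Hpsi by exact Hw.
        assert (E1 : ap p w = 0) by (apply Hp; apply (HP 0 b); [lia|exact Hw]).
        rewrite E1. ring.
      * replace f with (vsub (vadd phi psi) (vscal 2 p)) by (unfold f, psi; vlin).
        eapply Rle_trans; [apply nrm_sub|]. rewrite (nrm_scal_pos 2) by lra.
        assert (HBt := HB (t + 1) ltac:(lia)). assert (Ht' := nrm_add phi psi). lra.
    + destruct (H4 i Hi) as (G1 & G2 & G3). split; [|split].
      * intros y Hy. rewrite ap_vopp, (G1 y Hy). ring.
      * intros w Hw. rewrite ap_vopp, (G2 w Hw). ring.
      * now rewrite nrm_opp.
  - rewrite fsum_upd by (try (unfold b; lia); rewrite H3 by (unfold b; lia); vlin).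
    replace (fsum (fun i => vopp (c i))) with (vopp (fsum c)).
    + replace (vadd _ _) with phi by (unfold f; vlin). exact Hphi.
    + unfold fsum. rewrite <- vscalN1, <- vsum_scal. apply vsum_ext. intros. vlin.
Qed.

(* In a state with sign [-1] the corrections sum to at most [- g] at [x]. Hence, starting from the sign
   [1], a reflection after the last correction (if their sum at [x] is nonnegative) or before the first
   one (if it is negative) adds a correction of size at least [g] at [x]. *)
Lemma growth : (3 * N <= M)%nat -> forall k, (k <= N)%nat -> exists lo hi c,
  state (2 * k) lo hi c 1 /\ (N - k <= lo)%nat /\ (hi <= N + 2 * k)%nat /\ INR k * g <= asum c.
Proof.
  intros HS. induction k as [|k IH]; intros Hk.
  (* A round uses at most one place on the left and two on the right, so a start at [N] leaves room
     for [N] rounds among [3 * N] places. *)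
  - exists N, N, (fun _ => vzero). split; [|split; [lia|split; [lia|]]].
    + split; [lia|]. split; [now left|]. split; [reflexivity|]. split.
      * intros i _. split; [intros y _; apply ap_vzero|]. split; [intros; apply ap_vzero|].
        rewrite nrm_0. apply K_ge0.
      * change (2 * 0)%nat with O. rewrite pow_O, Rmult_1_l. unfold fsum. rewrite (vsum_0 (fun _ => vzero)) by reflexivity.
        replace (vadd _ _) with (vadd p q) by vlin. exact HL.
    + simpl. rewrite Rmult_0_l. apply rsum_ge0. intros. apply Rabs_pos.
  - destruct (IH ltac:(lia)) as (lo & hi & c & Hst & Hlo & Hhi & HA).
    assert (Hstep : exists lo' hi' c', state (2 * k + 1) lo' hi' c' (-1) /\ (N - S k <= lo')%nat /\
              (hi' <= N + 2 * k + 1)%nat /\ asum c + g <= asum c').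
    { replace (-1) with (- (1)) by ring.
      destruct (Rle_lt_dec 0 (ap (fsum c) x)) as [Hc|Hc].
      - destruct (end_flip _ _ _ _ _ Hst ltac:(lia) ltac:(lia)) as [f Hf].
        exists lo, (hi + 1)%nat, (upd c hi f). split; [exact Hf|]. split; [lia|]. split; [lia|].
        assert (Hz : c hi = vzero) by (apply Hst; lia).
        assert (Hl : (hi < M)%nat) by lia.
        rewrite asum_upd by auto.
        assert (Hb := state_bound (2 * k + 1)%nat _ _ _ _ ltac:(lia) Hf).
        rewrite fsum_upd in Hb by auto.
        assert (Hgf : ap (vadd (fsum c) f) x <= - g).
        { apply Hg. replace (vsub _ q) with (vadd (vadd p (vadd (fsum c) f)) (vscal (- (1)) q)) by vlin. exact Hb. }
        rewrite ap_vadd in Hgf. assert (Ha := Rle_abs (- ap f x)). rewrite Rabs_Ropp in Ha. lra.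
      - destruct (begin_flip _ _ _ _ _ Hst ltac:(lia) ltac:(lia)) as [f Hf].
        exists (lo - 1)%nat, hi, (upd (fun i => vopp (c i)) (lo - 1) f).
        split; [exact Hf|]. split; [lia|]. split; [lia|].
        assert (Hz : vopp (c (lo - 1)%nat) = vzero).
        { replace (c (lo - 1)%nat) with (vzero : Dual X); [vlin|]. symmetry. apply Hst. lia. }
        assert (Hl : (lo - 1 < M)%nat) by (destruct Hst; lia).
        rewrite asum_upd by auto.
        assert (Hb := state_bound (2 * k + 1)%nat _ _ _ _ ltac:(lia) Hf).
        rewrite fsum_upd in Hb by auto.
        assert (Ho : fsum (fun i => vopp (c i)) = vopp (fsum c)).
        { unfold fsum. rewrite <- vscalN1, <- vsum_scal. apply vsum_ext. intros. vlin. }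
        rewrite Ho in Hb.
        assert (Hgf : ap (vadd (vopp (fsum c)) f) x <= - g).
        { apply Hg. replace (vsub _ q) with (vadd (vadd p (vadd (vopp (fsum c)) f)) (vscal (- (1)) q)) by vlin. exact Hb. }
        rewrite ap_vadd, ap_vopp in Hgf. assert (Ha := Rle_abs (- ap f x)). rewrite Rabs_Ropp in Ha.
        assert (asum (fun i => vopp (c i)) = asum c).
        { unfold asum. apply rsum_ext. intros. now rewrite ap_vopp, Rabs_Ropp. }
        lra. }
    destruct Hstep as (lo' & hi' & c' & Hst' & Hlo' & Hhi' & HA').
    (* The sign 1 is restored by a reflection at the end, which leaves the earlier corrections as
       they are, so that [asum] cannot decrease. *)
    destruct (end_flip _ _ _ _ _ Hst' ltac:(lia) ltac:(lia)) as [f Hf].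
    exists lo', (hi' + 1)%nat, (upd c' hi' f).
    replace (2 * S k)%nat with (2 * k + 1 + 1)%nat by lia. replace 1 with (- -1) by ring.
    split; [exact Hf|]. split; [lia|]. split; [lia|].
    rewrite asum_upd by (try lia; apply Hst'; lia). rewrite S_INR.
    assert (Ha := Rabs_pos (ap f x)). lra.
Qed.

(** The correction [c i] does not see [y (b i)], which lies in [D i], and sees [y (a i)] almost as
    [x]. It vanishes on the earlier differences and is almost zero on the later ones, whose two
    terms nearly agree under [pj (P i)]. So the reflected functional takes almost the value
    [ap (c i) x] on the [i]-th difference, and the selected sums of differences have norm at most
    [Z]. *)
Lemma zigzag_bound (y : nat -> X) (a b : nat -> nat) (mu E Z : R) c lo hi :
  state (2 * N) lo hi c 1 ->
  (forall i j, (i <= j)%nat -> rg (D j) (y (b i))) ->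
  (forall i j, (i < j)%nat -> rg (D j) (y (a i))) ->
  (forall i, (i < M)%nat -> ap q (y (a i)) = 0 /\ ap q (y (b i)) = 0) ->
  (forall i, (i < M)%nat -> vnorm (pj (P i) (vsub (y (a i)) x)) <= mu) ->
  (forall i j, (i < j)%nat -> vnorm (pj (P i) (vsub (y (a j)) (y (b j)))) <= mu) ->
  (forall i, (i < M)%nat -> Rabs (ap p (vsub (y (a i)) (y (b i)))) <= mu) ->
  (forall i, good (P i)) -> 0 <= mu -> mu + INR (M + 1) * (K * mu) <= E ->
  (forall I : nat -> bool, vnorm (vsum (fun i => if I i then vsub (y (a i)) (y (b i)) else vzero) M) <= Z) ->
  asum c <= 2 * (B * Z) + 2 * (INR M * E).
Proof.
  intros Hst Hb Ha Hqy Hx Hjj Hpy HG Hmu HE HZ.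
  assert (HB0 := state_bound _ _ _ _ _ (le_n _) Hst). destruct Hst as (_ & _ & _ & H4 & _).
  set (psi := vadd (vadd p (fsum c)) (vscal 1 q)) in *.
  set (z := fun i => vsub (y (a i)) (y (b i))).
  assert (HKm : 0 <= K * mu) by (apply Rmult_le_pos; [apply K_ge0|exact Hmu]).
  assert (Hc : forall i w, (i < M)%nat -> vnorm (pj (P i) w) <= mu -> Rabs (ap (c i) w) <= K * mu).
  { intros i w Hi Hw. destruct (H4 i Hi) as (_ & G2 & G3).
    replace (ap (c i) w) with (ap (c i) (pj (P i) w)); [now apply ap_le_bd|].
    assert (H0 := G2 _ (kr_res (P i) w (HG i))). rewrite ap_sub in H0. lra. }
  assert (Hpsi : forall i, (i < M)%nat -> Rabs (ap psi (z i) - ap (c i) x) <= E).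
  { intros i Hi.
    assert (E1 : ap psi (z i) - ap (c i) x =
       ap p (z i) + rsum (fun j => ap (c j) (z i) - (if Nat.eqb i j then 1 else 0) * ap (c j) x) M).
    { rewrite (rsum_ext _ (fun j => ap (c j) (z i) + (-1) * ((if Nat.eqb i j then 1 else 0) * ap (c j) x)))
        by (intros; ring).
      rewrite rsum_add, rsum_scal, (rsum_single i (fun j => ap (c j) x)).
      destruct (Nat.ltb_spec i M); [|lia].
      unfold psi, fsum. rewrite !ap_vadd, ap_vscal, ap_vsum.
      unfold z at 3. rewrite (ap_sub q), (proj1 (Hqy i Hi)), (proj2 (Hqy i Hi)). ring. }
    rewrite E1. eapply Rle_trans; [apply Rabs_triang|].
    assert (E2 : Rabs (rsum (fun j => ap (c j) (z i) - (if Nat.eqb i j then 1 else 0) * ap (c j) x) M) <= INR M * (K * mu)).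
    { eapply Rle_trans; [apply rsum_abs|]. rewrite <- rsum_const. apply rsum_le. intros j Hj.
      destruct (H4 j Hj) as (G1 & _ & _). destruct (Nat.lt_trichotomy i j) as [Hij|[<-|Hij]].
      - destruct (Nat.eqb_spec i j); [lia|]. unfold z. rewrite ap_sub, (G1 (y (a i))), (G1 (y (b i))).
        + rewrite Rmult_0_l, !Rminus_0_r, Rabs_R0. exact HKm.
        + apply Hb. lia.
        + now apply Ha.
      - rewrite Nat.eqb_refl. unfold z.
        replace (ap (c i) (vsub (y (a i)) (y (b i))) - 1 * ap (c i) x) with (ap (c i) (vsub (y (a i)) x)).
        + apply Hc; auto.
        + rewrite !ap_sub, (G1 (y (b i))) by now apply Hb. ring.
      - destruct (Nat.eqb_spec i j); [lia|]. rewrite Rmult_0_l, Rminus_0_r. apply Hc; auto. now apply Hjj. }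
    assert (E3 := Hpy i Hi). fold (z i) in E3. rewrite plus_INR in HE. simpl in HE. lra. }
  assert (HI : forall (I : nat -> bool) (sg : R), (sg = 1 \/ sg = -1) ->
     sg * rsum (fun i => if I i then ap (c i) x else 0) M <= B * Z + INR M * E).
  { intros I sg Hsg.
    assert (E1 : sg * ap psi (vsum (fun i => if I i then z i else vzero) M) <= B * Z).
    { apply Rle_trans with (Rabs (ap psi (vsum (fun i => if I i then z i else vzero) M))).
      - unfold Rabs. destruct Rcase_abs, Hsg; nra.
      - apply ap_le_bd; [exact HB0|apply HZ]. }
    assert (E2 : sg * rsum (fun i => if I i then ap (c i) x else 0) M
        <= sg * ap psi (vsum (fun i => if I i then z i else vzero) M) + INR M * E).
    { rewrite ap_sum, <- !rsum_scal, <- rsum_const, <- rsum_add. apply rsum_le. intros i Hi.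
      assert (H0 := Hpsi i Hi). apply Rabs_le_iff in H0. destruct (I i).
      - destruct Hsg; subst sg; lra.
      - rewrite ap_0. lra. }
    lra. }
  (* Selecting the places by the sign of [ap (c i) x] recovers the sum of absolute values from two
     such sums. *)
  assert (H1 := HI (fun i => if Rle_dec 0 (ap (c i) x) then true else false) 1 (or_introl eq_refl)).
  assert (H2 := HI (fun i => if Rle_dec 0 (ap (c i) x) then false else true) (-1) (or_intror eq_refl)).
  assert (H3 : asum c = 1 * rsum (fun i => if (if Rle_dec 0 (ap (c i) x) then true else false) then ap (c i) x else 0) M
     + -1 * rsum (fun i => if (if Rle_dec 0 (ap (c i) x) then false else true) then ap (c i) x else 0) M).
  { unfold asum. rewrite <- !rsum_scal, <- rsum_add. apply rsum_ext. intros i Hi.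
    destruct (Rle_dec 0 (ap (c i) x)); [rewrite Rabs_pos_eq|rewrite Rabs_left]; lra. }
  lra.
Qed.
End Growth.

Lemma pow_small n th : 0 < th -> exists s, 0 < s /\ (1 + s) ^ n <= 1 + th.
Proof.
  revert th. induction n as [|n IH]; intros th Hth; [exists 1; simpl; lra|].
  destruct (IH (th / 2)) as [s [Hs H]]; [lra|]. set (u := th / 2 / (1 + th / 2)).
  assert (Hu : 0 < u) by (apply Rdiv_lt_0_compat; lra).
  exists (Rmin s u). split; [now apply Rmin_pos|]. cbn [pow].
  assert (H0 : 0 < Rmin s u) by now apply Rmin_pos.
  assert (H1 : (1 + Rmin s u) ^ n <= 1 + th / 2).
  { eapply Rle_trans; [|exact H]. apply pow_incr. assert (H1 := Rmin_l s u). lra. }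
  assert (H2 := Rmin_r s u).
  assert (H3 : u * (1 + th / 2) = th / 2) by (unfold u; field; lra).
  assert (H4 : 0 <= (1 + Rmin s u) ^ n) by (apply pow_le; lra). nra.
Qed.

Lemma pow_mono_exp s i j : 0 <= s -> (i <= j)%nat -> (1 + s) ^ i <= (1 + s) ^ j.
Proof. intros. apply Rle_pow; [lra|auto]. Qed.

(** Lets the norming vectors be taken in the union of the spaces [rg (D n)], so that their convex
    blocks lie in some [rg (D m)] too. *)
Lemma norming_dense {X : NSpace} {HX : is_normed X} (f : Dual X) (S : X -> Prop) t :
  (forall a x, S x -> S (vscal a x)) -> (forall x eps, 0 < eps -> exists y, S y /\ vnorm (vsub x y) < eps) ->
  0 <= t < vnorm f -> exists x, S x /\ vnorm x <= 1 /\ t < ap f x.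
Proof.
  intros SS Sd [Ht0 Ht]. apply NNPP. intros H. apply (Rlt_not_le _ _ Ht).
  apply dnorm_le; [exact Ht0|].
  assert (H1 : forall x, S x -> ap f x <= t * vnorm x).
  { intros x Hx. destruct (Req_dec (vnorm x) 0) as [E|E].
    - rewrite E. apply nrm_eq0 in E. subst x. rewrite ap_0. lra.
    - assert (Hn := nrm_ge0 x). destruct (nrm_normalize x E) as [Hi H1].
      apply Rnot_lt_le. intros Hlt. apply H. exists (vscal (/ vnorm x) x). split; [now apply SS|]. split; [lra|].
      rewrite ap_scal. apply Rmult_lt_reg_l with (vnorm x); [lra|].
      rewrite <- Rmult_assoc, Rinv_r by lra. lra. }
  intros x. apply le_epsilon. intros eps Heps.
  assert (Hf := dnorm_ge0 f). destruct (small_multiple (vnorm f + t) eps) as (eta & Heta & A3); [lra|exact Heps|].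
  destruct (Sd x eta Heta) as [y [Hy Hxy]]. specialize (H1 y Hy).
  assert (A1 : ap f x <= ap f y + vnorm f * eta).
  { assert (H2 := ap_le_l f (vsub x y)). rewrite ap_sub in H2. nra. }
  assert (A2 : vnorm y <= vnorm x + eta).
  { assert (H2 := nrm_le_sub y x). rewrite nrm_subC in H2. lra. }
  nra.
Qed.

Lemma blk_pj {X : NSpace} {HX : is_normed X} (l : frame X) (x : nat -> X) a b y z M :
  (forall j, (a <= j)%nat -> vnorm (pj l (vsub (x j) z)) <= M) -> blk x a b y -> vnorm (pj l (vsub y z)) <= M.
Proof.
  intros H Hy. induction Hy as [v (j & Hj & ->)|t v w Ht _ IH1 _ IH2]; [apply H; lia|].
  replace (vsub _ z) with (vadd (vscal t (vsub v z)) (vscal (1 - t) (vsub w z))) by vlin.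
  rewrite pj_add, !pj_scal. eapply Rle_trans; [apply nrm_add|]. rewrite !nrm_scal_pos by lra. nra.
Qed.

(** The indices are chosen in the order [b 0, m 0, a 0, b 1, m 1, a 1] and so on, each large in
    terms of the previous ones. In the application the vector [y k] lies in [rg (D (e k))], and from
    [A m] on the terms nearly agree under [pj (P m)]. *)
Lemma slots (A e : nat -> nat) M0 : exists b m a : nat -> nat,
  (forall i, (b i < a i < b (S i))%nat) /\ (forall i, (m i < m (S i))%nat) /\
  (forall i, (M0 <= m i)%nat) /\ (A O <= b O)%nat /\ (forall i, (e (b i) <= m i)%nat) /\
  (forall i, (e (a i) <= m (S i))%nat) /\ (forall i, (A (m i) <= a i)%nat) /\ (forall i, (A (m i) <= b (S i))%nat).
Proof.
  set (Q := fun (n : nat) (u : nat * nat * nat) => let '(b, m, a) := u in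
    (b < a /\ M0 <= m /\ A O <= b /\ e b <= m /\ A m <= a)%nat).
  set (T := fun (n : nat) (u v : nat * nat * nat) => let '(b, m, a) := u in let '(b', m', a') := v in
    (a < b' /\ m < m' /\ e a <= m' /\ A m <= b')%nat).
  destruct (dep_choice Q T (A O, max M0 (e (A O)), max (S (A O)) (A (max M0 (e (A O)))))) as [f [_ Hf]].
  - unfold Q. lia.
  - intros n [[b m] a] HQ. set (b' := max (max (S a) (A m)) (A O)). set (m' := max (max (S m) M0) (max (e a) (e b'))).
    assert (Hb : (S a <= b' /\ A m <= b' /\ A O <= b')%nat) by (unfold b'; lia).
    assert (Hm : (S m <= m' /\ M0 <= m' /\ e a <= m' /\ e b' <= m')%nat) by (unfold m'; lia).
    clearbody m'. clearbody b'. exists (b', m', max (S b') (A m')). unfold Q, T in *. lia.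
  - exists (fun i => fst (fst (f i))), (fun i => snd (fst (f i))), (fun i => snd (f i)).
    assert (H : forall i, Q i (fst (fst (f i)), snd (fst (f i)), snd (f i)) /\
       T i (fst (fst (f i)), snd (fst (f i)), snd (f i)) (fst (fst (f (S i))), snd (fst (f (S i))), snd (f (S i)))).
    { intros i. destruct (Hf i) as [H1 H2]. rewrite <- !surjective_pairing. auto. }
    unfold Q, T in H. cbv beta iota in H |- *.
    split; [|split; [|split; [|split; [|split; [|split; [|split]]]]]]; try (intros i; specialize (H i); lia).
    specialize (H O). lia.
Qed.

Lemma au_wabs_au_star (X : NSpace) : is_normed X -> separable X -> prop_au X -> WABS X -> prop_au_star X.
Proof.
  intros HX [d Hd] Hau HW p delta0 Hdelta0. set (delta := Rmin delta0 1).
  assert (Hdelta : 0 < delta) by (apply Rmin_pos; lra).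
  assert (Hde1 : delta <= 1) by apply Rmin_r. assert (Hde2 : delta <= delta0) by apply Rmin_l.
  apply NNPP. intros Hno.
  assert (Hq : forall l, good l -> exists q, vanish l q /\ (1 + delta) * vnorm (vadd p q) < vnorm (vsub p q)).
  { intros l Hl. apply NNPP. intros H. apply Hno. exists l. split; [exact Hl|]. intros q Hq.
    apply Rle_trans with ((1 + delta) * vnorm (vadd p q)).
    - apply Rnot_lt_le. intros Hlt. apply H. now exists q.
    - apply Rmult_le_compat_r; [apply dnorm_ge0|lra]. }
  clear Hno.
  (* The case [p = 0] is trivial. Otherwise [x0] is put into [D 0], where every [q] vanishes, so
     that [al] bounds the norms of [p + q] from below. *)
  assert (Hp0 : exists x0, 0 < ap p x0).
  { apply NNPP. intros H. destruct (Hq nil good_nil) as [q [_ Hlt]].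
    assert (E : p = vzero).
    { apply ap_ext. intros z. rewrite ap_vzero.
      destruct (Rtotal_order (ap p z) 0) as [Hz|[Hz|Hz]]; [|exact Hz|]; exfalso; apply H.
      - exists (vopp z). rewrite ap_opp. lra.
      - exists z. lra. }
    subst p. replace (vsub vzero q) with (vopp q) in Hlt by vlin.
    replace (vadd vzero q) with q in Hlt by vlin. rewrite nrm_opp in Hlt. assert (Hn := dnorm_ge0 q). nra. }
  destruct Hp0 as [x0 Hx0].
  assert (Hx0n : 0 < vnorm x0).
  { destruct (Req_dec (vnorm x0) 0) as [E|E]; [|assert (Hn := nrm_ge0 x0); lra].
    apply nrm_eq0 in E. subst x0. rewrite ap_0 in Hx0. lra. }
  set (al := ap p x0 / vnorm x0). assert (Hal : 0 < al) by now apply Rdiv_lt_0_compat.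
  destruct (frame_span nil [x0] good_nil) as (D0 & GD0 & _ & HD0).
  destruct (dep_choice (fun _ (l : frame X) => good l)
     (fun n l l' => (forall x, rg l x -> rg l' x) /\ rg l' (d n)) D0) as (D & ED & HD); [exact GD0| |].
  { intros n l Hl. destruct (frame_span l [d n] Hl) as (l' & H1 & H2 & H3).
    exists l'. repeat split; auto. apply H3. now left. }
  assert (HDm : forall i j y, (i <= j)%nat -> rg (D i) y -> rg (D j) y).
  { intros i j y Hij Hy. induction Hij; [exact Hy|]. now apply HD. }
  destruct (frame_add_functional nil p good_nil) as (l0 & Gl0 & _ & Hl0).
  destruct (au_frames Hau (D O) l0 1 Gl0 Rlt_0_1) as (P0 & GP0 & HP0 & HP0au).
  (* The reflection constants [1 + / INR (S n)] tend to 1, so any later choice of [s] is met from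
     some index [M0] on. *)
  destruct (dep_choice (fun n (l : frame X) => good l /\ forall x w, rg (D n) x -> kr l w ->
      vnorm (vsub x w) <= (1 + / INR (S n)) * vnorm (vadd x w))
     (fun n l l' => forall x, kr l' x -> kr l x) P0) as (P & EP & HP).
  { split; [exact GP0|]. simpl. rewrite Rinv_1. exact HP0au. }
  { intros n l [Gl _].
    destruct (au_frames Hau (D (S n)) l (/ INR (S (S n))) Gl (inv_INR_pos _)) as (l' & G1 & G2 & G3).
    exists l'. auto. }
  assert (HPm : forall i j w, (i <= j)%nat -> kr (P j) w -> kr (P i) w).
  { intros i j w Hij. induction Hij; [auto|]. intros Hw. apply IHHij. now apply HP. }
  assert (HPp : forall w, kr (P O) w -> ap p w = 0) by (intros w Hw; apply Hl0, HP0; now rewrite <- EP).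
  set (U := fun x => exists n, rg (D n) x).
  assert (HUd : forall x eps, 0 < eps -> exists y, U y /\ vnorm (vsub x y) < eps).
  { intros x eps Heps. destruct (Hd x eps Heps) as [n Hn]. exists (d n). split; [|exact Hn].
    exists (S n). apply HD. }
  assert (HU : subspace U).
  { split; [exists O; apply rg_subspace|]. split.
    - intros x y [n Hn] [m Hm]. exists (max n m). apply rg_subspace; [apply (HDm n)|apply (HDm m)]; auto; lia.
    - intros a x [n Hn]. exists n. now apply rg_subspace. }
  assert (Hqx : forall n, exists qx : Dual X * X, let (q, x) := qx in
     vanish (D n) q /\ U x /\ vnorm x <= 1 /\ (1 + delta) * vnorm (vadd p q) < ap (vsub p q) x /\
     (1 + delta) * vnorm (vadd p q) < vnorm (vsub p q)).
  { intros n. destruct (Hq (D n) (proj1 (HD n))) as [q [Hq1 Hq2]].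
    destruct (norming_dense (vsub p q) U ((1 + delta) * vnorm (vadd p q))) as (x & Hx1 & Hx2 & Hx3).
    - apply HU.
    - exact HUd.
    - split; [|exact Hq2]. apply Rmult_le_pos; [lra|apply dnorm_ge0].
    - exists (q, x). auto. }
  destruct (func_choice _ Hqx) as [qx0 Hqx0].
  destruct (diag_frames P (fun _ n => snd (qx0 n))) as (s & z & Hs & Hz).
  { intros _. exists 1. intros n. specialize (Hqx0 n). destruct (qx0 n). apply Hqx0. }
  set (q := fun n => fst (qx0 (s n))). set (x := fun n => snd (qx0 (s n))).
  assert (Hqn : forall n, vanish (D n) (q n) /\ U (x n) /\ vnorm (x n) <= 1 /\
     (1 + delta) * vnorm (vadd p (q n)) < ap (vsub p (q n)) (x n) /\
     (1 + delta) * vnorm (vadd p (q n)) < vnorm (vsub p (q n))).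
  { intros n. unfold q, x. specialize (Hqx0 (s n)). destruct (qx0 (s n)) as [q' x']. simpl.
    destruct Hqx0 as (H1 & H2). split; [|exact H2]. intros y Hy. apply H1.
    apply (HDm n); [now apply incr_ge|exact Hy]. }
  assert (Hxc : forall m mu, 0 < mu -> exists N, forall i j, (N <= i)%nat -> (N <= j)%nat ->
      vnorm (pj (P m) (vsub (x i) (x j))) <= mu).
  { intros m mu Hmu. destruct (converges_sub_bound _ _ (Hz m) mu Hmu) as [N HN].
    exists N. intros i j Hi Hj. rewrite pj_sub. now apply HN. }
  clearbody q x. clear Hqx Hqx0 qx0 z Hz s Hs.
  destruct (wabs_alternating x 1 HW) as (y & pp & Hpp0 & Hpp & Hy & Halt); [intros n; apply Hqn|].
  assert (HyU : forall k, exists m, rg (D m) (y k)).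
  { intros k. apply (conv_in _ U _ HU) with (2 := Hy k). intros v (j & _ & ->). apply Hqn. }
  destruct (func_choice _ HyU) as [e He].
  (* Since [(1 + delta) * vnorm (vadd p q) < vnorm (vsub p q) <= 2 * vnorm p + vnorm (vadd p q)],
     the norms of [p + q] are bounded independently of [q]. *)
  set (Lm := 2 * vnorm p / delta).
  assert (Hpn := dnorm_ge0 p).
  assert (HLm0 : 0 <= Lm) by (apply Rmult_le_pos; [lra|left; now apply Rinv_0_lt_compat]).
  assert (HL : forall n, al <= vnorm (vadd p (q n)) <= Lm).
  { intros n. destruct (Hqn n) as (H1 & _ & _ & _ & H5). split.
    - assert (H2 := ap_le_l (vadd p (q n)) x0). rewrite ap_vadd, (H1 x0) in H2.
      + unfold al. apply Rmult_le_reg_r with (vnorm x0); [exact Hx0n|].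
        unfold Rdiv. rewrite Rmult_assoc, Rinv_l by lra. lra.
      + apply (HDm O); [lia|]. rewrite ED. apply HD0. now left.
    - assert (H2 : vnorm (vsub p (q n)) <= 2 * vnorm p + vnorm (vadd p (q n))).
      { replace (vsub p (q n)) with (vsub (vscal 2 p) (vadd p (q n))) by vlin.
        eapply Rle_trans; [apply nrm_sub|]. rewrite nrm_scal_pos by lra. lra. }
      unfold Lm. apply Rmult_le_reg_r with delta; [exact Hdelta|].
      unfold Rdiv. rewrite Rmult_assoc, Rinv_l by lra. lra. }
  set (Bm := (1 + delta / 2) * Lm). set (Km := 2 * Bm + 2 * (Lm + vnorm p) + 2 * vnorm p).
  set (g := delta * al / 2). assert (Hg : 0 < g) by (unfold g; nra).
  assert (HBm0 : 0 <= Bm) by (unfold Bm; nra). assert (HKm0 : 0 <= Km) by (unfold Km; nra).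
  (* The final estimate bounds [INR N * g] by the sum of [12 * Bm * eta * INR N], [2 * Bm * K0] and
     [6 * INR N * E]. By the choice of [eta] and [E = g / 24], the first and last terms are at most
     a quarter of [INR N * g] each, and [N] makes the middle one less than half of it. *)
  set (eta := g / (48 * (Bm + 1))). assert (Heta : 0 < eta) by (apply Rdiv_lt_0_compat; lra).
  destruct (Halt eta Heta) as (K0 & HK0 & Hz).
  assert (HN : exists N, (1 <= N)%nat /\ 4 * Bm * K0 < INR N * g).
  { destruct (INR_unbounded (4 * Bm * K0 / g)) as [N HN]. exists (S N). split; [lia|].
    rewrite S_INR. apply Rmult_lt_compat_r with (r := g) in HN; [|exact Hg].
    unfold Rdiv in HN. rewrite Rmult_assoc, Rinv_l in HN by lra. lra. }
  destruct HN as (N & HN1 & HN).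
  set (M := (3 * N)%nat). set (E := g / 24). set (mu := E / (1 + INR (M + 1) * Km)).
  assert (HM1 := pos_INR (M + 1)).
  assert (Hmk : 0 <= INR (M + 1) * Km) by nra.
  assert (Hmu : 0 < mu) by (apply Rdiv_lt_0_compat; unfold E; lra).
  assert (HmuE : mu + INR (M + 1) * (Km * mu) = E) by (unfold mu; field; lra).
  set (mu1 := mu / (1 + vnorm p)). assert (Hmu1 : 0 < mu1) by (apply Rdiv_lt_0_compat; lra).
  assert (Hmu1p : mu1 * (1 + vnorm p) = mu) by (unfold mu1; field; lra).
  destruct (pow_small (2 * N) (delta / 2)) as (s & Hs0 & Hs); [lra|].
  destruct (inv_INR_small s Hs0) as [M0 HM0].
  destruct (func_choice _ (fun m => Hxc m mu1 Hmu1)) as [A HA].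
  assert (HyA : forall m k j, (A m <= k)%nat -> (A m <= j)%nat -> vnorm (pj (P m) (vsub (y k) (x j))) <= mu1).
  { intros m k j Hk Hj. apply (blk_pj (P m) x (pp k) (pp (S k))); [|apply Hy].
    intros i Hi. assert (k <= pp k)%nat by now apply incr_ge. apply HA; lia. }
  assert (HyyA : forall m k j, (A m <= k)%nat -> (A m <= j)%nat -> vnorm (pj (P m) (vsub (y k) (y j))) <= mu1).
  { intros m k j Hk Hj. apply (blk_pj (P m) x (pp k) (pp (S k))); [|apply Hy].
    intros i Hi. assert (k <= pp k)%nat by now apply incr_ge.
    rewrite pj_sub, nrm_subC, <- pj_sub. apply HyA; lia. }
  destruct (slots A e M0) as (b & m & a & Sab & Sm & SM0 & SA0 & Seb & Sea & SAa & SAb).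
  assert (Hb' : forall i, (b i < b (S i))%nat) by (intros i; specialize (Sab i); lia).
  assert (Hmm : forall i j, (i <= j)%nat -> (m i <= m j)%nat) by (intros; now apply incr_le).
  assert (Hbb : forall i j, (i <= j)%nat -> (b i <= b j)%nat) by (intros; now apply incr_le).
  (* The pair [q n], [x n] is chosen after all places: [q n] then vanishes at the vectors [y (a i)]
     and [y (b i)], and [x n] nearly agrees with [y (a i)] under [pj (P (m i))]. *)
  assert (Hn : exists n, forall i, (i < M)%nat -> (m i <= n /\ A (m i) <= n /\ e (a i) <= n /\ e (b i) <= n)%nat).
  { clear. induction M as [|M [n IH]]; [exists O; lia|].
    exists (max n (max (max (m M) (A (m M))) (max (e (a M)) (e (b M))))). intros i Hi.
    destruct (Nat.eq_dec i M) as [->|]; [lia|]. specialize (IH i ltac:(lia)). lia. }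
  destruct Hn as [n Hn].
  destruct (Hqn n) as (Q1 & _ & Q3 & Q4 & _). destruct (HL n) as [L1 L2].
  set (L := vnorm (vadd p (q n))) in *. set (B := (1 + delta / 2) * L).
  assert (HBB : B <= Bm) by (unfold B, Bm; nra).
  assert (Hqn' : vnorm (q n) <= Lm + vnorm p).
  { replace (q n) with (vsub (vadd p (q n)) p) by vlin. eapply Rle_trans; [apply nrm_sub|].
    fold L. lra. }
  assert (GD : forall i j v, (i <= j)%nat -> rg (D (m i)) v -> rg (D (m j)) v) by (intros i j v Hij; apply HDm; auto).
  assert (GP : forall i j w, (i <= j)%nat -> kr (P (m j)) w -> kr (P (m i)) w) by (intros i j w Hij; apply HPm; auto).
  assert (Gp : forall w, kr (P (m O)) w -> ap p w = 0) by (intros w Hw; apply HPp; apply (HPm O (m O)); [lia|exact Hw]).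
  assert (Gq : forall i, (i < M)%nat -> vanish (D (m i)) (q n)).
  { intros i Hi v Hv. apply Q1. apply (HDm (m i)); [apply Hn, Hi|exact Hv]. }
  assert (Gau : forall i v w, rg (D (m i)) v -> kr (P (m i)) w -> vnorm (vsub v w) <= (1 + s) * vnorm (vadd v w)).
  { intros i v w Hv Hw. eapply Rle_trans; [now apply (proj1 (HP (m i)))|].
    apply Rmult_le_compat_r; [apply nrm_ge0|]. specialize (HM0 (m i) (SM0 i)). lra. }
  assert (GB : forall t, (t <= 2 * N)%nat -> (1 + s) ^ t * L <= B).
  { intros t Ht. apply Rmult_le_compat_r; [lra|]. eapply Rle_trans; [|exact Hs].
    apply pow_mono_exp; [lra|exact Ht]. }
  assert (GK1 : 2 * B + 2 * vnorm (q n) <= Km) by (unfold Km; lra).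
  assert (GK2 : 2 * B + 2 * vnorm p <= Km) by (unfold Km; lra).
  assert (Gg : forall c, vnorm (vsub (vadd p c) (q n)) <= B -> ap c (x n) <= - g).
  { intros c Hc. assert (H1 := ap_le_bd _ _ _ _ Hc Q3). apply Rabs_le_iff in H1.
    rewrite ap_vsub, ap_vadd in H1. rewrite ap_vsub in Q4. unfold B, g in *. nra. }
  destruct (growth p (q n) (x n) (fun i => D (m i)) (fun i => P (m i)) s L B g Km N M
     GD GP Gp Gq (Rlt_le _ _ Hs0) Gau (Rle_refl _) GB GK1 GK2 Gg (le_n _) N (le_n _))
    as (lo & hi & c & Hst & _ & _ & Hc).
  assert (Hfin := zigzag_bound p (q n) (x n) (fun i => D (m i)) (fun i => P (m i)) s L B Km N M
     (Rle_refl _) GB GK1 y a b mu E (2 * eta * INR M + K0) c lo hi Hst).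
  assert (Hlast : asum (x n) M c <= 2 * (B * (2 * eta * INR M + K0)) + 2 * (INR M * E)).
  { apply Hfin.
    - intros i j Hij. apply (HDm (e (b i))); [|apply He]. eapply Nat.le_trans; [apply Seb|auto].
    - intros i j Hij. apply (HDm (e (a i))); [|apply He]. eapply Nat.le_trans; [apply Sea|]. apply Hmm. lia.
    - intros i Hi. destruct (Hn i Hi) as (N1 & N2 & N3 & N4).
      split; apply Q1; [apply (HDm (e (a i)))|apply (HDm (e (b i)))]; auto.
    - intros i Hi. apply Rle_trans with mu1; [|nra]. apply HyA; [apply SAa|]. apply Hn, Hi.
    - intros i j Hij. apply Rle_trans with mu1; [|nra]. specialize (Sab j).
      assert (A (m i) <= b j)%nat by (eapply Nat.le_trans; [apply SAb|apply Hbb; lia]).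
      apply HyyA; lia.
    - intros i Hi. set (w := vsub (y (a i)) (y (b i))).
      replace (ap p w) with (ap p (pj (P O) w)).
      + apply Rle_trans with (vnorm p * mu1); [|nra]. apply ap_le_bd; [lra|].
        specialize (Sab i). assert (b O <= b i)%nat by (apply Hbb; lia). apply HyyA; lia.
      + assert (H0 := HPp _ (kr_res (P O) w (proj1 (proj1 (HP O))))). rewrite ap_sub in H0. lra.
    - intros i. apply (proj1 (HP (m i))).
    - lra.
    - lra.
    - intros I. destruct (alt_of_pairs y I a b Sab M) as (k & r & Hk & Hr & _ & Ez). rewrite Ez.
      eapply Rle_trans; [now apply Hz|]. apply Rplus_le_compat_r.
      replace (2 * eta * INR M) with (eta * (2 * INR M)) by ring.
      apply Rmult_le_compat_l; [lra|]. rewrite mult_INR. simpl (INR 2). apply le_INR in Hk. lra. }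
  assert (HNp : 1 <= INR N) by (apply (le_INR 1); exact HN1).
  assert (HMN : INR M = 3 * INR N) by (unfold M; rewrite mult_INR; simpl; ring).
  rewrite HMN in Hlast.
  assert (Hb2 : B * (2 * eta * (3 * INR N) + K0) <= Bm * (2 * eta * (3 * INR N) + K0)).
  { apply Rmult_le_compat_r; [|exact HBB]. nra. }
  assert (Heb : eta * (Bm + 1) = g / 48) by (unfold eta; field; lra).
  assert (Heb2 : Bm * eta * INR N <= g / 48 * INR N).
  { apply Rmult_le_compat_r; [lra|]. lra. }
  unfold E in Hlast. nra.
Qed.

Lemma rsum_subseq (f : nat -> R) (t : nat -> nat) n : (forall k, 0 <= f k) -> (forall k, (t k < t (S k))%nat) ->
  rsum (fun k => f (t k)) n <= rsum f (t n).
Proof.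
  intros Hf Ht. induction n as [|n IH]; [simpl; now apply rsum_ge0|]. cbn [rsum].
  apply Rle_trans with (rsum f (S (t n))); [cbn [rsum]; lra|]. apply rsum_mono; [exact Hf|apply Ht].
Qed.

Lemma rsum_geometric n : rsum (fun k => (/ 2) ^ (S k)) n <= 1.
Proof.
  assert (H : rsum (fun k => (/ 2) ^ (S k)) n = 1 - (/ 2) ^ n).
  { induction n as [|n IH]; [simpl; ring|]. cbn [rsum]. rewrite IH. simpl. lra. }
  rewrite H. assert (0 < (/ 2) ^ n) by (apply pow_lt; lra). lra.
Qed.

Lemma rsum_tail_small (f : nat -> R) M mu : (forall k, 0 <= f k) -> (forall n, rsum f n <= M) -> 0 < mu ->
  exists N, forall m, rsum (fun k => f (N + k)%nat) m <= mu.
Proof.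
  intros Hf HM Hmu. destruct (completeness (fun t => exists n, t = rsum f n)) as [l [Hl1 Hl2]].
  - exists M. intros t [n ->]. apply HM.
  - exists (rsum f 0), O. reflexivity.
  - assert (H : exists N, l - mu < rsum f N).
    { apply NNPP. intros H. assert (l <= l - mu); [|lra]. apply Hl2. intros t [n ->].
      apply Rnot_lt_le. intros Hlt. apply H. now exists n. }
    destruct H as [N HN]. exists N. intros m.
    assert (H1 : rsum f (N + m) <= l) by (apply Hl1; now exists (N + m)%nat).
    rewrite rsum_split in H1. lra.
Qed.

(** * Weakly unconditionally Cauchy series in the dual *)

Section WUC.
Context {X : NSpace} {HX : is_normed X}.

(** The functionals are added with a sign that is constant on each convex block and alternates from
    one block to the next. The sum [T] has norm at most [M], yet diagonal dominance gives
    [(-1) ^ (S c) * ap T (y c) >= eta] for each block. Its value on an alternating sum thus grows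
    like [INR n * eta], too fast for (WABS). *)
Lemma biorthogonal_contra (G : nat -> Dual X) (x : nat -> X) M C eta : WABS X -> 0 < eta ->
  (forall n, vnorm (x n) <= C) -> (forall n z, rsum (fun j => Rabs (ap (G j) z)) n <= M * vnorm z) ->
  (forall l n, (l < n)%nat -> rsum (fun j => if Nat.eqb j l then 0 else Rabs (ap (G j) (x l))) n <= eta) ->
  (forall l, 2 * eta <= ap (G l) (x l)) -> False.
Proof.
  intros HW Heta Hx HM Hoff Hdiag.
  destruct (wabs_alternating x C HW Hx) as (y & p & Hp0 & Hp & Hy & Halt).
  assert (HMp : 0 <= M).
  { assert (H := HM 1%nat (x 0%nat)). simpl in H. assert (H1 := Hdiag 0%nat). assert (H2 := Rle_abs (ap (G 0%nat) (x 0%nat))).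
    assert (H3 := nrm_ge0 (x 0%nat)). apply Rnot_lt_le. intros Hneg. nra. }
  destruct (Halt (eta / (2 * (M + 1)))) as (K & HK & Hz); [apply Rdiv_lt_0_compat; lra|].
  assert (HeM : eta / (2 * (M + 1)) * (2 * (M + 1)) = eta) by (field; lra).
  set (e := eta / (2 * (M + 1))) in *.
  destruct (block_index p Hp0 Hp) as [b Hb].
  destruct (INR_unbounded (M * K / (eta / 2))) as [n Hn].
  set (sg := fun j => (-1) ^ (S (b j))).
  assert (Hsg : forall j, sg j = 1 \/ sg j = -1) by (intros j; apply sign_pow).
  set (T := vsum (fun j => vscal (sg j) (G j)) (p n)).
  assert (HT : vnorm T <= M).
  { apply dnorm_le; [exact HMp|]. intros z. unfold T. rewrite ap_vsum.
    eapply Rle_trans; [|apply (HM (p n))]. apply rsum_le. intros j _. rewrite ap_vscal.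
    unfold Rabs. destruct Rcase_abs; destruct (Hsg j) as [-> | ->]; lra. }
  assert (HTx : forall l, (l < p n)%nat -> eta <= sg l * ap T (x l)).
  { intros l Hl. unfold T. rewrite ap_vsum, <- rsum_scal.
    assert (H1 : rsum (fun j => (if Nat.eqb l j then 1 else 0) * ap (G j) (x l)) (p n) -
       rsum (fun j => if Nat.eqb j l then 0 else Rabs (ap (G j) (x l))) (p n)
       <= rsum (fun k => sg l * ap (vscal (sg k) (G k)) (x l)) (p n)).
    { unfold Rminus. rewrite <- (Rmult_1_l (rsum (fun j => if Nat.eqb j l then 0 else _) _)), <- Ropp_mult_distr_l_reverse, <- rsum_scal, <- rsum_add.
      apply rsum_le. intros j _. rewrite ap_vscal. rewrite (Nat.eqb_sym l j).
      destruct (Nat.eqb_spec j l) as [->|].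
      - destruct (Hsg l) as [-> | ->]; lra.
      - unfold Rabs. destruct Rcase_abs; destruct (Hsg l) as [-> | ->]; destruct (Hsg j) as [-> | ->]; lra. }
    rewrite (rsum_single l (fun j => ap (G j) (x l))) in H1.
    destruct (Nat.ltb_spec l (p n)); [|lia]. specialize (Hoff l (p n) Hl). specialize (Hdiag l). lra. }
  assert (HTy : forall c, (c < n)%nat -> eta <= (-1) ^ (S c) * ap T (y c)).
  { intros c Hc. assert (Hpc : (p (S c) <= p n)%nat) by (apply incr_le; auto).
    specialize (Hy c). induction Hy as [v (j & Hj & ->)|t v w Ht _ IH1 _ IH2].
    - specialize (HTx j ltac:(lia)). unfold sg in HTx. rewrite (Hb c j Hj) in HTx. exact HTx.
    - rewrite ap_add, !ap_scal. nra. }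
  assert (HTz : INR n * eta <= ap T (alt y (fun c => c) n)).
  { unfold alt. rewrite ap_sum, <- rsum_const. apply rsum_le. intros c Hc. rewrite ap_scal. auto. }
  assert (Hb2 := ap_le_bd T (alt y (fun c => c) n) M _ HT (Hz n (fun c => c) (fun j _ => Nat.lt_succ_diag_r j))).
  apply Rabs_le_iff in Hb2.
  assert (Hnp := pos_INR n).
  apply Rmult_lt_compat_r with (r := eta / 2) in Hn; [|lra].
  unfold Rdiv at 1 in Hn. rewrite Rmult_assoc, Rinv_l in Hn by lra.
  assert (e * M <= eta / 2) by nra. nra.
Qed.

(* Differences of consecutive terms make [G j] small at the later terms too, because each sequence
   [G j (x n)] converges along a subsequence. *)
Lemma wuc_contra_blocks (G : nat -> Dual X) (x : nat -> X) M eta : WABS X -> 0 < eta ->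
  (forall n, vnorm (x n) <= 1) -> (forall n z, rsum (fun j => Rabs (ap (G j) z)) n <= M * vnorm z) ->
  (forall l n, rsum (fun j => if Nat.ltb l j then Rabs (ap (G j) (x l)) else 0) n <= eta / 8) ->
  (forall l, eta <= ap (G l) (x l)) -> False.
Proof.
  intros HW Heta Hx HM Hoff Hdiag. set (mu := eta / 8). assert (Hmu : 0 < mu) by (unfold mu; lra).
  destruct (diag_reals (fun j n => ap (G j) (x n))) as (s & a & Hs & Ha).
  { intros k. exists (vnorm (G k) * 1). intros n. apply ap_le_bd; [lra|apply Hx]. }
  assert (HTh : forall jn : nat * nat, exists N, forall i i', (N <= i)%nat -> (N <= i')%nat ->
     Rabs (ap (G (fst jn)) (vsub (x (s i)) (x (s i')))) <= mu * (/ 2) ^ (S (snd jn))).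
  { intros [j n]. assert (H2 : 0 < mu * (/ 2) ^ (S n)) by (apply Rmult_lt_0_compat; [lra|apply pow_lt; lra]).
    destruct (Ha j (mu * (/ 2) ^ (S n) / 2)) as [N HN]; [lra|]. exists N. intros i i' Hi Hi'.
    cbn [fst snd]. rewrite ap_sub. assert (H3 := HN i Hi). assert (H4 := HN i' Hi'). unfold R_dist in *.
    apply Rabs_le. apply Rabs_def2 in H3. apply Rabs_def2 in H4. lra. }
  destruct (func_choice _ HTh) as [Th HTh'].
  (* [Th] is a threshold after which the chosen functional nearly agrees on all later terms, with an
     error that is summable along the construction. *)
  set (t := fix t n := match n with O => O | S n => max (S (t n)) (Th (s (t n), n)) end).
  assert (Ht : forall n, (t n < t (S n))%nat) by (intros n; cbn [t]; lia).
  assert (Htc : forall n i i', (n < i)%nat -> (n < i')%nat ->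
     Rabs (ap (G (s (t n))) (vsub (x (s (t i))) (x (s (t i'))))) <= mu * (/ 2) ^ (S n)).
  { intros n i i' Hi Hi'. apply (HTh' (s (t n), n));
      (apply Nat.le_trans with (t (S n)); [cbn [t]; lia|now apply incr_le]). }
  set (r := fun n => s (t n)). fold (r 0%nat) in *.
  assert (Hr : forall n, (r n < r (S n))%nat) by (intros n; unfold r; apply incr_lt; auto).
  assert (Hr2 : forall n, (r (2 * n + 1)%nat < r (2 * S n + 1)%nat)%nat) by (intros n; apply incr_lt; auto; lia).
  assert (Habs : forall (b : bool) v, 0 <= (if b then Rabs v else 0)).
  { intros b v. destruct b; [apply Rabs_pos|lra]. }
  (* The functionals have odd indices, and the subtracted vector comes just before, where [Hoff]
     makes the functional small. The diagonal is at least [eta - mu = 7 * mu]. The off-diagonal sum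
     is at most [3 * mu]: one [mu] from [Hoff] for each of the two vectors, and one from the
     geometric errors. *)
  apply (biorthogonal_contra (fun j => G (r (2 * j + 1)%nat))
     (fun l => vsub (x (r (2 * l + 1)%nat)) (x (r (2 * l)%nat))) M 2 (3 * mu) HW); [lra| | | |].
  - intros l. eapply Rle_trans; [apply nrm_sub|]. assert (H1 := Hx (r (2 * l + 1)%nat)). assert (H2 := Hx (r (2 * l)%nat)). lra.
  - intros n z. eapply Rle_trans; [|apply (HM (r (2 * n + 1)%nat))].
    apply (rsum_subseq (fun j => Rabs (ap (G j) z)) (fun j => r (2 * j + 1)%nat)); [intros; apply Rabs_pos|exact Hr2].
  - intros l n Hl.
    set (f1 := fun j => if Nat.ltb (r (2 * l + 1)%nat) j then Rabs (ap (G j) (x (r (2 * l + 1)%nat))) else 0).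
    set (f2 := fun j => if Nat.ltb (r (2 * l)%nat) j then Rabs (ap (G j) (x (r (2 * l)%nat))) else 0).
    apply Rle_trans with (rsum (fun j => f1 (r (2 * j + 1)%nat) + f2 (r (2 * j + 1)%nat) + mu * (/ 2) ^ (S j)) n).
    + apply rsum_le. intros j _. unfold f1, f2.
      assert (Hm : 0 < mu * (/ 2) ^ (S j)) by (apply Rmult_lt_0_compat; [lra|apply pow_lt; lra]).
      destruct (Nat.lt_trichotomy l j) as [H|[->|H]].
      * destruct (Nat.eqb_spec j l); [lia|].
        assert (H1 : (r (2 * l + 1) < r (2 * j + 1))%nat) by (apply incr_lt; auto; lia).
        assert (H2 : (r (2 * l) < r (2 * j + 1))%nat) by (apply incr_lt; auto; lia).
        apply Nat.ltb_lt in H1. apply Nat.ltb_lt in H2. rewrite H1, H2, ap_sub.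
        assert (H3 := Rabs_triang (ap (G (r (2 * j + 1)%nat)) (x (r (2 * l + 1)%nat))) (- ap (G (r (2 * j + 1)%nat)) (x (r (2 * l)%nat)))).
        rewrite Rabs_Ropp in H3. unfold Rminus. lra.
      * rewrite Nat.eqb_refl.
        assert (H1 := Habs (Nat.ltb (r (2 * j + 1)) (r (2 * j + 1)))%nat (ap (G (r (2 * j + 1)%nat)) (x (r (2 * j + 1)%nat)))).
        assert (H2 := Habs (Nat.ltb (r (2 * j)) (r (2 * j + 1)))%nat (ap (G (r (2 * j + 1)%nat)) (x (r (2 * j)%nat)))). lra.
      * destruct (Nat.eqb_spec j l); [lia|].
        assert (H1 := Habs (Nat.ltb (r (2 * l + 1)) (r (2 * j + 1)))%nat (ap (G (r (2 * j + 1)%nat)) (x (r (2 * l + 1)%nat)))).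
        assert (H2 := Habs (Nat.ltb (r (2 * l)) (r (2 * j + 1)))%nat (ap (G (r (2 * j + 1)%nat)) (x (r (2 * l)%nat)))).
        assert (H3 := Htc (2 * j + 1)%nat (2 * l + 1)%nat (2 * l)%nat ltac:(lia) ltac:(lia)).
        assert (H4 : (/ 2) ^ (S (2 * j + 1)) <= (/ 2) ^ (S j)).
        { replace (S (2 * j + 1)) with (S j + S j)%nat by lia. rewrite pow_add.
          assert (0 < (/ 2) ^ (S j) <= 1).
          { split; [apply pow_lt; lra|]. rewrite <- (pow1 (S j)). apply pow_incr. lra. }
          nra. }
        apply Rmult_le_compat_l with (r := mu) in H4; [|lra]. unfold r. unfold r in H1, H2. lra.
    + rewrite !rsum_add, rsum_scal. assert (H1 := rsum_geometric n).
      assert (H2 : rsum (fun k => f1 (r (2 * k + 1)%nat)) n <= mu).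
      { eapply Rle_trans; [apply (rsum_subseq f1 (fun j => r (2 * j + 1)%nat)); [intros; apply Habs|exact Hr2]|apply Hoff]. }
      assert (H3 : rsum (fun k => f2 (r (2 * k + 1)%nat)) n <= mu).
      { eapply Rle_trans; [apply (rsum_subseq f2 (fun j => r (2 * j + 1)%nat)); [intros; apply Habs|exact Hr2]|apply Hoff]. }
      nra.
  - intros l. rewrite ap_sub.
    assert (H1 := Hdiag (r (2 * l + 1)%nat)).
    assert (H2 : Rabs (ap (G (r (2 * l + 1)%nat)) (x (r (2 * l)%nat))) <= mu).
    { assert (Hlt : (r (2 * l) < r (2 * l + 1))%nat) by (apply incr_lt; auto; lia).
      assert (Hterm := rsum_term (fun j => if Nat.ltb (r (2 * l)%nat) j then Rabs (ap (G j) (x (r (2 * l)%nat))) else 0)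
        (S (r (2 * l + 1)%nat)) (r (2 * l + 1)%nat) (fun j => Habs _ _) (Nat.lt_succ_diag_r _)).
      cbv beta in Hterm. rewrite (proj2 (Nat.ltb_lt _ _) Hlt) in Hterm.
      eapply Rle_trans; [exact Hterm|apply Hoff]. }
    apply Rabs_le_iff in H2. unfold mu in *. lra.
Qed.

(** A weakly unconditionally Cauchy series in the dual converges, uniformly over signs. Otherwise
    there are consecutive blocks of terms and vectors [x i] of the ball on which the [i]-th block
    has absolute sum at least [eta]; signs turn this block into a functional [G i] attaining that
    sum. As the series of absolute values converges at [x i], the next block can start so late that
    all later ones are small there. *)
Lemma wabs_wuc (g : nat -> Dual X) M : WABS X ->
  (forall n x, rsum (fun k => Rabs (ap (g k) x)) n <= M * vnorm x) ->
  forall eta, 0 < eta -> exists N, forall m x, rsum (fun k => Rabs (ap (g (N + k)%nat) x)) m <= eta * vnorm x.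
Proof.
  intros HW HM eta Heta. apply NNPP. intros Hno.
  assert (Hbad : forall n, exists m x, vnorm x <= 1 /\ eta < rsum (fun k => Rabs (ap (g (n + k)%nat) x)) m).
  { intros n. apply NNPP. intros H. apply Hno. exists n. intros m x.
    destruct (Req_dec (vnorm x) 0) as [E|E].
    - apply nrm_eq0 in E. subst x. rewrite nrm_0, rsum_0; [lra|]. intros k _. now rewrite ap_0, Rabs_R0.
    - assert (Hn := nrm_ge0 x). destruct (nrm_normalize x E) as [Hi H1].
      apply Rnot_lt_le. intros Hlt. apply H. exists m, (vscal (/ vnorm x) x). split; [lra|].
      rewrite (rsum_ext _ (fun k => / vnorm x * Rabs (ap (g (n + k)%nat) x))).
      + rewrite rsum_scal. apply Rmult_lt_reg_l with (vnorm x); [lra|].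
        rewrite <- Rmult_assoc, Rinv_r by lra. lra.
      + intros k _. rewrite ap_scal, Rabs_mult, (Rabs_pos_eq (/ vnorm x)) by lra. reflexivity. }
  set (Q := fun (i : nat) (u : nat * X) => True).
  set (T := fun (i : nat) (u v : nat * X) => (fst u < fst v)%nat /\ vnorm (snd v) <= 1 /\
     eta <= rsum (fun k => Rabs (ap (g (fst u + k)%nat) (snd v))) (fst v - fst u) /\
     forall m, rsum (fun k => Rabs (ap (g (fst v + k)%nat) (snd v))) m <= eta / 8).
  destruct (dep_choice Q T (O, vzero)) as (f & _ & Hf); [exact I| |].
  { intros i [n x0] _. destruct (Hbad n) as (m & x & Hx & Hm).
    destruct (rsum_tail_small (fun k => Rabs (ap (g k) x)) (M * vnorm x) (eta / 8)) as [N HN];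
      [intros; apply Rabs_pos|intros; apply HM|lra|].
    exists (max N (n + m) + 1, x)%nat. split; [exact I|]. unfold T. cbn [fst snd]. split; [lia|]. split; [exact Hx|]. split.
    - left. eapply Rlt_le_trans; [exact Hm|]. apply rsum_mono; [intros; apply Rabs_pos|lia].
    - intros q. set (N' := (max N (n + m) + 1)%nat).
      eapply Rle_trans; [|apply (HN (N' - N + q)%nat)]. rewrite rsum_split.
      assert (H0 : 0 <= rsum (fun k => Rabs (ap (g (N + k)%nat) x)) (N' - N)) by (apply rsum_ge0; intros; apply Rabs_pos).
      assert (H1 : rsum (fun k => Rabs (ap (g (N' + k)%nat) x)) q = rsum (fun k => Rabs (ap (g (N + (N' - N + k))%nat) x)) q).
      { apply rsum_ext. intros k _. replace (N + (N' - N + k))%nat with (N' + k)%nat by (unfold N'; lia). reflexivity. }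
      lra. }
  set (n := fun i => fst (f i)). set (x := fun i => snd (f (S i))).
  assert (Hn : forall i, (n i < n (S i))%nat) by (intros i; apply (Hf i)).
  set (sg := fun i k => if Rle_dec 0 (ap (g k) (x i)) then 1 else -1).
  set (G := fun i => vsum (fun k => vscal (sg i (n i + k)%nat) (g (n i + k)%nat)) (n (S i) - n i)).
  assert (HG : forall i z, Rabs (ap (G i) z) <= rsum (fun k => Rabs (ap (g (n i + k)%nat) z)) (n (S i) - n i)).
  { intros i z. unfold G. rewrite ap_vsum. eapply Rle_trans; [apply rsum_abs|]. apply rsum_le. intros k _.
    rewrite ap_vscal, Rabs_mult. unfold sg. destruct Rle_dec; rewrite ?Rabs_R1, ?Rabs_m1; lra. }
  assert (HGb : forall z i m, rsum (fun j => Rabs (ap (G (i + j)%nat) z)) m <= rsum (fun k => Rabs (ap (g (n i + k)%nat) z)) (n (i + m)%nat - n i)).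
  { intros z i. induction m as [|m IH]; cbn [rsum].
    - rewrite Nat.add_0_r, Nat.sub_diag. simpl. lra.
    - assert (Hle : (n i <= n (i + m))%nat) by (apply incr_le; auto; lia). specialize (Hn (i + m)%nat).
      replace (n (i + S m) - n i)%nat with ((n (i + m) - n i) + (n (S (i + m)) - n (i + m)))%nat
        by (rewrite Nat.add_succ_r; lia).
      rewrite rsum_split. apply Rplus_le_compat; [exact IH|].
      eapply Rle_trans; [apply HG|]. apply Req_le. apply rsum_ext. intros k _.
      replace (n i + (n (i + m)%nat - n i + k))%nat with (n (i + m)%nat + k)%nat by lia. reflexivity. }
  apply (wuc_contra_blocks G x M eta HW Heta).
  - intros i. apply (Hf i).
  - intros m z. assert (H := HGb z O m). cbn [Nat.add] in H. eapply Rle_trans; [exact H|].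
    assert (H1 := HM (n O + (n m - n O))%nat z). rewrite rsum_split in H1.
    assert (H0 : 0 <= rsum (fun k => Rabs (ap (g k) z)) (n O)) by (apply rsum_ge0; intros; apply Rabs_pos). lra.
  - intros l m. destruct (Hf l) as (_ & _ & _ & _ & H4). fold (n (S l)) in H4. fold (x l) in H4.
    apply Rle_trans with (rsum (fun j => Rabs (ap (G (S l + j)%nat) (x l))) m).
    + clear. induction m as [|m IH]; [simpl; lra|].
      destruct (le_lt_dec m l) as [Hm|Hm].
      * rewrite rsum_0; [apply rsum_ge0; intros; apply Rabs_pos|].
        intros k Hk. destruct (Nat.ltb_spec l k); [lia|reflexivity].
      * replace (S m) with (S l + (m - l))%nat at 1 by lia. rewrite rsum_split.
        rewrite (rsum_0 _ (S l)).
        -- rewrite Rplus_0_l. eapply Rle_trans; [|apply (rsum_mono _ (m - l) (S m)); [intros; apply Rabs_pos|lia]].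
           apply rsum_le. intros k _. destruct (Nat.ltb_spec l (S l + k)); [lra|lia].
        -- intros k Hk. destruct (Nat.ltb_spec l k); [lia|reflexivity].
    + eapply Rle_trans; [apply HGb|apply H4].
  - intros i. destruct (Hf i) as (_ & _ & _ & H3 & _). fold (n i) (n (S i)) (x i) in H3.
    eapply Rle_trans; [exact H3|]. unfold G. rewrite ap_vsum. apply rsum_le. intros k _.
    rewrite ap_vscal. unfold sg. destruct Rle_dec; [rewrite Rabs_pos_eq|rewrite Rabs_left]; lra.
Qed.
End WUC.

(** * Small convex combinations of separated vectors *)

Lemma kr_closed {X : NSpace} {HX : is_normed X} (l : frame X) : closed_set (kr l).
Proof.
  intros u x Hu Hx. destruct (pj_bound l) as [C [HC HlC]]. apply nrm_eq0.
  apply Rle_antisym; [|apply nrm_ge0]. apply le_epsilon. intros eps Heps. rewrite Rplus_0_l.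
  destruct (Hx (eps / C)) as [N HN]; [now apply Rdiv_lt_0_compat|]. specialize (HN N (le_n N)).
  replace (pj l x) with (vopp (pj l (vsub (u N) x))) by (rewrite pj_sub, (Hu N); vlin).
  rewrite nrm_opp. eapply Rle_trans; [apply HlC|].
  apply Rmult_lt_compat_l with (r := C) in HN; [|exact HC].
  replace (C * (eps / C)) with eps in HN by (field; lra). lra.
Qed.

Section Separated.
Context {X : NSpace} {HX : is_normed X}.
Variables F P : nat -> frame X.
Hypothesis HF : forall i j y, (i <= j)%nat -> rg (F i) y -> rg (F j) y.
Hypothesis HP : forall i j w, (i <= j)%nat -> kr (P j) w -> kr (P i) w.
Hypothesis Hau : forall j x w, rg (F j) x -> kr (P j) w -> vnorm (vsub x w) <= (1 + (/ 2) ^ (j + 2)) * vnorm (vadd x w).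

(** By (au) along the chain, the blocks [y i] are unconditional up to a factor 2. Their plain mean,
    a convex combination of the [v i], is then as small as their alternating mean. *)
Lemma separated_contra (v : nat -> X) j0 C eps : WABS X -> 0 < eps -> (forall i, vnorm (v i) <= C) ->
  (forall i, kr (P (j0 + i)%nat) (v i) /\ rg (F (S (j0 + i))) (v i)) ->
  (forall a b y, blk v a b y -> eps <= vnorm y) -> False.
Proof.
  intros HW Heps HC Hv Hlow.
  destruct (wabs_alternating v C HW HC) as (y & p & Hp0 & Hp & Hy & Halt).
  destruct (Halt (eps / 4)) as (K & HK & Hz); [lra|].
  destruct (INR_unbounded (4 * K / eps)) as [n0 Hn0]. set (n := S n0).
  set (e := fun i => (-1) ^ (S i)). assert (He : sgn_seq e) by (intros i; apply sign_pow).
  assert (Hpk : forall k, (k <= p k)%nat) by (intros k; now apply incr_ge).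
  assert (Hyr : forall i k, (i < k)%nat -> rg (F (j0 + p k)%nat) (y i)).
  { intros i k Hik. apply (conv_in _ (rg (F (j0 + p k)%nat)) _ (rg_subspace _)) with (2 := Hy i).
    intros w (j & Hj & ->). assert (p (S i) <= p k)%nat by (apply incr_le; auto).
    apply (HF (S (j0 + j))); [lia|apply Hv]. }
  assert (Hyk : forall i k, (k <= i)%nat -> kr (P (j0 + p k)%nat) (y i)).
  { intros i k Hik. apply (conv_in _ (kr (P (j0 + p k)%nat)) _ (kr_subspace _)) with (2 := Hy i).
    intros w (j & Hj & ->). assert (p k <= p i)%nat by (apply incr_le; auto).
    apply (HP _ (j0 + j)); [lia|apply Hv]. }
  assert (Hflip : flips (fun i => vscal (e i) (y i)) n (fun k => 1 * (/ 2) ^ (k + 2))).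
  { intros e' k He' Hk. rewrite (vsum_split_at (fun i => vscal (e' i) (vscal (e i) (y i))) k n) by lia.
    eapply Rle_trans; [apply (Hau (j0 + p k)%nat)|].
    - apply vsum_in; [apply rg_subspace|]. intros i Hi. apply rg_subspace, rg_subspace, Hyr. exact Hi.
    - apply vsum_in; [apply kr_subspace|]. intros i Hi. destruct (Nat.ltb_spec i k); [apply kr_subspace|].
      apply kr_subspace, kr_subspace, Hyk. exact H.
    - apply Rmult_le_compat_r; [apply nrm_ge0|]. rewrite Rmult_1_l.
      assert (Hle : (/ 2) ^ (j0 + p k + 2) <= (/ 2) ^ (k + 2)).
      { rewrite !pow_inv. apply Rinv_le_contravar; [apply pow_lt; lra|].
        apply Rle_pow; [lra|]. specialize (Hpk k). lia. }
      lra. }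
  assert (Hd : forall k, 0 <= 1 * (/ 2) ^ (k + 2) <= 1 * (/ 2) ^ (k + 2)).
  { intros k. assert (0 < (/ 2) ^ (k + 2)) by (apply pow_lt; lra). lra. }
  assert (Hch := sign_change _ n _ 1 ltac:(lra) Hd Hflip e He).
  (* The signs [e] applied twice cancel, so the plain sum is compared with the alternating one. *)
  rewrite (vsum_ext _ y) in Hch.
  - assert (H1 : vnorm (vsum (fun i => vscal (e i) (y i)) n) <= eps / 4 * INR n + K) by (apply (Hz n (fun j => j)); auto).
    assert (Hnn : 0 < INR n) by (apply lt_0_INR; unfold n; lia).
    assert (H2 : eps <= vnorm (vsum (fun i => vscal (/ INR n) (y i)) n)).
    { apply (Hlow 0%nat (p n)). assert (Hi : 0 < / INR n) by now apply Rinv_0_lt_compat.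
      assert (Hcv : conv (blk v 0 (p n)) (vsum (fun i => vscal (/ INR n) (y i)) n)).
      { apply (conv_of_weights _ (fun _ => / INR n)).
        - intros i Hi'. apply (blk_sub v (p i) (p (S i))); [lia|apply incr_le; auto|apply Hy].
        - intros _. lra.
        - rewrite rsum_const, Rinv_r; lra. }
      induction Hcv; [assumption|now apply conv_mix]. }
    rewrite vsum_scal, nrm_scal_pos in H2 by (left; now apply Rinv_0_lt_compat).
    apply Rmult_le_compat_l with (r := INR n) in H2; [|lra].
    rewrite <- Rmult_assoc, Rinv_r, Rmult_1_l in H2 by lra.
    apply Rmult_lt_compat_r with (r := eps) in Hn0; [|exact Heps].
    unfold Rdiv in Hn0. rewrite Rmult_assoc, Rinv_l in Hn0 by lra.
    assert (INR n0 <= INR n) by (apply le_INR; unfold n; lia). nra.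
  - intros i _. rewrite vscalA. destruct (He i) as [-> | ->]; vlin.
Qed.

(** [N] must not depend on [w], which is obtained by compactness: if every length had a
    counterexample, the coordinates of these, lying in fixed finite dimensional spaces, would
    converge along a subsequence, and the limit would contradict [separated_contra]. *)
Lemma small_conv j0 C eps : WABS X -> 0 < eps -> exists N, (j0 < N)%nat /\ forall w : nat -> X,
  (forall j, (j0 <= j < N)%nat -> kr (P j) (w j) /\ rg (F (S j)) (w j) /\ vnorm (w j) <= C) ->
  exists y, blk w j0 N y /\ vnorm y < eps.
Proof.
  intros HW Heps. apply NNPP. intros Hno.
  assert (Hbad : forall n, exists w : nat -> X,
    (forall j, (j0 <= j < j0 + S n)%nat -> kr (P j) (w j) /\ rg (F (S j)) (w j) /\ vnorm (w j) <= C) /\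
    forall y, blk w j0 (j0 + S n) y -> eps <= vnorm y).
  { intros n. apply NNPP. intros H. apply Hno. exists (j0 + S n)%nat. split; [lia|]. intros w Hw.
    apply NNPP. intros H'. apply H. exists w. split; [exact Hw|]. intros y Hy.
    apply Rnot_lt_le. intros Hlt. apply H'. now exists y. }
  destruct (func_choice _ Hbad) as [w Hw].
  assert (HC0 : 0 <= C).
  { destruct (Hw O) as [H _]. eapply Rle_trans; [apply (nrm_ge0 (w O j0))|]. apply H. lia. }
  (* The counterexample number [n] is only controlled up to the index [n]; it is continued by zeros,
     which keeps all the bounds. *)
  set (x := fun i n => if Nat.leb i n then w n (j0 + i)%nat else vzero).
  assert (Hxw : forall i n, (i <= n)%nat -> x i n = w n (j0 + i)%nat).
  { intros i n Hin. unfold x. destruct (Nat.leb_spec i n); [reflexivity|lia]. }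
  assert (HxC : forall i n, vnorm (x i n) <= C).
  { intros i n. unfold x. destruct (Nat.leb_spec i n); [apply Hw; lia|rewrite nrm_0; exact HC0]. }
  assert (Hxr : forall i n, rg (F (S (j0 + i))) (x i n)).
  { intros i n. unfold x. destruct (Nat.leb_spec i n); [apply Hw; lia|apply rg_subspace]. }
  assert (Hxk : forall i n, kr (P (j0 + i)%nat) (x i n)).
  { intros i n. unfold x. destruct (Nat.leb_spec i n); [apply Hw; lia|apply kr_subspace]. }
  destruct (diag_frames (fun i => F (S (j0 + i))) x) as (s & v & Hs & Hv).
  { intros j. exists C. apply HxC. }
  assert (Hv' : forall i, converges_to (fun n => x i (s n)) (v i)).
  { intros i eta Heta. destruct (Hv i eta Heta) as [N HN]. exists N. intros n Hn.
    specialize (HN n Hn). rewrite (Hxr i (s n)) in HN. exact HN. }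
  apply (separated_contra v j0 (C + 1) eps HW Heps).
  - intros i. destruct (Hv' i 1 Rlt_0_1) as [N HN]. specialize (HN N (le_n N)).
    assert (H := nrm_le_sub (v i) (x i (s N))). rewrite nrm_subC in H. specialize (HxC i (s N)). lra.
  - intros i. split; [apply (kr_closed _ (fun n => x i (s n)))|apply (rg_closed _ (fun n => x i (s n)))]; auto.
  - intros a b y Hy.
    assert (Happ : forall eta, 0 < eta -> exists N, forall n, (N <= n)%nat ->
       exists y', blk (w (s n)) (j0 + a) (j0 + b) y' /\ vnorm (vsub y' y) <= eta).
    { intros eta Heta. induction Hy as [z (j & Hj & ->)|t z1 z2 Ht _ [N1 IH1] _ [N2 IH2]].
      - destruct (Hv' j eta Heta) as [N HN]. exists (max N j). intros n Hn.
        exists (w (s n) (j0 + j)%nat). split.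
        + apply conv_base. exists (j0 + j)%nat. split; [lia|reflexivity].
        + rewrite <- Hxw by (assert (n <= s n)%nat by (apply incr_ge; auto); lia). left. apply HN. lia.
      - exists (max N1 N2). intros n Hn. destruct (IH1 n ltac:(lia)) as (y1 & A1 & B1).
        destruct (IH2 n ltac:(lia)) as (y2 & A2 & B2).
        exists (vadd (vscal t y1) (vscal (1 - t) y2)). split; [now apply conv_mix|].
        replace (vsub _ _) with (vadd (vscal t (vsub y1 z1)) (vscal (1 - t) (vsub y2 z2))) by vlin.
        eapply Rle_trans; [apply nrm_add|]. rewrite !nrm_scal_pos by lra. nra. }
    apply le_epsilon. intros eta Heta. destruct (Happ eta Heta) as [N HN].
    destruct (HN (max N b) ltac:(lia)) as (y' & Hy' & Hyy').
    assert (Hb : (b <= s (max N b))%nat) by (assert (max N b <= s (max N b))%nat by (apply incr_ge; auto); lia).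
    assert (H1 : eps <= vnorm y').
    { apply (proj2 (Hw (s (max N b)))). apply (blk_sub _ (j0 + a) (j0 + b)); [lia|lia|exact Hy']. }
    assert (H2 := nrm_le_sub y' y). lra.
Qed.
End Separated.

(** * Unconditional systems of functionals *)

Lemma half_pow_pos k : 0 < (/ 2) ^ k.
Proof. apply pow_lt. lra. Qed.
Lemma half_pow_le i j : (i <= j)%nat -> (/ 2) ^ j <= (/ 2) ^ i.
Proof.
  intros H. rewrite !pow_inv. apply Rinv_le_contravar; [apply pow_lt; lra|]. apply Rle_pow; [lra|exact H].
Qed.

(** [F (S j)] is chosen after [P j], to contain the range of its projection and a space supplied by
    the dual property; [P (S j)] comes after [F (S j)]. The exponents are those of [sign_change]: a
    cut by (au) occurs at [j], while the cut after the functional piece number [j] occurs at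
    position [j + 1], whence [j + 3]. *)
Lemma chain (X : NSpace) {HX : is_normed X} (d : nat -> X) th : prop_au X -> prop_au_star X -> 0 < th ->
  exists F P : nat -> frame X,
    (forall x, rg (F O) x -> x = vzero) /\ (forall j, good (P j)) /\
    (forall j x, rg (F j) x -> rg (F (S j)) x) /\ (forall j, rg (F (S j)) (d j)) /\
    (forall j x, rg (F (S j)) (pj (P j) x)) /\ (forall j w, kr (P (S j)) w -> kr (P j) w) /\
    (forall j x w, rg (F j) x -> kr (P j) w -> vnorm (vsub x w) <= (1 + th * (/ 2) ^ (j + 2)) * vnorm (vadd x w)) /\
    (forall j f q, adj (P j) f = f -> vanish (F (S j)) q ->
       vnorm (vsub f q) <= (1 + th * (/ 2) ^ (j + 3)) * vnorm (vadd f q)).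
Proof.
  intros Hau Haus Hth.
  assert (Hc : forall k, 0 < th * (/ 2) ^ k) by (intros k; apply Rmult_lt_0_compat; [lra|apply half_pow_pos]).
  set (Q := fun (j : nat) (u : frame X * frame X) => good (fst u) /\ good (snd u) /\
    forall x w, rg (fst u) x -> kr (snd u) w -> vnorm (vsub x w) <= (1 + th * (/ 2) ^ (j + 2)) * vnorm (vadd x w)).
  set (T := fun (j : nat) (u v : frame X * frame X) => (forall x, rg (fst u) x -> rg (fst v) x) /\ rg (fst v) (d j) /\
    (forall x, rg (fst v) (pj (snd u) x)) /\ (forall w, kr (snd v) w -> kr (snd u) w) /\
    forall f q, adj (snd u) f = f -> vanish (fst v) q -> vnorm (vsub f q) <= (1 + th * (/ 2) ^ (j + 3)) * vnorm (vadd f q)).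
  destruct (au_frames Hau nil nil _ good_nil (Hc 2%nat)) as (P0 & GP0 & _ & HP0).
  destruct (dep_choice Q T (nil, P0)) as (u & E & Hu).
  - split; [apply good_nil|]. split; [exact GP0|exact HP0].
  - intros j [F P] (G1 & G2 & _). cbn [fst snd] in *.
    destruct (au_star_frames Haus P _ (Hc (j + 3)%nat)) as (l & Gl & Hl).
    destruct (frame_span_frame F P G1) as (F1 & GF1 & K1 & K1').
    destruct (frame_span_frame F1 l GF1) as (F2 & GF2 & K2 & K2').
    destruct (frame_span F2 [d j] GF2) as (F3 & GF3 & K3 & K3').
    destruct (au_frames Hau F3 P _ G2 (Hc (S j + 2)%nat)) as (P' & GP' & K4 & K5).
    exists (F3, P'). split; [split; [exact GF3|split; [exact GP'|exact K5]]|].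
    unfold T. cbn [fst snd]. split; [auto|]. split; [apply K3'; now left|]. split; [auto|]. split; [auto|].
    intros f q Hf Hq. apply Hl; [exact Hf|]. intros x Hx. apply Hq. rewrite <- Hx. auto.
  - exists (fun j => fst (u j)), (fun j => snd (u j)).
    split; [|split; [|split; [|split; [|split; [|split; [|split]]]]]]; try (intros j; apply (Hu j)).
    intros x Hx. rewrite E in Hx. unfold rg in Hx. simpl in Hx. now symmetry.
Qed.

(** * Cutting functionals at gaps, and finite nets of pieces *)

Section System.
Context {X : NSpace} {HX : is_normed X}.
Variables (F P : nat -> frame X) (th : R) (t : nat -> nat).
Hypothesis Hth : 0 < th <= 1.
Hypothesis HF0 : forall x, rg (F O) x -> x = vzero.
Hypothesis GP : forall j, good (P j).
Hypothesis HFS : forall j x, rg (F j) x -> rg (F (S j)) x.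
Hypothesis HFP : forall j x, rg (F (S j)) (pj (P j) x).
Hypothesis HPS : forall j w, kr (P (S j)) w -> kr (P j) w.
Hypothesis Hau : forall j x w, rg (F j) x -> kr (P j) w ->
  vnorm (vsub x w) <= (1 + th * (/ 2) ^ (j + 2)) * vnorm (vadd x w).
Hypothesis Haus : forall j f q, adj (P j) f = f -> vanish (F (S j)) q ->
  vnorm (vsub f q) <= (1 + th * (/ 2) ^ (j + 3)) * vnorm (vadd f q).
Hypothesis Ht0 : t O = O.
Hypothesis Ht : forall i, (t i < t (S i))%nat.
Hypothesis Hsmall : forall i (w : nat -> X),
  (forall j, (t i <= j < t (S i))%nat -> kr (P j) (w j) /\ rg (F (S j)) (w j) /\ vnorm (w j) <= 3) ->
  exists y, blk w (t i) (t (S i)) y /\ vnorm y < th * (/ 2) ^ (S i).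

Lemma F_mono i j y : (i <= j)%nat -> rg (F i) y -> rg (F j) y.
Proof. intros Hij Hy. induction Hij; auto. Qed.
Lemma P_mono i j w : (i <= j)%nat -> kr (P j) w -> kr (P i) w.
Proof. intros Hij Hw. induction Hij; auto. Qed.

(* A functional vanishing on the gap [kr (P j)] meet [rg (F (S j))] splits there into a part killing
   [kr (P j)] and a part killing [rg (F (S j))], to which (au* ) applies. *)
Definition gaps (j : nat -> nat) (n : nat) (m : X) : Prop :=
  exists w : nat -> X, (forall i, (i < n)%nat -> kr (P (j i)) (w i) /\ rg (F (S (j i))) (w i)) /\ m = vsum w n.

Definition admissible (j : nat -> nat) (n : nat) : Prop := forall i, (i < n)%nat -> (t i <= j i < t (S i))%nat.

Lemma gaps_subspace j n : subspace (gaps j n).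
Proof.
  split; [|split].
  - exists (fun _ => vzero). split; [|symmetry; now apply vsum_0].
    intros i _. split; [apply kr_subspace|apply rg_subspace].
  - intros x y (w & Hw & ->) (w' & Hw' & ->). exists (fun i => vadd (w i) (w' i)). split.
    + intros i Hi. destruct (Hw i Hi), (Hw' i Hi). split; [now apply kr_subspace|now apply rg_subspace].
    + symmetry. apply vsum_add.
  - intros a x (w & Hw & ->). exists (fun i => vscal a (w i)). split.
    + intros i Hi. destruct (Hw i Hi). split; [now apply kr_subspace|now apply rg_subspace].
    + symmetry. apply vsum_scal.
Qed.

Lemma gaps_rg j n m : admissible j n -> gaps j n m -> rg (F (t n)) m.
Proof.
  intros Hj (w & Hw & ->). apply vsum_in; [apply rg_subspace|]. intros i Hi.
  apply (F_mono (S (j i))); [|now apply Hw]. specialize (Hj i Hi).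
  assert (t (S i) <= t n)%nat by (apply incr_le; auto). lia.
Qed.

(** If no gap of the next block were suitable, each index [k] would give a combination [m k + w k]
    too close to [x], with [m k] in the gaps already chosen and [w k] in the gap [k]. Some convex
    combination of the [w k] is almost zero, and the same combination of the [m k] is an element of
    the old gaps too close to [x]. *)
Lemma gaps_distance x n : vnorm x <= 1 -> exists j, admissible j n /\
  forall m, gaps j n m -> vnorm x - rsum (fun i => th * (/ 2) ^ (S i)) n <= vnorm (vsub x m).
Proof.
  intros Hx. induction n as [|n (j & Hj & IH)].
  - exists (fun _ => O). split; [intros i Hi; lia|]. intros m (w & _ & ->). simpl.
    replace (vsub x vzero) with x by vlin. lra.
  - apply NNPP. intros Hno. cbn [rsum] in Hno.
    set (Dn := vnorm x - rsum (fun i => th * (/ 2) ^ (S i)) n) in *. set (ep := th * (/ 2) ^ (S n)) in *.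
    assert (Hep : 0 < ep) by (apply Rmult_lt_0_compat; [lra|apply half_pow_pos]).
    assert (HDn : Dn <= 1).
    { unfold Dn. assert (0 <= rsum (fun i => th * (/ 2) ^ (S i)) n); [|lra].
      apply rsum_ge0. intros k _. apply Rmult_le_pos; [lra|]. left. apply half_pow_pos. }
    assert (Hbad : forall k, exists mw : X * X, (t n <= k < t (S n))%nat ->
       gaps j n (fst mw) /\ kr (P k) (snd mw) /\ rg (F (S k)) (snd mw) /\
       vnorm (vsub x (vadd (fst mw) (snd mw))) <= Dn - ep).
    { intros k. destruct (classic (t n <= k < t (S n))%nat) as [Hk|Hk]; [|exists (vzero, vzero); intros; contradiction].
      apply NNPP. intros H. apply Hno. exists (fun i => if Nat.eqb i n then k else j i). split.
      - intros i Hi. destruct (Nat.eqb_spec i n) as [->|]; [exact Hk|apply Hj; lia].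
      - intros m (w & Hw & ->). cbn [vsum]. apply Rnot_lt_le. intros Hlt. apply H.
        exists (vsum w n, w n). intros _. cbn [fst snd].
        assert (Hwn := Hw n (Nat.lt_succ_diag_r n)). rewrite Nat.eqb_refl in Hwn.
        split; [|split; [apply Hwn|split; [apply Hwn|unfold Dn; lra]]].
        exists w. split; [|reflexivity]. intros i Hi. specialize (Hw i ltac:(lia)).
        destruct (Nat.eqb_spec i n); [lia|exact Hw]. }
    destruct (func_choice _ Hbad) as [mw Hmw].
    destruct (Hsmall n (fun k => snd (mw k))) as (y & Hy & Hyn).
    (* The bound 3 in [Hsmall]: [m + w] has norm at most 2, so by (au) [m - w] has norm at most 4,
       and [2 * w] is their difference. *)
    { intros k Hk. destruct (Hmw k Hk) as (H1 & H2 & H3 & H4). repeat split; auto.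
      assert (Hr : rg (F k) (fst (mw k))) by (apply (F_mono (t n)); [lia|now apply (gaps_rg j)]).
      assert (H5 := Hau k _ _ Hr H2).
      assert (H6 : vnorm (vadd (fst (mw k)) (snd (mw k))) <= 2).
      { replace (vadd _ _) with (vsub x (vsub x (vadd (fst (mw k)) (snd (mw k))))) by vlin.
        eapply Rle_trans; [apply nrm_sub|]. lra. }
      assert (H7 : 2 * vnorm (snd (mw k)) <= vnorm (vadd (fst (mw k)) (snd (mw k))) + vnorm (vsub (fst (mw k)) (snd (mw k)))).
      { rewrite <- nrm_scal_pos by lra.
        replace (vscal 2 _) with (vsub (vadd (fst (mw k)) (snd (mw k))) (vsub (fst (mw k)) (snd (mw k)))) by vlin. apply nrm_sub. }
      assert (H8 : (/ 2) ^ (k + 2) <= (/ 2) ^ 0) by (apply half_pow_le; lia). simpl in H8.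
      assert (H9 := half_pow_pos (k + 2)). assert (H10 := nrm_ge0 (vadd (fst (mw k)) (snd (mw k)))).
      assert (th * (/ 2) ^ (k + 2) <= 1) by nra. nra. }
    assert (HS : exists m, gaps j n m /\ vnorm (vsub x (vadd m y)) <= Dn - ep).
    { clear Hyn. induction Hy as [v (k & Hk & ->)|s v v' Hs _ (m & Hm & IHm) _ (m' & Hm' & IHm')].
      - exists (fst (mw k)). destruct (Hmw k Hk) as (H1 & _ & _ & H4). auto.
      - exists (vadd (vscal s m) (vscal (1 - s) m')). split; [now apply gaps_subspace; apply gaps_subspace|].
        replace (vsub _ _) with (vadd (vscal s (vsub x (vadd m v))) (vscal (1 - s) (vsub x (vadd m' v')))) by vlin.
        eapply Rle_trans; [apply nrm_add|]. rewrite !nrm_scal_pos by lra. nra. }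
    destruct HS as (m & Hm & Hxm). specialize (IH m Hm). fold ep in Hyn.
    assert (H := nrm_sub_tri x (vadd m y) m). replace (vsub (vadd m y) m) with y in H by vlin. lra.
Qed.

Lemma gaps_functional x n : vnorm x = 1 -> exists j (f : Dual X), admissible j n /\ vnorm f <= 1 /\
  (forall m, gaps j n m -> ap f m = 0) /\ 1 - th <= ap f x.
Proof.
  intros Hx. destruct (gaps_distance x n) as (j & Hj & Hd); [lra|].
  assert (Hs : rsum (fun i => th * (/ 2) ^ (S i)) n <= th).
  { rewrite rsum_scal. assert (H := rsum_geometric n). nra. }
  destruct (gaps_subspace j n) as (G0 & GA & GS).
  destruct (hahn_banach 1 (fun z r => exists m s, gaps j n m /\ z = vadd m (vscal s x) /\ r = s * (1 - th))) as (f & Hf1 & Hf2); [lra| |].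
  - split; [|split; [|split]].
    + exists vzero, 0. repeat split; [exact G0|vlin|ring].
    + intros z r z' r' (m & s & Hm & -> & ->) (m' & s' & Hm' & -> & ->).
      exists (vadd m m'), (s + s'). repeat split; [now apply GA|vlin|ring].
    + intros a z r (m & s & Hm & -> & ->). exists (vscal a m), (a * s). repeat split; [now apply GS|vlin|ring].
    + intros z r (m & s & Hm & -> & ->). rewrite Rmult_1_l.
      assert (Hn := nrm_ge0 (vadd m (vscal s x))). destruct (Rle_lt_dec s 0) as [Hs0|Hs0]; [nra|].
      assert (H := Hd _ (GS (- / s) _ Hm)).
      assert (He : vnorm (vadd m (vscal s x)) = s * vnorm (vsub x (vscal (- / s) m))).
      { rewrite <- nrm_scal_pos by lra. f_equal. vcoefs; field; lra. }
      rewrite He. nra.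
  - exists j, f. split; [exact Hj|]. split; [exact Hf2|]. split.
    + intros m Hm. apply Hf1. exists m, 0. repeat split; [exact Hm|vlin|ring].
    + right. symmetry. apply Hf1. exists vzero, 1. repeat split; [exact G0|vlin|ring].
Qed.

Definition piece (f : Dual X) (j : nat -> nat) (i : nat) : Dual X :=
  match i with O => adj (P (j O)) f | S i => vsub (adj (P (j (S i))) f) (adj (P (j i)) f) end.

Lemma piece_sum f j n : vsum (piece f j) (S n) = adj (P (j n)) f.
Proof.
  induction n as [|n IH].
  - change (vadd vzero (adj (P (j O)) f) = adj (P (j O)) f). vlin.
  - change (vadd (vsum (piece f j) (S n)) (vsub (adj (P (j (S n))) f) (adj (P (j n)) f)) = adj (P (j (S n))) f).
    rewrite IH. vlin.
Qed.

Section Pieces.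
Variables (f : Dual X) (j : nat -> nat) (n : nat).
Hypothesis Hj : admissible j (S n).
Hypothesis Hf1 : vnorm f <= 1.
Hypothesis Hf0 : forall m, gaps j (S n) m -> ap f m = 0.

Lemma j_lt i k : (i < k < S n)%nat -> (j i < j k)%nat.
Proof.
  intros Hik. assert (H1 := Hj i ltac:(lia)). assert (H2 := Hj k ltac:(lia)).
  assert (t (S i) <= t k)%nat by (apply incr_le; auto; lia). lia.
Qed.

(** The residue of [x] lies in the gap: it is in [kr (P (j i))], and [rg (F (S (j i)))] contains
    both [x] and its projection. *)
Lemma gap_vanish i x : (i < S n)%nat -> rg (F (S (j i))) x -> ap f (pj (P (j i)) x) = ap f x.
Proof.
  intros Hi Hx. assert (H : ap f (vsub x (pj (P (j i)) x)) = 0).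
  { apply Hf0. exists (fun k => vscal (if Nat.eqb i k then 1 else 0) (vsub x (pj (P (j i)) x))). split.
    - intros k Hk. destruct (Nat.eqb_spec i k) as [<-|].
      + split; [apply kr_subspace, kr_res, GP|]. apply rg_subspace. apply rg_sub; [exact Hx|apply HFP].
      + rewrite vscal0. split; [apply kr_subspace|apply rg_subspace].
    - rewrite (vsum_single (fun _ => vsub x (pj (P (j i)) x))). destruct (Nat.ltb_spec i (S n)); [reflexivity|lia]. }
  rewrite ap_sub in H. lra.
Qed.

Lemma piece_vanish i : (S i < S n)%nat -> vanish (F (S (j i))) (piece f j (S i)).
Proof.
  intros Hi x Hx. unfold piece. rewrite ap_vsub, !ap_adj, !gap_vanish; auto; try lia; [ring|].
  apply (F_mono (S (j i))); [|exact Hx]. assert (j i < j (S i))%nat by (apply j_lt; lia). lia.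
Qed.

Lemma adj_kr l g : good l -> (forall w, kr l w -> ap g w = 0) -> adj l g = g.
Proof.
  intros Gl H. apply ap_ext. intros x. rewrite ap_adj. assert (H1 := H _ (kr_res l x Gl)).
  rewrite ap_sub in H1. lra.
Qed.

Lemma piece_kr i w : (i < S n)%nat -> kr (P (j i)) w -> ap (piece f j i) w = 0.
Proof.
  intros Hi Hw. destruct i as [|i]; unfold piece; rewrite ?ap_vsub, !ap_adj, Hw.
  - apply ap_0.
  - assert (Hlt : (j i < j (S i))%nat) by (apply j_lt; lia).
    assert (Hw' : kr (P (j i)) w) by (apply (P_mono _ (j (S i))); [lia|exact Hw]).
    rewrite Hw', ap_0. ring.
Qed.

(** The remainder [f - adj (P (j n)) f] is added as a last piece, so that the sum is [f]. At each
    cut the head kills [kr (P (j k))] and the tail kills [rg (F (S (j k)))], so (au* ) reflects the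
    tail and [sign_change] gives all choices of signs. *)
Lemma pieces_bound z : rsum (fun i => Rabs (ap (piece f j i) z)) (S n) <= (1 + th) * vnorm z.
Proof.
  set (v := fun i => if Nat.ltb i (S n) then piece f j i else vsub f (adj (P (j n)) f)).
  assert (Hv : forall i, (i < S n)%nat -> v i = piece f j i).
  { intros i Hi. unfold v. destruct (Nat.ltb_spec i (S n)); [reflexivity|lia]. }
  assert (Hvl : v (S n) = vsub f (adj (P (j n)) f)).
  { unfold v. destruct (Nat.ltb_spec (S n) (S n)); [lia|reflexivity]. }
  assert (Hsum : vsum v (S (S n)) = f).
  { change (vadd (vsum v (S n)) (v (S n)) = f). rewrite (vsum_ext v (piece f j)) by auto. rewrite piece_sum, Hvl. vlin. }
  assert (Hfl : flips v (S (S n)) (fun k => th * (/ 2) ^ (k + 2))).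
  { intros e k He Hk. rewrite (vsum_split_at (fun i => vscal (e i) (v i)) k (S (S n))) by lia.
    destruct k as [|k]; [lia|].
    eapply Rle_trans; [apply (Haus (j k))|].
    - apply adj_kr; [apply GP|]. intros w Hw. rewrite ap_vsum. apply rsum_0. intros i Hi.
      assert (Hki : kr (P (j i)) w).
      { apply (P_mono (j i) (j k)); [|exact Hw]. destruct (Nat.eq_dec i k) as [->|]; [lia|].
        assert (j i < j k)%nat by (apply j_lt; lia). lia. }
      rewrite ap_vscal, Hv, (piece_kr i w ltac:(lia) Hki) by lia. ring.
    - intros x Hx. rewrite ap_vsum. apply rsum_0. intros i Hi.
      destruct (Nat.ltb_spec i (S k)); [apply ap_vzero|]. rewrite ap_vscal.
      destruct (Nat.eq_dec i (S n)) as [->|Hin].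
      + rewrite Hvl, ap_vsub, ap_adj, gap_vanish; [ring|lia|].
        apply (F_mono (S (j k))); [|exact Hx].
        destruct (Nat.eq_dec k n) as [->|]; [lia|]. assert (j k < j n)%nat by (apply j_lt; lia). lia.
      + rewrite Hv by lia. destruct i as [|i]; [lia|]. rewrite piece_vanish; [ring|lia|].
        apply (F_mono (S (j k))); [|exact Hx].
        destruct (Nat.eq_dec k i) as [->|]; [lia|]. assert (j k < j i)%nat by (apply j_lt; lia). lia.
    (* The cut is at position [S k], so the exponent required is [S k + 2]; (au* ) gives [j k + 3],
       which is enough as [j k >= t k >= k]. *)
    - apply Rmult_le_compat_r; [apply dnorm_ge0|]. apply Rplus_le_compat_l.
      apply Rmult_le_compat_l; [lra|]. apply half_pow_le.
      specialize (Hj k ltac:(lia)). assert (k <= t k)%nat by now apply incr_ge. lia. }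
  assert (Hd : forall k, 0 <= th * (/ 2) ^ (k + 2) <= th * (/ 2) ^ (k + 2)).
  { intros k. assert (H := half_pow_pos (k + 2)). nra. }
  assert (Hall : forall e, sgn_seq e -> vnorm (vsum (fun i => vscal (e i) (v i)) (S (S n))) <= 1 + th).
  { intros e He. eapply Rle_trans; [apply (sign_change v _ _ th Hth Hd Hfl e He)|]. rewrite Hsum. nra. }
  set (e := fun i => if Rle_dec 0 (ap (piece f j i) z) then 1 else -1).
  (* Averaging the two choices of sign for the remainder removes it. *)
  set (e1 := fun i => if Nat.eqb i (S n) then 1 else e i). set (e2 := fun i => if Nat.eqb i (S n) then -1 else e i).
  assert (He : sgn_seq e) by (intros i; unfold e; destruct Rle_dec; auto).
  assert (H1 := Hall e1 ltac:(intros i; unfold e1; destruct Nat.eqb; auto)).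
  assert (H2 := Hall e2 ltac:(intros i; unfold e2; destruct Nat.eqb; auto)).
  assert (Es : forall a e', (forall i, (i < S n)%nat -> e' i = e i) -> e' (S n) = a ->
    vsum (fun i => vscal (e' i) (v i)) (S (S n)) = vadd (vsum (fun i => vscal (e i) (piece f j i)) (S n)) (vscal a (v (S n)))).
  { intros a e' He' Ha. change (vadd (vsum (fun i => vscal (e' i) (v i)) (S n)) (vscal (e' (S n)) (v (S n))) =
      vadd (vsum (fun i => vscal (e i) (piece f j i)) (S n)) (vscal a (v (S n)))).
    rewrite Ha. f_equal. apply vsum_ext. intros i Hi. now rewrite He', Hv. }
  rewrite (Es 1) in H1.
  2: { intros i Hi. unfold e1. destruct (Nat.eqb_spec i (S n)); [lia|reflexivity]. }
  2: { unfold e1. now rewrite Nat.eqb_refl. }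
  rewrite (Es (-1)) in H2.
  2: { intros i Hi. unfold e2. destruct (Nat.eqb_spec i (S n)); [lia|reflexivity]. }
  2: { unfold e2. now rewrite Nat.eqb_refl. }
  set (A := vsum (fun i => vscal (e i) (piece f j i)) (S n)) in *.
  assert (HA : vnorm A <= 1 + th).
  { replace A with (vscal (/ 2) (vadd (vadd A (vscal 1 (v (S n)))) (vadd A (vscal (-1) (v (S n)))))) by vlin.
    rewrite nrm_scal_pos by lra. assert (H3 := nrm_add (vadd A (vscal 1 (v (S n)))) (vadd A (vscal (-1) (v (S n))))). lra. }
  assert (HAz : rsum (fun i => Rabs (ap (piece f j i) z)) (S n) = ap A z).
  { unfold A. rewrite ap_vsum. apply rsum_ext. intros i _. rewrite ap_vscal. unfold e.
    destruct Rle_dec; [rewrite Rabs_pos_eq|rewrite Rabs_left]; lra. }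
  rewrite HAz. eapply Rle_trans; [apply ap_le_l|]. apply Rmult_le_compat_r; [apply nrm_ge0|exact HA].
Qed.

Lemma pieces_value x : rg (F (S (j n))) x -> rsum (fun i => ap (piece f j i) x) (S n) = ap f x.
Proof. intros Hx. rewrite <- ap_vsum, piece_sum, ap_adj. apply gap_vanish; [lia|exact Hx]. Qed.
End Pieces.

(** All [i]-th pieces lie here, whatever the functional and its cuts, since the cut [j i] is before
    [t (S i)] and the previous one is not before [t (pred i)]. For [i = 0] the vanishing condition
    is void, because [F 0] is zero. *)
Definition pieces_space (i : nat) (g : Dual X) : Prop :=
  adj (P (t (S i))) g = g /\ vanish (F (t (pred i))) g /\ vnorm g <= 2.

Lemma nets_of_pieces : exists Phi : nat -> list (Dual X), forall i,
  (forall h, In h (Phi i) -> pieces_space i h) /\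
  forall g, pieces_space i g -> exists h, In h (Phi i) /\ vnorm (vsub g h) <= th * (/ 2) ^ (S i).
Proof.
  apply (func_choice (fun i L => (forall h, In h L -> pieces_space i h) /\
    forall g, pieces_space i g -> exists h, In h L /\ vnorm (vsub g h) <= th * (/ 2) ^ (S i))).
  intros i. destruct (adj_frame (P (t (S i)))) as [L HL].
  apply (finite_net L 2 (pieces_space i)); [lra| |].
  - intros g (H1 & _ & H2). auto.
  - apply Rmult_lt_0_compat; [lra|apply half_pow_pos].
Qed.

(** The system lists the nets through Cantor's pairing: the number of [(i, l)] carries the [l]-th
    element of the [i]-th net, or zero past its end. On [rg (F m)] only the nets with index at most
    [m] survive. A sum of pieces is replaced by net elements at a total cost [th * vnorm z]. *)
Lemma unconditional_system_of_chain : exists f : nat -> Dual X,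
  (forall m x, rg (F m) x -> exists N, forall k, (N <= k)%nat -> ap (f k) x = 0) /\
  (forall m x, rg (F m) x -> exists n (kap : nat -> nat), (forall i, (i < n)%nat -> (i <= kap i)%nat) /\
     (forall z, rsum (fun i => Rabs (ap (f (kap i)) z)) n <= (1 + 2 * th) * vnorm z) /\
     (1 - 2 * th) * vnorm x <= rsum (fun i => ap (f (kap i)) x) n).
Proof.
  destruct nets_of_pieces as [Phi HPhi].
  exists (fun k => nth (snd (of_nat k)) (Phi (fst (of_nat k))) vzero). split.
  - intros m x Hx.
    assert (Hb : forall a, exists N, forall i l, (i <= a)%nat -> (l < length (Phi i))%nat -> (to_nat (i, l) < N)%nat).
    { assert (Hl : forall i b, exists N, forall l, (l < b)%nat -> (to_nat (i, l) < N)%nat).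
      { intros i. induction b as [|b [N IH]]; [exists O; intros; lia|]. exists (max N (S (to_nat (i, b)))).
        intros l Hl. destruct (Nat.eq_dec l b) as [->|]; [lia|]. specialize (IH l ltac:(lia)). lia. }
      induction a as [|a [N IH]].
      - destruct (Hl O (length (Phi O))) as [N HN]. exists N. intros i l Hi. replace i with O by lia. apply HN.
      - destruct (Hl (S a) (length (Phi (S a)))) as [N' HN']. exists (max N N'). intros i l Hi Hli.
        destruct (Nat.eq_dec i (S a)) as [->|]; [specialize (HN' l Hli); lia|].
        specialize (IH i l ltac:(lia) Hli). lia. }
    destruct (Hb m) as [N HN]. exists N. intros k Hk.
    destruct (le_lt_dec (length (Phi (fst (of_nat k)))) (snd (of_nat k))) as [Hle|Hlt].
    + rewrite nth_overflow by exact Hle. apply ap_vzero.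
    + destruct (le_lt_dec (fst (of_nat k)) m) as [Hkm|Hkm].
      * specialize (HN _ _ Hkm Hlt). rewrite <- surjective_pairing, cancel_to_of in HN. lia.
      * destruct (proj1 (HPhi (fst (of_nat k))) _ (nth_In _ vzero Hlt)) as (_ & Hv & _). apply Hv.
        apply (F_mono m); [|exact Hx].
        assert (Hi := incr_ge t Ht (pred (fst (of_nat k)))). lia.
  - intros m x Hx. destruct (Req_dec (vnorm x) 0) as [E|E].
    + exists O, (fun i => i). split; [intros; lia|]. simpl. split; [|rewrite E; lra].
      intros z. assert (H := nrm_ge0 z). nra.
    + assert (Hxn := nrm_ge0 x). destruct (nrm_normalize x E) as [Hxi Hx1].
      (* With [S m] gaps, the last cut satisfies [j m >= t m >= m], so the pieces already sum to [f]
         at [x]. *)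
      destruct (gaps_functional (vscal (/ vnorm x) x) (S m) Hx1) as (j & f & Hj & Hf1 & Hf0 & Hfx).
      assert (Hb := pieces_bound f j m Hj Hf1 Hf0).
      assert (Hps : forall i, (i < S m)%nat -> pieces_space i (piece f j i)).
      { intros i Hi. split; [|split].
        - apply adj_kr; [apply GP|]. intros w Hw. apply (piece_kr f j m Hj i w Hi).
          apply (P_mono _ (t (S i))); [|exact Hw]. specialize (Hj i Hi). lia.
        - destruct i as [|i].
          + cbn [pred]. rewrite Ht0. intros y Hy. rewrite (HF0 y Hy). apply ap_0.
          + cbn [pred]. intros y Hy. apply (piece_vanish f j m Hj Hf0 i Hi).
            apply (F_mono (t i)); [|exact Hy]. specialize (Hj i ltac:(lia)). lia.
        - apply dnorm_le; [lra|]. intros z. eapply Rle_trans; [apply Rle_abs|].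
          assert (H1 := rsum_term (fun i => Rabs (ap (piece f j i) z)) (S m) i (fun _ => Rabs_pos _) Hi). cbv beta in H1.
          assert (H2 := Hb z). assert (H3 := nrm_ge0 z). nra. }
      assert (Hh : forall i, exists l, (i < S m)%nat -> (l < length (Phi i))%nat /\
        vnorm (vsub (piece f j i) (nth l (Phi i) vzero)) <= th * (/ 2) ^ (S i)).
      { intros i. destruct (le_lt_dec (S m) i) as [Hi|Hi]; [exists O; lia|].
        destruct (proj2 (HPhi i) _ (Hps i Hi)) as (h & Hh1 & Hh2).
        destruct (In_nth _ _ vzero Hh1) as (l & Hl1 & Hl2). exists l. intros _. split; [exact Hl1|]. now rewrite Hl2. }
      destruct (func_choice _ Hh) as [l Hl].
      exists (S m), (fun i => to_nat (i, l i)).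
      split; [intros i _; assert (H := to_nat_non_decreasing i (l i)); lia|].
      set (h := fun i => nth (l i) (Phi i) vzero).
      assert (Hnear : forall z i, (i < S m)%nat -> Rabs (ap (piece f j i) z - ap (h i) z) <= th * (/ 2) ^ (S i) * vnorm z).
      { intros z i Hi. rewrite <- ap_vsub. apply ap_le_bd; [apply Hl, Hi|lra]. }
      assert (Hsum : forall z : X, rsum (fun i => th * (/ 2) ^ (S i) * vnorm z) (S m) <= th * vnorm z).
      { intros z. rewrite (rsum_ext _ (fun i => (th * vnorm z) * (/ 2) ^ (S i))) by (intros; ring).
        rewrite rsum_scal. assert (H1 := rsum_geometric (S m)). assert (H2 := nrm_ge0 z).
        assert (0 <= th * vnorm z) by nra. nra. }
      split.
      * intros z. rewrite (rsum_ext _ (fun i => Rabs (ap (h i) z))) by (intros; now rewrite cancel_of_to).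
        apply Rle_trans with (rsum (fun i => Rabs (ap (piece f j i) z) + th * (/ 2) ^ (S i) * vnorm z) (S m)).
        -- apply rsum_le. intros i Hi. specialize (Hnear z i Hi).
           assert (H1 := Rabs_triang_inv (ap (h i) z) (ap (piece f j i) z)). rewrite Rabs_minus_sym in H1. lra.
        -- rewrite rsum_add. specialize (Hb z). specialize (Hsum z). lra.
      * rewrite (rsum_ext _ (fun i => ap (h i) x)) by (intros; now rewrite cancel_of_to).
        assert (Hv := pieces_value f j m Hf0 x).
        assert (Hxj : rg (F (S (j m))) x).
        { apply (F_mono m); [|exact Hx]. specialize (Hj m ltac:(lia)).
          assert (m <= t m)%nat by now apply incr_ge. lia. }
        specialize (Hv Hxj).
        assert (H1 : rsum (fun i => ap (piece f j i) x) (S m) <= rsum (fun i => ap (h i) x + th * (/ 2) ^ (S i) * vnorm x) (S m)).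
        { apply rsum_le. intros i Hi. specialize (Hnear x i Hi). apply Rabs_le_iff in Hnear. lra. }
        rewrite rsum_add in H1. specialize (Hsum x).
        rewrite ap_scal in Hfx. apply Rmult_le_compat_l with (r := vnorm x) in Hfx; [|lra].
        rewrite <- Rmult_assoc, Rinv_r in Hfx by exact E. lra.
Qed.
End System.

Lemma unconditional_system (X : NSpace) {HX : is_normed X} th : separable X -> prop_au X -> WABS X -> 0 < th <= 1 ->
  exists (f : nat -> Dual X) (U : X -> Prop), (forall x eps, 0 < eps -> exists y, U y /\ vnorm (vsub x y) < eps) /\
  (forall x, U x -> exists N, forall k, (N <= k)%nat -> ap (f k) x = 0) /\
  (forall x, U x -> exists n (kap : nat -> nat), (forall i, (i < n)%nat -> (i <= kap i)%nat) /\
     (forall z, rsum (fun i => Rabs (ap (f (kap i)) z)) n <= (1 + 2 * th) * vnorm z) /\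
     (1 - 2 * th) * vnorm x <= rsum (fun i => ap (f (kap i)) x) n).
Proof.
  intros Hsep Hau HW Hth. assert (Haus := au_wabs_au_star X HX Hsep Hau HW).
  destruct Hsep as [d Hd].
  destruct (chain X d th Hau Haus) as (F & P & H1 & H2 & H3 & H4 & H5 & H6 & H7 & H8); [lra|].
  assert (HF := F_mono F H3). assert (HP := P_mono P H6).
  assert (Hau' : forall j x w, rg (F j) x -> kr (P j) w -> vnorm (vsub x w) <= (1 + (/ 2) ^ (j + 2)) * vnorm (vadd x w)).
  { intros j x w Hx Hw. eapply Rle_trans; [apply (H7 j); assumption|]. apply Rmult_le_compat_r; [apply nrm_ge0|].
    assert (H := half_pow_pos (j + 2)). nra. }
  assert (Hb : forall ij : nat * nat, exists N, (snd ij < N)%nat /\ forall w : nat -> X,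
     (forall j, (snd ij <= j < N)%nat -> kr (P j) (w j) /\ rg (F (S j)) (w j) /\ vnorm (w j) <= 3) ->
     exists y, blk w (snd ij) N y /\ vnorm y < th * (/ 2) ^ (S (fst ij))).
  { intros [i j0]. apply (small_conv F P HF HP Hau' j0 3 _ HW).
    apply Rmult_lt_0_compat; [lra|apply half_pow_pos]. }
  destruct (func_choice _ Hb) as [N HN].
  set (t := fix t i := match i with O => O | S i => N (i, t i) end).
  destruct (unconditional_system_of_chain F P th t Hth H1 H2 H3 H5 H6 H7 H8 eq_refl) as (f & K1 & K2).
  - intros i. apply (HN (i, t i)).
  - intros i w Hw. apply (HN (i, t i)). exact Hw.
  - exists f, (fun x => exists m, rg (F m) x). split; [|split].
    + intros x eps Heps. destruct (Hd x eps Heps) as [n Hn]. exists (d n). split; [|exact Hn]. exists (S n). apply H4.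
    + intros x [m Hm]. now apply (K1 m).
    + intros x [m Hm]. now apply (K2 m).
Qed.

(** * The sequence space of an unconditional system *)

Lemma rsum_drop (h : nat -> R) N n : (forall k, 0 <= h k) ->
  rsum (fun k => if Nat.ltb k N then 0 else h k) n <= rsum (fun k => h (N + k)%nat) n.
Proof.
  intros Hh. destruct (le_lt_dec n N) as [Hn|Hn].
  - rewrite rsum_0; [apply rsum_ge0; auto|]. intros k Hk. destruct (Nat.ltb_spec k N); [reflexivity|lia].
  - replace n with (N + (n - N))%nat at 1 by lia. rewrite rsum_split, (rsum_0 _ N).
    + rewrite Rplus_0_l. eapply Rle_trans; [|apply (rsum_mono _ (n - N) n); [intros; apply Hh|lia]].
      apply rsum_le. intros k _. destruct (Nat.ltb_spec (N + k) N); [lia|lra].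
    + intros k Hk. destruct (Nat.ltb_spec k N); [reflexivity|lia].
Qed.

Lemma Un_cv_const c : Un_cv (fun _ => c) c.
Proof. intros eps Heps. exists O. intros m _. unfold R_dist. rewrite Rminus_diag, Rabs_R0. exact Heps. Qed.

Lemma rsum_cv (g : nat -> nat -> R) (l : nat -> R) n : (forall k, Un_cv (fun m => g m k) (l k)) ->
  Un_cv (fun m => rsum (g m) n) (rsum l n).
Proof.
  intros H. induction n as [|n IH]; simpl.
  - apply Un_cv_const.
  - apply CV_plus; [exact IH|apply H].
Qed.

Lemma Un_cv_le (u : nat -> R) l B N : Un_cv u l -> (forall n, (N <= n)%nat -> u n <= B) -> l <= B.
Proof.
  intros Hu HB. apply le_epsilon. intros eps Heps. destruct (Hu eps Heps) as [M HM].
  specialize (HM (max N M) ltac:(lia)). specialize (HB (max N M) ltac:(lia)).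
  unfold R_dist in HM. apply Rabs_def2 in HM. lra.
Qed.

Section Koethe.
Context {X : NSpace} {HX : is_normed X}.
Variable f : nat -> Dual X.

Definition tw (k : nat) : R := (/ 2) ^ (S k).

Lemma tw_pos k : 0 < tw k <= 1.
Proof. split; [apply half_pow_pos|]. assert (H := half_pow_le 0 (S k) ltac:(lia)). exact H. Qed.

(* The unit ball of the dual norm: the multipliers [c] with [sum (+-) c k * f k] of norm at most 1 for
   all signs. The weights [tw] bound the coordinates at which [f k = 0]. *)
Definition Kset (c : nat -> R) : Prop :=
  (forall n x, rsum (fun k => Rabs (c k) * Rabs (ap (f k) x)) n <= vnorm x) /\
  forall n, rsum (fun k => tw k * Rabs (c k)) n <= 1.

Definition pairing (a c : nat -> R) (n : nat) : R := rsum (fun k => Rabs (a k) * Rabs (c k)) n.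
(** An upper bound for the norm that is meaningful for every sequence, before the supremum is known
    to exist. *)
Definition NB (a : nat -> R) (B : R) : Prop := forall c n, Kset c -> pairing a c n <= B.
Definition seq_tail (a : nat -> R) (N : nat) : nat -> R := fun k => if Nat.ltb k N then 0 else a k.
Definition seq_head (a : nat -> R) (N : nat) : nat -> R := fun k => if Nat.ltb k N then a k else 0.
(** The closure of the finite sequences, rather than all sequences of finite norm, which is what
    makes the unit vectors a basis. *)
Definition inY (a : nat -> R) : Prop := forall eta, 0 < eta -> exists N, NB (seq_tail a N) eta.

Lemma pairing_le a b c n : (forall k, Rabs (a k) <= Rabs (b k)) -> pairing a c n <= pairing b c n.
Proof. intros H. apply rsum_le. intros k _. apply Rmult_le_compat_r; [apply Rabs_pos|apply H]. Qed.
Lemma NB_le a b B : (forall k, Rabs (a k) <= Rabs (b k)) -> NB b B -> NB a B.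
Proof. intros H Hb c n Hc. eapply Rle_trans; [now apply pairing_le|]. now apply Hb. Qed.
Lemma NB_mono a B B' : B <= B' -> NB a B -> NB a B'.
Proof. intros H Ha c n Hc. eapply Rle_trans; [now apply Ha|exact H]. Qed.
Lemma NB_add a b A B : NB a A -> NB b B -> NB (fun k => a k + b k) (A + B).
Proof.
  intros Ha Hb c n Hc. apply Rle_trans with (pairing a c n + pairing b c n).
  - unfold pairing. rewrite <- rsum_add. apply rsum_le. intros k _. rewrite <- Rmult_plus_distr_r.
    apply Rmult_le_compat_r; [apply Rabs_pos|apply Rabs_triang].
  - specialize (Ha c n Hc). specialize (Hb c n Hc). lra.
Qed.
Lemma NB_scal t a A : NB a A -> NB (fun k => t * a k) (Rabs t * A).
Proof.
  intros Ha c n Hc. unfold pairing. rewrite (rsum_ext _ (fun k => Rabs t * (Rabs (a k) * Rabs (c k)))).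
  - rewrite rsum_scal. apply Rmult_le_compat_l; [apply Rabs_pos|now apply Ha].
  - intros k _. rewrite Rabs_mult. ring.
Qed.
Lemma Kset_0 : Kset (fun _ => 0).
Proof.
  split; intros; rewrite rsum_0; try apply nrm_ge0; try lra; intros; rewrite Rabs_R0; ring.
Qed.
Lemma NB_ge0 a B : NB a B -> 0 <= B.
Proof. intros H. exact (H _ O Kset_0). Qed.
Lemma Kset_coord c k : Kset c -> Rabs (c k) <= / tw k.
Proof.
  intros [_ H]. specialize (H (S k)). assert (Ht := tw_pos k).
  assert (H1 := rsum_term (fun k => tw k * Rabs (c k)) (S k) k).
  cbv beta in H1. assert (H2 : tw k * Rabs (c k) <= 1).
  { eapply Rle_trans; [apply H1; [|lia]|exact H]. intros i. apply Rmult_le_pos; [left; apply tw_pos|apply Rabs_pos]. }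
  apply Rmult_le_reg_l with (tw k); [lra|]. rewrite Rinv_r; lra.
Qed.
Lemma Kset_delta k : exists s, 0 < s /\ Kset (fun j => if Nat.eqb k j then s else 0).
Proof.
  assert (Hn := dnorm_ge0 (f k)). set (s := / (1 + vnorm (f k))).
  assert (Hs : 0 < s) by (apply Rinv_0_lt_compat; lra).
  assert (Hsn : s * (1 + vnorm (f k)) = 1) by (apply Rinv_l; lra).
  assert (He : forall (g : nat -> R) n, rsum (fun j => Rabs (if Nat.eqb k j then s else 0) * g j) n = if Nat.ltb k n then s * g k else 0).
  { intros g n. rewrite (rsum_ext _ (fun j => (if Nat.eqb k j then 1 else 0) * (s * g j))).
    - now rewrite (rsum_single k (fun j => s * g j)).
    - intros j _. destruct (Nat.eqb k j); [rewrite Rabs_pos_eq by lra|rewrite Rabs_R0]; ring. }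
  exists s. split; [exact Hs|]. split.
  - intros n x. rewrite (He (fun j => Rabs (ap (f j) x))). assert (Hx := nrm_ge0 x).
    destruct (Nat.ltb k n); [|exact Hx]. assert (H := ap_le (f k) x).
    apply Rmult_le_compat_l with (r := s) in H; [|lra]. nra.
  - intros n. rewrite (rsum_ext _ (fun j => Rabs (if Nat.eqb k j then s else 0) * tw j)) by (intros; ring).
    rewrite He. assert (Ht := tw_pos k). destruct (Nat.ltb k n); [|lra]. nra.
Qed.
Lemma NB_coord k : exists s, 0 < s /\ forall a B, NB a B -> s * Rabs (a k) <= B.
Proof.
  destruct (Kset_delta k) as (s & Hs & HK). exists s. split; [exact Hs|]. intros a B Ha.
  specialize (Ha _ (S k) HK). unfold pairing in Ha.
  rewrite (rsum_ext _ (fun j => (if Nat.eqb k j then 1 else 0) * (s * Rabs (a j)))) in Ha.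
  - rewrite (rsum_single k (fun j => s * Rabs (a j))) in Ha. destruct (Nat.ltb_spec k (S k)); [exact Ha|lia].
  - intros j _. destruct (Nat.eqb k j); [rewrite (Rabs_pos_eq s) by lra|rewrite Rabs_R0]; ring.
Qed.

Lemma NB_head a N : exists B, NB (seq_head a N) B.
Proof.
  exists (rsum (fun k => Rabs (a k) * / tw k) N). intros c n Hc.
  assert (Hp : forall k, 0 <= Rabs (a k) * / tw k).
  { intros k. apply Rmult_le_pos; [apply Rabs_pos|]. left. apply Rinv_0_lt_compat. apply tw_pos. }
  apply Rle_trans with (rsum (fun k => if Nat.ltb k N then Rabs (a k) * / tw k else 0) (N + n)).
  - unfold pairing. eapply Rle_trans; [|apply (rsum_mono _ n); [|lia]].
    + apply rsum_le. intros k _. unfold seq_head. destruct (Nat.ltb k N).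
      * apply Rmult_le_compat_l; [apply Rabs_pos|now apply Kset_coord].
      * rewrite Rabs_R0. lra.
    + intros k. destruct (Nat.ltb k N); [apply Hp|lra].
  - rewrite rsum_split, (rsum_0 _ n).
    + rewrite Rplus_0_r. apply Req_le. apply rsum_ext. intros k Hk. destruct (Nat.ltb_spec k N); [reflexivity|lia].
    + intros k _. destruct (Nat.ltb_spec (N + k) N); [lia|reflexivity].
Qed.

Lemma head_tail a N k : a k = seq_head a N k + seq_tail a N k.
Proof. unfold seq_head, seq_tail. destruct (Nat.ltb k N); ring. Qed.

Lemma NB_ext a b B : (forall k, a k = b k) -> NB a B -> NB b B.
Proof. intros H. apply NB_le. intros k. rewrite H. lra. Qed.

Lemma inY_NB a : inY a -> exists B, NB a B.
Proof.
  intros H. destruct (H 1 Rlt_0_1) as [N HN]. destruct (NB_head a N) as [B HB].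
  exists (B + 1). eapply NB_ext; [|apply (NB_add _ _ _ _ HB HN)]. intros k. symmetry. apply head_tail.
Qed.

(** The norm is taken by [epsilon], hence arbitrary if there is no least upper bound; on [inY] there
    is one, by [kn_lub]. *)
Definition kn (a : nat -> R) : R :=
  epsilon (inhabits 0) (is_lub (fun t => exists c n, Kset c /\ t = pairing a c n)).

Lemma kn_lub a : inY a -> is_lub (fun t => exists c n, Kset c /\ t = pairing a c n) (kn a).
Proof.
  intros Ha. destruct (inY_NB a Ha) as [B HB]. unfold kn. apply epsilon_spec.
  destruct (completeness (fun t => exists c n, Kset c /\ t = pairing a c n)) as [l Hl]; [| |now exists l].
  - exists B. intros t (c & n & Hc & ->). now apply HB.
  - exists (pairing a (fun _ => 0) O), (fun _ => 0), O. split; [apply Kset_0|reflexivity].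
Qed.
Lemma kn_NB a : inY a -> NB a (kn a).
Proof. intros Ha c n Hc. apply (kn_lub a Ha). now exists c, n. Qed.
Lemma kn_le a B : inY a -> NB a B -> kn a <= B.
Proof. intros Ha HB. apply (kn_lub a Ha). intros t (c & n & Hc & ->). now apply HB. Qed.

Lemma tail_anti a N N' B : (N <= N')%nat -> NB (seq_tail a N) B -> NB (seq_tail a N') B.
Proof.
  intros HN. apply NB_le. intros k. unfold seq_tail.
  destruct (Nat.ltb_spec k N'), (Nat.ltb_spec k N); try lia; try rewrite Rabs_R0; try apply Rabs_pos; lra.
Qed.

Lemma inY_0 : inY (fun _ => 0).
Proof.
  intros eta Heta. exists O. apply (NB_le _ (fun _ => 0)).
  - intros k. unfold seq_tail. destruct (Nat.ltb k 0); lra.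
  - intros c n _. unfold pairing. rewrite rsum_0; [lra|]. intros k _. rewrite Rabs_R0. ring.
Qed.
Lemma inY_add a b : inY a -> inY b -> inY (fun k => a k + b k).
Proof.
  intros Ha Hb eta Heta. destruct (Ha (eta / 2)) as [N HN]; [lra|]. destruct (Hb (eta / 2)) as [M HM]; [lra|].
  exists (max N M). apply (NB_ext (fun k => seq_tail a (max N M) k + seq_tail b (max N M) k)).
  - intros k. unfold seq_tail. destruct (Nat.ltb k (max N M)); ring.
  - replace eta with (eta / 2 + eta / 2) by lra.
    apply NB_add; [apply (tail_anti a N)|apply (tail_anti b M)]; auto; lia.
Qed.
Lemma inY_scal t a : inY a -> inY (fun k => t * a k).
Proof.
  intros Ha eta Heta. assert (Ht := Rabs_pos t).
  destruct (small_multiple _ _ Ht Heta) as (e & He & Hte). destruct (Ha e He) as [N HN]. exists N.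
  apply (NB_ext (fun k => t * seq_tail a N k)).
  - intros k. unfold seq_tail. destruct (Nat.ltb k N); ring.
  - eapply NB_mono; [|apply (NB_scal t _ _ HN)]. lra.
Qed.
Lemma inY_opp a : inY a -> inY (fun k => - a k).
Proof.
  intros Ha. replace (fun k => - a k) with (fun k => -1 * a k); [now apply inY_scal|].
  apply functional_extensionality. intros k. ring.
Qed.
Lemma inY_finite a N : (forall k, (N <= k)%nat -> a k = 0) -> inY a.
Proof.
  intros Ha eta Heta. exists N. apply (NB_le _ (fun _ => 0)).
  - intros k. unfold seq_tail. destruct (Nat.ltb_spec k N); [lra|]. rewrite Ha; [lra|auto].
  - intros c n _. unfold pairing. rewrite rsum_0; [lra|]. intros k _. rewrite Rabs_R0. ring.
Qed.

Definition KY : NSpace := {|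
  car := { a : nat -> R | inY a };
  vzero := exist _ (fun _ => 0) inY_0;
  vadd := fun a b => exist _ (fun k => proj1_sig a k + proj1_sig b k) (inY_add _ _ (proj2_sig a) (proj2_sig b));
  vopp := fun a => exist _ (fun k => - proj1_sig a k) (inY_opp _ (proj2_sig a));
  vscal := fun t a => exist _ (fun k => t * proj1_sig a k) (inY_scal t _ (proj2_sig a));
  vnorm := fun a => kn (proj1_sig a) |}.

Definition co (a : KY) (k : nat) : R := proj1_sig a k.

Lemma co_ext (a b : KY) : (forall k, co a k = co b k) -> a = b.
Proof.
  destruct a as [a Ha], b as [b Hb]. unfold co; simpl; intros H.
  assert (a = b) by now apply functional_extensionality. subst b. f_equal. apply proof_irrelevance.
Qed.
Lemma co_inY (a : KY) : inY (co a).
Proof. apply (proj2_sig a). Qed.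
Lemma ynorm_NB (a : KY) : NB (co a) (vnorm a).
Proof. apply kn_NB, co_inY. Qed.
Lemma ynorm_le (a : KY) B : NB (co a) B -> vnorm a <= B.
Proof. apply kn_le, co_inY. Qed.

Global Instance KY_normed : is_normed KY.
Proof.
  assert (Hs : forall (t : R) (a : KY), vnorm (vscal t a) <= Rabs t * vnorm a).
  { intros t a. apply ynorm_le. apply NB_scal. apply ynorm_NB. }
  assert (H0 : forall a : KY, 0 <= vnorm a) by (intros a; exact (NB_ge0 _ _ (ynorm_NB a))).
  unfold is_normed. repeat match goal with |- _ /\ _ => split end.
  1-8: intros; apply co_ext; intros k; unfold co; simpl; ring.
  - exact H0.
  - intros a Ha. apply co_ext. intros k. destruct (NB_coord k) as (s & Hs0 & Hk).
    assert (H := Hk _ _ (ynorm_NB a)). rewrite Ha in H. assert (Hp := Rabs_pos (co a k)).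
    change (co a k = 0). destruct (Req_dec (co a k) 0) as [|Hne]; [assumption|].
    apply Rabs_pos_lt in Hne. nra.
  - apply norm_homogeneous; [exact H0| |exact Hs].
    intros t a Ht. apply co_ext. intros k. unfold co; simpl. field. exact Ht.
  - intros a b. apply ynorm_le. apply NB_add; apply ynorm_NB.
Qed.

Lemma co_sub (a b : KY) k : co (vsub a b) k = co a k - co b k.
Proof. reflexivity. Qed.
Lemma co_vsum (u : nat -> KY) n k : co (vsum u n) k = rsum (fun i => co (u i) k) n.
Proof. induction n as [|n IH]; [reflexivity|]. cbn [vsum rsum]. rewrite <- IH. reflexivity. Qed.

(** The limit is taken coordinatewise; the Cauchy estimate passes to it in each finite pairing, and
    tails of the limit are small because those of some [u N] are. *)
Lemma KY_Banach : Banach KY.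
Proof.
  split; [exact KY_normed|]. intros u Hu.
  assert (Hcv : forall k, exists l, Un_cv (fun n => co (u n) k) l).
  { intros k. destruct (NB_coord k) as (s & Hs & Hk).
    assert (Hc : Cauchy_crit (fun n => co (u n) k)).
    { intros eps Heps. destruct (Hu (s * eps)) as [N HN]; [nra|]. exists N. intros n m Hn Hm.
      specialize (HN n m Hn Hm). assert (H := Hk _ _ (ynorm_NB (vsub (u n) (u m)))).
      rewrite co_sub in H. unfold R_dist. apply Rmult_lt_reg_l with s; [exact Hs|]. lra. }
    destruct (R_complete _ Hc) as [l Hl]. now exists l. }
  destruct (func_choice _ Hcv) as [a Ha].
  assert (Hlim : forall eta, 0 < eta -> exists N, forall n, (N <= n)%nat -> NB (fun k => co (u n) k - a k) eta).
  { intros eta Heta. destruct (Hu eta Heta) as [N HN]. exists N. intros n Hn c p Hc.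
    apply (Un_cv_le (fun m => rsum (fun k => Rabs (co (u n) k - co (u m) k) * Rabs (c k)) p) _ eta N).
    - apply rsum_cv. intros k. apply CV_mult.
      + apply cv_cvabs. apply CV_minus; [apply Un_cv_const|apply Ha].
      + apply Un_cv_const.
    - intros m Hm. eapply Rle_trans; [apply (ynorm_NB (vsub (u n) (u m)) c p Hc)|]. left. now apply HN. }
  assert (HaY : inY a).
  { intros eta Heta. destruct (Hlim (eta / 2)) as [N HN]; [lra|]. specialize (HN N (le_n N)).
    destruct (co_inY (u N) (eta / 2)) as [M HM]; [lra|]. exists M.
    apply (NB_ext (fun k => seq_tail (co (u N)) M k + -1 * seq_tail (fun k => co (u N) k - a k) M k)).
    - intros k. unfold seq_tail. destruct (Nat.ltb k M); ring.
    - replace eta with (eta / 2 + Rabs (-1) * (eta / 2)) by (rewrite Rabs_m1; lra).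
      apply NB_add; [exact HM|]. apply NB_scal. apply (NB_le _ (fun k => co (u N) k - a k)); [|exact HN].
      intros k. unfold seq_tail. destruct (Nat.ltb k M); [rewrite Rabs_R0; apply Rabs_pos|lra]. }
  exists (exist _ a HaY). intros eps Heps. destruct (Hlim (eps / 2)) as [N HN]; [lra|]. exists N. intros n Hn.
  apply Rle_lt_trans with (eps / 2); [|lra]. apply ynorm_le. apply (NB_ext (fun k => co (u n) k - a k)); [reflexivity|auto].
Qed.

Lemma head_out a n k : (n <= k)%nat -> seq_head a n k = 0.
Proof. intros H. unfold seq_head. destruct (Nat.ltb_spec k n); [lia|reflexivity]. Qed.

Definition fin_seq (a : nat -> R) (n : nat) : KY := exist _ (seq_head a n) (inY_finite (seq_head a n) n (head_out a n)).

Definition unit_vec (j : nat) : KY := fin_seq (fun k => if Nat.eqb j k then 1 else 0) (S j).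

Lemma co_unit_vec j k : co (unit_vec j) k = if Nat.eqb j k then 1 else 0.
Proof.
  unfold co, unit_vec; simpl. unfold seq_head. destruct (Nat.ltb_spec k (S j)); [reflexivity|].
  destruct (Nat.eqb_spec j k); [lia|reflexivity].
Qed.

Lemma vsum_unit_vec a n : vsum (fun j => vscal (a j) (unit_vec j)) n = fin_seq a n.
Proof.
  apply co_ext. intros k. rewrite co_vsum.
  rewrite (rsum_ext _ (fun j => (if Nat.eqb k j then 1 else 0) * a j)).
  - rewrite (rsum_single k a). reflexivity.
  - intros j _. change (co (vscal (a j) (unit_vec j)) k) with (a j * co (unit_vec j) k).
    rewrite co_unit_vec, (Nat.eqb_sym k j). destruct (Nat.eqb j k); ring.
Qed.

Lemma fin_seq_approx (y : KY) eta : 0 < eta -> exists N, forall n, (N <= n)%nat -> vnorm (vsub (fin_seq (co y) n) y) <= eta.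
Proof.
  intros Heta. destruct (co_inY y eta Heta) as [N HN]. exists N. intros n Hn. apply ynorm_le.
  apply (NB_le _ (seq_tail (co y) n)); [|now apply (tail_anti (co y) N)].
  intros k. rewrite co_sub. change (co (fin_seq (co y) n) k) with (seq_head (co y) n k).
  rewrite (head_tail (co y) n k). replace (seq_head (co y) n k - _) with (- seq_tail (co y) n k) by ring.
  rewrite Rabs_Ropp. lra.
Qed.

Lemma fin_seq_series (y : KY) : series_to (fun j => vscal (co y j) (unit_vec j)) y.
Proof.
  intros eps Heps. destruct (fin_seq_approx y (eps / 2)) as [N HN]; [lra|]. exists N. intros n Hn.
  rewrite vsum_unit_vec. specialize (HN n Hn). lra.
Qed.

Lemma co_bounded k : bounded_functional (fun y : KY => co y k).
Proof.
  split; [reflexivity|]. split; [reflexivity|]. destruct (NB_coord k) as (s & Hs & Hk).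
  exists (/ s). intros y. apply Rmult_le_reg_l with s; [exact Hs|]. rewrite <- Rmult_assoc, Rinv_r, Rmult_1_l by lra.
  apply Hk, ynorm_NB.
Qed.

Definition coord (k : nat) : Dual KY := dmk (fun y : KY => co y k) (co_bounded k).

Lemma unit_vec_basis : is_basis KY unit_vec.
Proof.
  intros y. exists (co y). split; [apply fin_seq_series|]. intros a Ha.
  apply functional_extensionality. intros k. symmetry.
  apply cond_eq. intros eps Heps. destruct (NB_coord k) as (s & Hs & Hk).
  destruct (Ha (s * eps)) as [N HN]; [nra|]. specialize (HN (max N (S k)) ltac:(lia)).
  rewrite vsum_unit_vec in HN. assert (H := Hk _ _ (ynorm_NB (vsub (fin_seq a (max N (S k))) y))).
  rewrite co_sub in H. change (co (fin_seq a (max N (S k))) k) with (seq_head a (max N (S k)) k) in H.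
  unfold seq_head in H. destruct (Nat.ltb_spec k (max N (S k))); [|lia].
  apply Rmult_lt_reg_l with s; [exact Hs|]. lra.
Qed.

Lemma unit_vec_unconditional : one_unconditional KY unit_vec.
Proof.
  split; [exact unit_vec_basis|]. intros n a eps Heps. rewrite !vsum_unit_vec. apply ynorm_le.
  apply (NB_le _ (co (fin_seq a n))); [|apply ynorm_NB]. intros k.
  change (Rabs (seq_head (fun j => eps j * a j) n k) <= Rabs (seq_head a n k)). unfold seq_head.
  destruct (Nat.ltb k n); [|lra]. rewrite Rabs_mult.
  destruct (Heps k) as [-> | ->]; rewrite ?Rabs_R1, ?Rabs_m1; lra.
Qed.

Lemma ap_fin_seq (phi : Dual KY) a n : ap phi (fin_seq a n) = rsum (fun k => a k * ap phi (unit_vec k)) n.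
Proof. rewrite <- vsum_unit_vec, ap_sum. apply rsum_ext. intros k _. apply ap_scal. Qed.

Lemma head_abs_le a b n : (forall k, Rabs (a k) <= Rabs (b k)) -> forall k, Rabs (seq_head a n k) <= Rabs (b k).
Proof. intros H k. unfold seq_head. destruct (Nat.ltb k n); [apply H|]. rewrite Rabs_R0. apply Rabs_pos. Qed.

(** The left side is the value of [phi] at the finite sequence of the [Rabs (b k)] with the signs of
    the coefficients of [phi]. *)
Lemma dual_coefs (phi : Dual KY) (b : nat -> R) B n : NB b B ->
  rsum (fun k => Rabs (ap phi (unit_vec k)) * Rabs (b k)) n <= vnorm phi * B.
Proof.
  intros Hb. set (a := fun k => if Rle_dec 0 (ap phi (unit_vec k)) then Rabs (b k) else - Rabs (b k)).
  assert (Ha : forall k, Rabs (a k) <= Rabs (b k)).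
  { intros k. unfold a. destruct Rle_dec; rewrite ?Rabs_Ropp, Rabs_Rabsolu; lra. }
  assert (H : rsum (fun k => Rabs (ap phi (unit_vec k)) * Rabs (b k)) n = ap phi (fin_seq a n)).
  { rewrite ap_fin_seq. apply rsum_ext. intros k _. unfold a.
    destruct Rle_dec; [rewrite (Rabs_pos_eq (ap phi _)) by lra|rewrite (Rabs_left (ap phi _)) by lra]; ring. }
  rewrite H. eapply Rle_trans; [apply ap_le_l|]. apply Rmult_le_compat_l; [apply dnorm_ge0|].
  apply ynorm_le. apply (NB_le _ b); [|exact Hb]. apply head_abs_le. exact Ha.
Qed.

Lemma functional_NB x : NB (fun k => ap (f k) x) (vnorm x).
Proof. intros c n [Hc _]. unfold pairing. rewrite (rsum_ext _ (fun k => Rabs (c k) * Rabs (ap (f k) x))) by (intros; ring). apply Hc. Qed.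

Lemma tw_NB : NB tw 1.
Proof.
  intros c n [_ Hc]. unfold pairing. rewrite (rsum_ext _ (fun k => tw k * Rabs (c k))); [apply Hc|].
  intros k _. rewrite (Rabs_pos_eq (tw k)); [reflexivity|left; apply tw_pos].
Qed.

(** For the coefficients [c] of [phi], [dual_coefs] makes the series of the [c k * f k] weakly
    unconditionally Cauchy, hence convergent by [wabs_wuc]. A tail of [c] divided by [eta] thus
    belongs to [Kset], and the norm of [KY] bounds the pairing with it. *)
Lemma dual_tail_small (phi : Dual KY) : WABS X -> forall eta, 0 < eta -> exists N, forall n (y : KY),
  pairing (co y) (seq_tail (fun k => ap phi (unit_vec k)) N) n <= eta * vnorm y.
Proof.
  intros HW eta Heta. set (c := fun k => ap phi (unit_vec k)).
  destruct (wabs_wuc (fun k => vscal (c k) (f k)) (vnorm phi) HW) with (eta := eta) as [N1 H1].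
  { intros n x. eapply Rle_trans; [|apply (dual_coefs phi _ _ n (functional_NB x))].
    apply Req_le. apply rsum_ext. intros k _. rewrite ap_vscal, Rabs_mult. reflexivity. }
  { exact Heta. }
  destruct (rsum_tail_small (fun k => Rabs (c k) * tw k) (vnorm phi * 1) eta) as [N2 H2].
  { intros k. apply Rmult_le_pos; [apply Rabs_pos|left; apply tw_pos]. }
  { intros n. eapply Rle_trans; [|apply (dual_coefs phi _ _ n tw_NB)]. apply Req_le. apply rsum_ext.
    intros k _. rewrite (Rabs_pos_eq (tw k)); [reflexivity|left; apply tw_pos]. }
  { exact Heta. }
  exists (max N1 N2). set (N := max N1 N2).
  assert (HK : Kset (fun k => / eta * seq_tail c N k)).
  { assert (Hi : 0 < / eta) by now apply Rinv_0_lt_compat. split.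
    - intros n x. rewrite (rsum_ext _ (fun k => / eta * (Rabs (seq_tail c N k) * Rabs (ap (f k) x)))).
      + rewrite rsum_scal. apply Rmult_le_reg_l with eta; [exact Heta|].
        rewrite <- Rmult_assoc, Rinv_r, Rmult_1_l by lra.
        eapply Rle_trans; [|apply (H1 n x)].
        eapply Rle_trans; [|apply (rsum_drop (fun k => Rabs (ap (vscal (c k) (f k)) x))); intros; apply Rabs_pos].
        apply rsum_le. intros k _. unfold seq_tail. destruct (Nat.ltb_spec k N), (Nat.ltb_spec k N1); try lia.
        * rewrite Rabs_R0. lra.
        * rewrite Rabs_R0, Rmult_0_l. apply Rabs_pos.
        * rewrite ap_vscal, Rabs_mult. lra.
      + intros k _. rewrite Rabs_mult, (Rabs_pos_eq (/ eta)) by lra. ring.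
    - intros n. rewrite (rsum_ext _ (fun k => / eta * (Rabs (seq_tail c N k) * tw k))).
      + rewrite rsum_scal. apply Rmult_le_reg_l with eta; [exact Heta|].
        rewrite <- Rmult_assoc, Rinv_r, Rmult_1_l, Rmult_1_r by lra.
        eapply Rle_trans; [|apply (H2 n)].
        eapply Rle_trans; [|apply (rsum_drop (fun k => Rabs (c k) * tw k)); intros; apply Rmult_le_pos; [apply Rabs_pos|left; apply tw_pos]].
        apply rsum_le. intros k _. assert (Ht := tw_pos k). assert (Hp := Rabs_pos (c k)).
        unfold seq_tail. destruct (Nat.ltb_spec k N), (Nat.ltb_spec k N2); try lia; rewrite ?Rabs_R0; nra.
      + intros k _. rewrite Rabs_mult, (Rabs_pos_eq (/ eta)) by lra. ring. }
  intros n y. assert (H := ynorm_NB y _ n HK). unfold pairing in *.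
  rewrite (rsum_ext _ (fun k => / eta * (Rabs (co y k) * Rabs (seq_tail c N k)))) in H.
  - rewrite rsum_scal in H. apply Rmult_le_compat_l with (r := eta) in H; [|lra].
    rewrite <- Rmult_assoc, Rinv_r, Rmult_1_l in H by lra. exact H.
  - intros k _. rewrite Rabs_mult, (Rabs_pos_eq (/ eta)) by (left; now apply Rinv_0_lt_compat). ring.
Qed.

Lemma unit_vec_shrinking : WABS X -> shrinking KY unit_vec.
Proof.
  intros HW. split; [exact unit_vec_basis|]. exists coord. split.
  - intros i j. change (co (unit_vec j) i = if Nat.eqb i j then 1 else 0). rewrite co_unit_vec, Nat.eqb_sym. reflexivity.
  - intros phi. exists (fun k => ap phi (unit_vec k)). split.
    + intros eps Heps. destruct (dual_tail_small phi HW (eps / 2)) as [N HN]; [lra|]. exists N. intros n Hn.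
      apply Rle_lt_trans with (eps / 2); [|lra]. apply dnorm_le; [lra|]. intros y.
      rewrite ap_vsub, ap_vsum. apply le_epsilon. intros e He.
      assert (Hphi := dnorm_ge0 phi).
      destruct (small_multiple _ _ Hphi He) as (e' & He' & Hpe). destruct (fin_seq_approx y e' He') as [M HM].
      set (m := (n + M)%nat). specialize (HM m ltac:(unfold m; lia)).
      assert (E1 : ap phi (fin_seq (co y) m) - ap phi y <= e).
      { rewrite <- ap_sub. eapply Rle_trans; [apply ap_le_l|].
        apply Rle_trans with (vnorm phi * e'); [now apply Rmult_le_compat_l|lra]. }
      rewrite ap_fin_seq in E1. unfold m in E1. rewrite rsum_split in E1.
      assert (E2 : - rsum (fun k => co y (n + k)%nat * ap phi (unit_vec (n + k))) M <=
         pairing (co y) (seq_tail (fun k => ap phi (unit_vec k)) N) (n + M)).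
      { unfold pairing. rewrite rsum_split.
        assert (P1 : 0 <= rsum (fun k => Rabs (co y k) * Rabs (seq_tail (fun k => ap phi (unit_vec k)) N k)) n).
        { apply rsum_ge0. intros k _. apply Rmult_le_pos; apply Rabs_pos. }
        assert (P2 := rsum_abs (fun k => co y (n + k)%nat * ap phi (unit_vec (n + k))) M).
        assert (P3 := Rle_abs (- rsum (fun k => co y (n + k)%nat * ap phi (unit_vec (n + k))) M)). rewrite Rabs_Ropp in P3.
        assert (P4 : rsum (fun k => Rabs (co y (n + k)%nat * ap phi (unit_vec (n + k)))) M <=
           rsum (fun k => Rabs (co y (n + k)%nat) * Rabs (seq_tail (fun k => ap phi (unit_vec k)) N (n + k)%nat)) M).
        { apply rsum_le. intros k _. unfold seq_tail. destruct (Nat.ltb_spec (n + k) N); [lia|]. rewrite Rabs_mult. lra. }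
        lra. }
      specialize (HN (n + M)%nat y).
      rewrite (rsum_ext _ (fun k => co y k * ap phi (unit_vec k))).
      2: { intros k _. rewrite ap_vscal, Rmult_comm. reflexivity. }
      lra.
    + intros a Ha. apply functional_extensionality. intros k. symmetry.
      apply cond_eq. intros eps Heps. assert (Hu := nrm_ge0 (unit_vec k)).
      destruct (small_multiple _ _ Hu Heps) as (eta & Heta & Hue). destruct (Ha eta Heta) as [N HN].
      specialize (HN (max N (S k)) ltac:(lia)).
      set (psi := vsub (vsum (fun j => vscal (a j) (coord j)) (max N (S k))) phi) in *.
      assert (E : ap psi (unit_vec k) = a k - ap phi (unit_vec k)).
      { unfold psi. rewrite ap_vsub, ap_vsum. f_equal.
        rewrite (rsum_ext _ (fun j => (if Nat.eqb k j then 1 else 0) * a j)).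
        - rewrite (rsum_single k a). destruct (Nat.ltb_spec k (max N (S k))); [reflexivity|lia].
        - intros j _. rewrite ap_vscal. change (ap (coord j) (unit_vec k)) with (co (unit_vec k) j).
          rewrite co_unit_vec. ring. }
      rewrite <- E. eapply Rle_lt_trans; [apply ap_le|].
      apply Rle_lt_trans with (eta * vnorm (unit_vec k)); [|lra].
      apply Rmult_le_compat_r; [exact Hu|]. left. exact HN.
Qed.

(** * The embedding of [X] in the sequence space *)

Section Embedding.
Variables (U : X -> Prop) (th : R).
Hypothesis Hth : 0 < th /\ 2 * th < 1.
Hypothesis HU : forall x eps, 0 < eps -> exists y, U y /\ vnorm (vsub x y) < eps.
Hypothesis Hfin : forall x, U x -> exists N, forall k, (N <= k)%nat -> ap (f k) x = 0.
Hypothesis Hnorm : forall x, U x -> exists n (kap : nat -> nat), (forall i, (i < n)%nat -> (i <= kap i)%nat) /\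
     (forall z, rsum (fun i => Rabs (ap (f (kap i)) z)) n <= (1 + 2 * th) * vnorm z) /\
     (1 - 2 * th) * vnorm x <= rsum (fun i => ap (f (kap i)) x) n.

Lemma emb_inY x : inY (fun k => ap (f k) x).
Proof.
  intros eta Heta. destruct (HU x eta Heta) as (y & Hy & Hxy). destruct (Hfin y Hy) as [N HN].
  exists N. apply (NB_le _ (fun k => ap (f k) (vsub x y))).
  - intros k. unfold seq_tail. destruct (Nat.ltb_spec k N); [rewrite Rabs_R0; apply Rabs_pos|].
    rewrite ap_sub, (HN k), Rminus_0_r by auto. lra.
  - apply (NB_mono _ (vnorm (vsub x y))); [lra|apply functional_NB].
Qed.

Definition emb (x : X) : KY := exist _ _ (emb_inY x).

Lemma emb_linear : linear_map emb.
Proof.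
  split; intros; apply co_ext; intros k.
  - apply ap_add.
  - apply ap_scal.
Qed.

Lemma emb_le x : vnorm (emb x) <= vnorm x.
Proof. apply ynorm_le. apply functional_NB. Qed.

(** For [x] in the dense set [U], the functionals that almost norm [x] define a multiplier in [Kset]
    whose pairing with the image of [x] is large; density gives the rest. *)
Lemma emb_ge x : (1 - 2 * th) / (1 + 2 * th) * vnorm x <= vnorm (emb x).
Proof.
  set (rho := (1 - 2 * th) / (1 + 2 * th)).
  assert (Hr1 : rho <= 1).
  { unfold rho. apply Rmult_le_reg_r with (1 + 2 * th); [lra|]. unfold Rdiv. rewrite Rmult_assoc, Rinv_l; lra. }
  assert (Hr0 : 0 <= rho).
  { unfold rho. apply Rmult_le_pos; [lra|]. left. apply Rinv_0_lt_compat. lra. }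
  assert (HUx : forall x, U x -> rho * vnorm x <= vnorm (emb x)).
  { clear x. intros x Hx. destruct (Hnorm x Hx) as (n & kap & Hk & Hb & Hv).
    set (s := / (1 + 2 * th)). assert (Hs : 0 < s) by (apply Rinv_0_lt_compat; lra).
    assert (Hs1 : s * (1 + 2 * th) = 1) by (apply Rinv_l; lra).
    (* The multiplier counts how often [kap] takes the value [k], as [Hnorm] does not say that [kap]
       is injective. Dividing by [1 + 2 * th] gives the first condition of [Kset]; [i <= kap i]
       compares the weights [tw] with a geometric sum for the second. *)
    set (c := fun k => s * rsum (fun i => if Nat.eqb (kap i) k then 1 else 0) n).
    assert (Hc0 : forall k, 0 <= c k).
    { intros k. apply Rmult_le_pos; [lra|]. apply rsum_ge0. intros i _. destruct Nat.eqb; lra. }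
    assert (Hc : forall (h : nat -> R) m, rsum (fun k => Rabs (c k) * h k) m =
        s * rsum (fun i => if Nat.ltb (kap i) m then h (kap i) else 0) n).
    { intros h m. rewrite (rsum_ext _ (fun k => s * rsum (fun i => (if Nat.eqb (kap i) k then 1 else 0) * h k) n)).
      - rewrite rsum_scal, rsum_swap. f_equal. apply rsum_ext. intros i _. apply rsum_single.
      - intros k _. rewrite (Rabs_pos_eq _ (Hc0 k)). unfold c. rewrite Rmult_assoc. f_equal.
        rewrite (rsum_ext (fun i => _ * h k) (fun i => h k * (if Nat.eqb (kap i) k then 1 else 0))) by (intros; ring).
        rewrite rsum_scal. ring. }
    assert (HK : Kset c).
    { split.
      - intros m z. rewrite Hc. apply Rle_trans with (s * ((1 + 2 * th) * vnorm z)).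
        + apply Rmult_le_compat_l; [lra|]. eapply Rle_trans; [|apply Hb]. apply rsum_le. intros i _.
          destruct Nat.ltb; [lra|apply Rabs_pos].
        + rewrite <- Rmult_assoc, Hs1. lra.
      - intros m. rewrite (rsum_ext _ (fun k => Rabs (c k) * tw k)) by (intros; ring). rewrite Hc.
        assert (H : rsum (fun i => if Nat.ltb (kap i) m then tw (kap i) else 0) n <= 1).
        { eapply Rle_trans; [|apply (rsum_geometric n)]. apply rsum_le. intros i Hi.
          destruct Nat.ltb; [apply half_pow_le; specialize (Hk i Hi); lia|left; apply half_pow_pos]. }
        nra. }
    assert (Hm : exists m, forall i, (i < n)%nat -> (kap i < m)%nat).
    { clear. induction n as [|n [m IH]]; [exists O; lia|]. exists (max m (S (kap n))). intros i Hi.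
      destruct (Nat.eq_dec i n) as [->|]; [lia|]. specialize (IH i ltac:(lia)). lia. }
    destruct Hm as [m Hm]. assert (H := ynorm_NB (emb x) c m HK). unfold pairing in H.
    rewrite (rsum_ext _ (fun k => Rabs (c k) * Rabs (ap (f k) x))) in H by (intros; apply Rmult_comm).
    rewrite Hc in H. eapply Rle_trans; [|exact H].
    replace (rho * vnorm x) with (s * ((1 - 2 * th) * vnorm x)) by (unfold rho, s; field; lra).
    apply Rmult_le_compat_l; [lra|]. eapply Rle_trans; [exact Hv|]. apply rsum_le. intros i Hi.
    rewrite (proj2 (Nat.ltb_lt _ _) (Hm i Hi)). apply Rle_abs. }
  apply le_epsilon. intros eps Heps. destruct (HU x (eps / 2)) as (y & Hy & Hxy); [lra|].
  specialize (HUx y Hy). assert (H1 := nrm_le_sub x y). assert (H2 := nrm_le_sub (emb y) (emb x)).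
  assert (H3 : vnorm (vsub (emb y) (emb x)) <= vnorm (vsub y x)).
  { replace (vsub (emb y) (emb x)) with (emb (vsub y x)); [apply emb_le|].
    apply co_ext. intros k. apply ap_sub. }
  rewrite (nrm_subC y x) in H3. nra.
Qed.
End Embedding.
End Koethe.

Lemma embedding_of_au_wabs (X : NSpace) : is_normed X -> separable X -> prop_au X -> WABS X ->
  forall delta, 0 < delta -> exists (Y : NSpace) (e : nat -> Y) (Xd : Y -> Prop),
    Banach Y /\ shrinking Y e /\ one_unconditional Y e /\ subspace Xd /\ banach_mazur_lt X Y Xd (1 + delta).
Proof.
  (* The distance is at most [(1 + 2 * th) / (1 - 2 * th)], which is below [1 + delta] when
     [th * (4 + 2 * delta) < delta]; [th] is half of that threshold. *)
  intros HX Hsep Hau HW delta Hdelta. set (th := delta / (8 + 4 * delta)).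
  assert (Hth : th * (8 + 4 * delta) = delta) by (unfold th; field; lra).
  assert (Hth0 : 0 < th) by (apply Rdiv_lt_0_compat; lra).
  assert (Hth1 : 4 * th < 1) by nra.
  destruct (unconditional_system X th Hsep Hau HW) as (f & U & HU & Hfin & Hnorm); [lra|].
  assert (Hth2 : 0 < th /\ 2 * th < 1) by lra.
  set (T := emb f U HU Hfin).
  exists (KY f), (unit_vec f), (fun y => exists x, T x = y).
  destruct (emb_linear f U HU Hfin) as [TA TS]. fold T in TA, TS.
  split; [apply KY_Banach|]. split; [now apply unit_vec_shrinking|]. split; [apply unit_vec_unconditional|]. split.
  - split; [|split].
    + exists vzero. rewrite <- (vscal0 vzero), TS. vlin.
    + intros y y' [x <-] [x' <-]. exists (vadd x x'). apply TA.
    + intros a y [x <-]. exists (vscal a x). apply TS.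
  - set (rho := (1 - 2 * th) / (1 + 2 * th)).
    assert (Hr : 0 < rho) by (apply Rdiv_lt_0_compat; lra).
    exists T, 1, (/ rho). split; [split; [exact TA|exact TS]|]. split; [intros x; now exists x|].
    split; [intros z Hz; exact Hz|]. split; [lra|]. split; [left; now apply Rinv_0_lt_compat|]. split; [|split].
    + intros x. rewrite Rmult_1_l. apply emb_le.
    + intros x. apply Rmult_le_reg_l with rho; [exact Hr|]. rewrite <- Rmult_assoc, Rinv_r, Rmult_1_l by lra.
      apply (emb_ge f U th Hth2 HU Hfin Hnorm x).
    + rewrite Rmult_1_l. apply Rmult_lt_reg_l with rho; [exact Hr|]. rewrite Rinv_r by lra.
      unfold rho. apply Rmult_lt_reg_r with (1 + 2 * th); [lra|].
      replace ((1 - 2 * th) / (1 + 2 * th) * (1 + delta) * (1 + 2 * th)) with ((1 - 2 * th) * (1 + delta)) by (field; lra).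
      nra.
Qed.

(** * Subspaces of spaces with a shrinking unconditional basis *)

Lemma kr_finite_codim {X : NSpace} {HX : is_normed X} (l : frame X) : good l -> finite_codim (kr l).
Proof.
  intros Hl. set (d := (vzero, vzero) : Dual X * X).
  exists (length l), (fun k => snd (nth k l d)). intros x.
  exists (vsub x (pj l x)), (fun k => ap (fst (nth k l d)) x). split; [now apply kr_res|].
  replace (vsum _ _) with (pj l x); [vlin|]. clear Hl. induction l as [|c l IH]; [reflexivity|].
  cbn [pj length]. rewrite IH, <- Nat.add_1_l, vsum_split. cbn [vsum nth Nat.add]. vlin.
Qed.

(** If [tau] bounds the first [m] terms, their alternating sum lies between 0 and [(-1) ^ m * tau].
    The induction applies this with [tau = t m], available by monotonicity. *)
Lemma alternating_monotone (t : nat -> R) n : (forall j, (j < n)%nat -> 0 <= t j <= 1) ->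
  (forall i j, (i < j < n)%nat -> t i <= t j) -> Rabs (rsum (fun j => (-1) ^ (S j) * t j) n) <= 1.
Proof.
  intros Ht Hm. set (g := fun j => (-1) ^ (S j) * t j).
  assert (Hg : forall m, g m = - ((-1) ^ m * t m)) by (intros m; unfold g; cbn [pow]; ring).
  assert (H : forall m tau, (m <= n)%nat -> 0 <= tau -> (forall j, (j < m)%nat -> t j <= tau) ->
     ((-1) ^ m = 1 /\ 0 <= rsum g m <= tau) \/
     ((-1) ^ m = -1 /\ - tau <= rsum g m <= 0)).
  { induction m as [|m IH]; intros tau Hmn Htau Hb; [left; simpl; lra|].
    assert (H1 := Ht m ltac:(lia)).
    assert (H2 := Hb m ltac:(lia)). cbn [rsum pow]. rewrite Hg.
    destruct (IH (t m)) as [[E1 E2]|[E1 E2]]; [lia|lra|intros j Hj; apply Hm; lia|right|left]; rewrite E1; lra. }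
  destruct (H n 1 (le_n n) ltac:(lra)) as [[_ E]|[_ E]]; [intros j Hj; apply Ht; exact Hj| |]; apply Rabs_le; lra.
Qed.

Section UnconditionalBasis.
Context {Y : NSpace} {HY : is_normed Y}.
Variables (e : nat -> Y) (es : nat -> Dual Y).
Hypothesis Hbasis : is_basis Y e.
Hypothesis Hbio : forall i j, ap (es i) (e j) = if Nat.eqb i j then 1 else 0.
Hypothesis Hunc : forall n a s, (forall j, s j = 1 \/ s j = -1) ->
  vnorm (vsum (fun j => vscal (s j * a j) (e j)) n) <= vnorm (vsum (fun j => vscal (a j) (e j)) n).

Definition comb (a : nat -> R) (n : nat) : Y := vsum (fun j => vscal (a j) (e j)) n.
Definition part (n : nat) (y : Y) : Y := comb (fun j => ap (es j) y) n.

Lemma comb_add a b n : comb (fun k => a k + b k) n = vadd (comb a n) (comb b n).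
Proof. unfold comb. rewrite <- vsum_add. apply vsum_ext. intros. vlin. Qed.
Lemma comb_scal t a n : comb (fun k => t * a k) n = vscal t (comb a n).
Proof. unfold comb. rewrite <- vsum_scal. apply vsum_ext. intros. vlin. Qed.
Lemma comb_sub a b n : comb (fun k => a k - b k) n = vsub (comb a n) (comb b n).
Proof. unfold comb. rewrite <- vsum_sub. apply vsum_ext. intros. vlin. Qed.
Lemma comb_ext a b n : (forall k, (k < n)%nat -> a k = b k) -> comb a n = comb b n.
Proof. intros H. apply vsum_ext. intros k Hk. now rewrite H. Qed.
Lemma ap_es_comb a n k : ap (es k) (comb a n) = if Nat.ltb k n then a k else 0.
Proof.
  unfold comb. rewrite ap_sum, (rsum_ext _ (fun j => (if Nat.eqb k j then 1 else 0) * a j)).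
  - apply (rsum_single k a).
  - intros j _. rewrite ap_scal, Hbio. ring.
Qed.
Lemma comb_extend a n m : (n <= m)%nat -> (forall k, (n <= k < m)%nat -> a k = 0) -> comb a m = comb a n.
Proof.
  intros Hnm Ha. unfold comb. replace m with (n + (m - n))%nat by lia. rewrite vsum_split.
  rewrite (vsum_0 (fun k => _ : Y) (m - n)); [vlin|].
  intros k Hk. rewrite Ha by lia. vlin.
Qed.

(** The coefficients are changed one at a time: a multiplier in [[-1, 1]] is an average of 1 and
    [-1], and both signs preserve the bound. *)
Lemma comb_multiplier a mu n : (forall j, (j < n)%nat -> Rabs (mu j) <= 1) -> vnorm (comb (fun j => mu j * a j) n) <= vnorm (comb a n).
Proof.
  intros Hmu.
  assert (H : forall m, (m <= n)%nat -> vnorm (comb (fun j => if Nat.ltb j m then mu j * a j else a j) n) <= vnorm (comb a n)).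
  { induction m as [|m IH]; intros Hm.
    - apply Req_le. f_equal.
    - set (b := fun j => if Nat.ltb j m then mu j * a j else a j) in *.
      set (s := fun j => if Nat.eqb j m then -1 else 1).
      assert (Hs := Hunc n b s). specialize (IH ltac:(lia)).
      assert (Hs' : vnorm (comb (fun j => s j * b j) n) <= vnorm (comb b n)).
      { apply Hs. intros j. unfold s. destruct (Nat.eqb j m); auto. }
      rewrite (comb_ext _ (fun j => (1 + mu m) / 2 * b j + (1 - mu m) / 2 * (s j * b j))).
      + rewrite comb_add, !comb_scal. eapply Rle_trans; [apply nrm_add|].
        specialize (Hmu m ltac:(lia)). apply Rabs_le_iff in Hmu. rewrite !nrm_scal_pos by lra. nra.
      + intros k Hk. unfold s, b. destruct (Nat.ltb_spec k (S m)), (Nat.ltb_spec k m), (Nat.eqb_spec k m);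
          try lia; subst; field. }
  specialize (H n (le_n n)). rewrite (comb_ext (fun j => mu j * a j) (fun j => if Nat.ltb j n then mu j * a j else a j)); [exact H|].
  intros k Hk. destruct (Nat.ltb_spec k n); [reflexivity|lia].
Qed.

Lemma comb_dominated a b n : (forall j, (j < n)%nat -> Rabs (b j) <= Rabs (a j)) -> vnorm (comb b n) <= vnorm (comb a n).
Proof.
  intros H. set (mu := fun j => if Req_dec_T (a j) 0 then 0 else b j / a j).
  rewrite (comb_ext b (fun j => mu j * a j)).
  - apply comb_multiplier. intros j Hj. unfold mu. destruct (Req_dec_T (a j) 0) as [E|E]; [rewrite Rabs_R0; lra|].
    specialize (H j Hj). unfold Rdiv. rewrite Rabs_mult, Rabs_inv. assert (Hp := Rabs_pos_lt _ E).
    apply Rmult_le_reg_r with (Rabs (a j)); [exact Hp|]. rewrite Rmult_assoc, Rinv_l by lra. lra.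
  - intros k Hk. unfold mu. destruct (Req_dec_T (a k) 0) as [E|E]; [|field; exact E].
    specialize (H k Hk). rewrite E, Rabs_R0 in H. assert (Hp := Rabs_pos (b k)).
    destruct (Req_dec (b k) 0) as [Eb|Eb]; [rewrite Eb; ring|]. apply Rabs_pos_lt in Eb. lra.
Qed.

Lemma part_cv y : converges_to (fun n => part n y) y.
Proof.
  destruct (Hbasis y) as (a & Ha & _).
  assert (E : forall k, ap (es k) y = a k).
  { intros k. apply cond_eq. intros eps Heps. assert (Hn := dnorm_ge0 (es k)).
    destruct (small_multiple _ _ Hn Heps) as (eta & Heta & Hne). destruct (Ha eta Heta) as [N HN].
    specialize (HN (max N (S k)) ltac:(lia)). fold (comb a (max N (S k))) in HN.
    assert (H := ap_le (es k) (vsub (comb a (max N (S k))) y)). rewrite ap_sub, ap_es_comb in H.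
    destruct (Nat.ltb_spec k (max N (S k))); [|lia]. rewrite Rabs_minus_sym.
    eapply Rle_lt_trans; [exact H|].
    apply Rle_lt_trans with (vnorm (es k) * eta); [apply Rmult_le_compat_l; lra|exact Hne]. }
  intros eps Heps. destruct (Ha eps Heps) as [N HN]. exists N. intros n Hn. specialize (HN n Hn).
  unfold part. rewrite (comb_ext _ a) by (intros; apply E). exact HN.
Qed.

Lemma part_approx y eta : 0 < eta -> exists N, forall n, (N <= n)%nat -> vnorm (vsub (part n y) y) <= eta.
Proof. intros H. destruct (part_cv y eta H) as [N HN]. exists N. intros n Hn. left. auto. Qed.

Lemma part_le n y : vnorm (part n y) <= vnorm y.
Proof.
  apply le_epsilon. intros eps Heps. destruct (part_approx y eps Heps) as [N HN].
  set (m := max n N). specialize (HN m ltac:(unfold m; lia)).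
  assert (H1 : vnorm (part n y) <= vnorm (part m y)).
  { unfold part.
    rewrite (comb_ext _ (fun j => if Nat.ltb j n then ap (es j) y else 0) n).
    - rewrite <- (comb_extend _ n m); [|unfold m; lia|].
      + apply comb_dominated. intros j _. destruct (Nat.ltb j n); [lra|]. rewrite Rabs_R0. apply Rabs_pos.
      + intros k Hk. destruct (Nat.ltb_spec k n); [lia|reflexivity].
    - intros k Hk. destruct (Nat.ltb_spec k n); [reflexivity|lia]. }
  assert (H2 := nrm_le_sub (part m y) y). lra.
Qed.

Lemma part_flip N y w : (forall k, (k < N)%nat -> ap (es k) w = 0) -> vnorm (vsub (part N y) w) <= vnorm (vadd (part N y) w).
Proof.
  intros Hw. apply le_epsilon. intros eps Heps. destruct (part_approx w (eps / 2)) as [M HM]; [lra|].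
  set (m := max N M). specialize (HM m ltac:(unfold m; lia)).
  set (a := fun j => if Nat.ltb j N then ap (es j) y else 0).
  assert (Ha : part N y = comb a m).
  { rewrite (comb_extend a N m); [|unfold m; lia|].
    - apply comb_ext. intros k Hk. unfold a. destruct (Nat.ltb_spec k N); [reflexivity|lia].
    - intros k Hk. unfold a. destruct (Nat.ltb_spec k N); [lia|reflexivity]. }
  assert (H1 : vnorm (vsub (part N y) (part m w)) <= vnorm (vadd (part N y) (part m w))).
  { rewrite Ha. unfold part. rewrite <- comb_sub, <- comb_add. apply comb_dominated. intros j _. unfold a.
    destruct (Nat.ltb_spec j N); [rewrite (Hw j) by assumption; right; f_equal; ring|].
    rewrite Rminus_0_l, Rplus_0_l, Rabs_Ropp. lra. }
  assert (H2 : vnorm (vsub (part N y) w) <= vnorm (vsub (part N y) (part m w)) + vnorm (vsub (part m w) w)).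
  { replace (vsub (part N y) w) with (vadd (vsub (part N y) (part m w)) (vsub (part m w) w)) by vlin. apply nrm_add. }
  assert (H3 : vnorm (vadd (part N y) (part m w)) <= vnorm (vadd (part N y) w) + vnorm (vsub (part m w) w)).
  { replace (vadd (part N y) (part m w)) with (vadd (vadd (part N y) w) (vsub (part m w) w)) by vlin. apply nrm_add. }
  lra.
Qed.

(* If the convex combinations of the blocks stayed away from 0, unconditionality would make the blocks
   an l_1 sequence, and a functional constant on them is not a limit of combinations of the [es k]. *)
Section Blocks.
Variables (N : nat -> nat) (d : nat -> R) (C : R).
Hypothesis Hshr : is_basis (Dual Y) es.
Hypothesis HN0 : N O = O.
Hypothesis HN : forall n, (N n < N (S n))%nat.

Definition block (j : nat) : Y := vsum (fun k => vscal (d (N j + k)%nat) (e (N j + k)%nat)) (N (S j) - N j).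
Hypothesis HC : forall j, vnorm (block j) <= C.

Lemma sum_blocks (b : nat -> nat) (al : nat -> R) n : (forall n j, (N n <= j < N (S n))%nat -> b j = n) ->
  vsum (fun j => vscal (al j) (block j)) n = comb (fun k => al (b k) * d k) (N n).
Proof.
  intros Hb. induction n as [|n IH]; [rewrite HN0; reflexivity|]. cbn [vsum]. rewrite IH.
  unfold comb. assert (H := HN n). replace (N (S n)) with (N n + (N (S n) - N n))%nat by lia. rewrite vsum_split.
  f_equal. unfold block. rewrite <- vsum_scal. apply vsum_ext. intros k Hk. rewrite (Hb n) by lia. vlin.
Qed.

Lemma blocks_unconditional al n : vnorm (vsum (fun j => vscal (Rabs (al j)) (block j)) n) <= vnorm (vsum (fun j => vscal (al j) (block j)) n).
Proof.
  destruct (block_index N HN0 HN) as [b Hb]. rewrite !(sum_blocks b) by exact Hb.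
  apply comb_dominated. intros j _. rewrite !Rabs_mult, Rabs_Rabsolu. lra.
Qed.

Lemma small_block_combination J eps : 0 < eps -> exists b y, (J < b)%nat /\ blk block J b y /\ vnorm y < eps.
Proof.
  intros Heps. apply NNPP. intros Hno.
  assert (Hlow : forall b y, (J < b)%nat -> blk block J b y -> eps <= vnorm y).
  { intros b y Hb Hy. apply Rnot_lt_le. intros Hlt. apply Hno. now exists b, y. }
  set (lc := fun (al : nat -> R) n => vsum (fun i => vscal (al i) (block (J + i))) n).
  assert (Hshift : forall al n, lc al n = vsum (fun j => vscal (if Nat.ltb j J then 0 else al (j - J)%nat) (block j)) (J + n)).
  { intros al n. rewrite vsum_split, (vsum_0 _ J).
    - unfold lc. replace (vadd vzero _) with (vsum (fun k => vscal (if Nat.ltb (J + k) J then 0 else al (J + k - J)%nat) (block (J + k))) n) by vlin.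
      apply vsum_ext. intros k _. destruct (Nat.ltb_spec (J + k) J); [lia|]. do 2 f_equal. lia.
    - intros k Hk. destruct (Nat.ltb_spec k J); [vlin|lia]. }
  assert (Habs : forall al n, vnorm (lc (fun i => Rabs (al i)) n) <= vnorm (lc al n)).
  { intros al n. rewrite !Hshift. eapply Rle_trans; [|apply blocks_unconditional]. apply Req_le. f_equal.
    apply vsum_ext. intros j _. destruct (Nat.ltb j J); [now rewrite Rabs_R0|reflexivity]. }
  (* The lower estimate of an [l_1] sequence: unconditionality allows absolute values, and
     normalizing them gives a convex combination of the blocks. *)
  assert (Hbound : forall al n, eps * rsum al n <= vnorm (lc al n)).
  { intros al n. eapply Rle_trans; [|apply Habs]. set (A := rsum (fun i => Rabs (al i)) n).
    assert (HA : rsum al n <= A) by (apply rsum_le; intros; apply Rle_abs).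
    assert (HA0 : 0 <= A) by (apply rsum_ge0; intros; apply Rabs_pos).
    apply Rle_trans with (eps * A); [apply Rmult_le_compat_l; lra|].
    destruct (Req_dec A 0) as [E|E]; [rewrite E, Rmult_0_r; apply nrm_ge0|].
    assert (Hi : 0 < / A) by (apply Rinv_0_lt_compat; lra).
    assert (Hn : (0 < n)%nat) by (destruct n; [unfold A in E; simpl in E; lra|lia]).
    assert (H : eps <= vnorm (vsum (fun i => vscal (/ A * Rabs (al i)) (block (J + i))) n)).
    { apply (Hlow (J + n)%nat); [lia|]. apply conv_of_weights.
      - intros k Hk. exists (J + k)%nat. split; [lia|reflexivity].
      - intros k. apply Rmult_le_pos; [lra|apply Rabs_pos].
      - rewrite rsum_scal. fold A. now apply Rinv_l. }
    rewrite (vsum_ext _ (fun i => vscal (/ A) (vscal (Rabs (al i)) (block (J + i))))) in H by (intros; vlin).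
    rewrite vsum_scal, nrm_scal_pos in H by lra. fold (lc (fun i => Rabs (al i)) n) in H.
    apply Rmult_le_compat_l with (r := A) in H; [|lra]. rewrite <- Rmult_assoc, Rinv_r in H by exact E. lra. }
  assert (Hext : forall al n m, (n <= m)%nat -> lc (fun i => if Nat.ltb i n then al i else 0) m = lc al n /\
     rsum (fun i => if Nat.ltb i n then al i else 0) m = rsum al n).
  { intros al n m Hnm. replace m with (n + (m - n))%nat by lia. unfold lc. rewrite vsum_split, rsum_split.
    rewrite (vsum_0 (fun k => _ : Y) (m - n)), (rsum_0 _ (m - n)).
    - split.
      + replace (vadd _ vzero) with (vsum (fun i => vscal (if Nat.ltb i n then al i else 0) (block (J + i))) n) by vlin.
        apply vsum_ext. intros k Hk. destruct (Nat.ltb_spec k n); [reflexivity|lia].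
      + rewrite Rplus_0_r. apply rsum_ext. intros k Hk. destruct (Nat.ltb_spec k n); [reflexivity|lia].
    - intros k Hk. destruct (Nat.ltb_spec (n + k) n); [lia|reflexivity].
    - intros k Hk. destruct (Nat.ltb_spec (n + k) n); [lia|vlin]. }
  destruct (hahn_banach 1 (fun z r => exists al n, z = lc al n /\ r = eps * rsum al n)) as (phi & Hphi & Hphi1); [lra| |].
  { split; [|split; [|split]].
    - exists (fun _ => 0), O. split; [reflexivity|simpl; ring].
    - intros z r z' r' (al & n & -> & ->) (al' & n' & -> & ->).
      exists (fun i => (if Nat.ltb i n then al i else 0) + (if Nat.ltb i n' then al' i else 0)), (max n n').
      destruct (Hext al n (max n n')) as [E1 E2]; [lia|]. destruct (Hext al' n' (max n n')) as [E3 E4]; [lia|].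
      split.
      + rewrite <- E1, <- E3. unfold lc. rewrite <- vsum_add. apply vsum_ext. intros. vlin.
      + rewrite rsum_add, E2, E4. ring.
    - intros a z r (al & n & -> & ->). exists (fun i => a * al i), n. split.
      + unfold lc. rewrite <- vsum_scal. apply vsum_ext. intros. vlin.
      + rewrite rsum_scal. ring.
    - intros z r (al & n & -> & ->). rewrite Rmult_1_l. apply Hbound. }
  assert (Hval : forall i, ap phi (block (J + i)) = eps).
  { intros i. apply Hphi. exists (fun k => if Nat.eqb i k then 1 else 0), (S i). split.
    - unfold lc. rewrite (vsum_single (fun k => block (J + k))). destruct (Nat.ltb_spec i (S i)); [reflexivity|lia].
    - rewrite (rsum_ext _ (fun k => (if Nat.eqb i k then 1 else 0) * 1)) by (intros; ring).
      rewrite (rsum_single i (fun _ => 1)). destruct (Nat.ltb_spec i (S i)); [ring|lia]. }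
  destruct (Hshr phi) as (c & Hc & _).
  assert (HC0 : 0 <= C) by (eapply Rle_trans; [apply (nrm_ge0 (block O))|apply HC]).
  destruct (small_multiple _ _ HC0 Heps) as (eta & Heta & HCe). destruct (Hc eta Heta) as [n Hn]. specialize (Hn n (le_n n)).
  set (psi := vsub (vsum (fun j => vscal (c j) (es j)) n) phi) in *.
  (* The block [J + n] starts at [N (J + n) >= n], after the coordinates used by the approximation
     of [phi], which therefore vanishes on it although [phi] equals [eps] there. *)
  assert (Hz : ap psi (block (J + n)) = - eps).
  { unfold psi. rewrite ap_vsub, Hval, ap_vsum, rsum_0; [ring|]. intros k Hk. rewrite ap_vscal.
    assert (Hk' : (k < N (J + n))%nat) by (assert (J + n <= N (J + n))%nat by (apply incr_ge; exact HN); lia).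
    unfold block. rewrite ap_sum, rsum_0; [ring|]. intros i _. rewrite ap_scal, Hbio.
    destruct (Nat.eqb_spec k (N (J + n) + i)); [lia|ring]. }
  assert (Hle := ap_le psi (block (J + n))). rewrite Hz, Rabs_Ropp, (Rabs_pos_eq eps) in Hle by lra.
  assert (Hb2 : vnorm psi * vnorm (block (J + n)) <= eta * C).
  { apply Rmult_le_compat; [apply dnorm_ge0|apply nrm_ge0|lra|apply HC]. }
  lra.
Qed.
End Blocks.

Section Subspace.
Context {X : NSpace} {HX : is_normed X}.
Variables (T : X -> Y) (a b : R).
Hypothesis HT : linear_map T.
Hypothesis Hb0 : 0 <= b.
Hypothesis Ha : forall x, vnorm (T x) <= a * vnorm x.
Hypothesis Hb : forall x, vnorm x <= b * vnorm (T x).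

Lemma T_sub x y : T (vsub x y) = vsub (T x) (T y).
Proof. destruct HT as [TA TS]. unfold vsub. now rewrite <- !vscalN1, TA, TS. Qed.
Lemma T_sum u n : T (vsum u n) = vsum (fun k => T (u k)) n.
Proof.
  destruct HT as [TA TS]. induction n as [|n IH]; cbn [vsum]; [|now rewrite TA, IH].
  rewrite <- (vscal0 vzero), TS. apply vscal0.
Qed.

Lemma pullback_bounded k : bounded_functional (fun x => ap (es k) (T x)).
Proof.
  destruct HT as [TA TS]. split; [intros; now rewrite TA, ap_add|]. split; [intros; now rewrite TS, ap_scal|].
  exists (vnorm (es k) * a). intros x. eapply Rle_trans; [apply ap_le|]. rewrite Rmult_assoc.
  apply Rmult_le_compat_l; [apply dnorm_ge0|apply Ha].
Qed.

Lemma au_of_subspace x delta : 0 < delta -> a * b < 1 + delta / 2 ->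
  exists W : X -> Prop, subspace W /\ closed_set W /\ finite_codim W /\
      forall w, W w -> vnorm (vsub x w) <= (1 + delta) * vnorm (vadd x w).
Proof.
  intros Hdelta Hab. destruct (Req_dec (vnorm x) 0) as [E|E].
  - apply nrm_eq0 in E. subst x. exists (kr nil). split; [apply kr_subspace|]. split; [apply kr_closed|].
    split; [apply kr_finite_codim, good_nil|]. intros w _.
    replace (vsub vzero w) with (vopp w) by vlin. replace (vadd vzero w) with w by vlin.
    rewrite nrm_opp. assert (H := nrm_ge0 w). nra.
  - set (c := vnorm (T x)). assert (Hx := nrm_ge0 x).
    assert (Hc : 0 < c).
    { assert (H := nrm_ge0 (T x)). fold c in H. destruct (Req_dec c 0) as [Ec|Ec]; [|lra].
      specialize (Hb x). fold c in Hb. rewrite Ec in Hb. lra. }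
    (* Chosen so that [(1 + delta / 2) * (1 + kap) = 1 + delta]. The truncation costs
       [2 * eta = kap * c / 2], and this is at most [kap * S] because [S >= c / 2]. *)
    set (kap := delta / 2 / (1 + delta / 2)).
    assert (Hk0 : 0 < kap) by (apply Rdiv_lt_0_compat; lra).
    assert (Hk : kap * (1 + delta / 2) = delta / 2) by (unfold kap; field; lra).
    assert (Hk1 : kap <= 1) by nra.
    set (eta := kap * c / 4). assert (Heta : 0 < eta) by (unfold eta; nra).
    destruct (part_approx (T x) eta Heta) as [N HN]. specialize (HN N (le_n N)).
    assert (Hl : exists l : frame X, good l /\ forall w, kr l w -> forall k, (k < N)%nat -> ap (es k) (T w) = 0).
    { clear HN. induction N as [|N (l & Gl & IH)]; [exists nil; split; [apply good_nil|intros; lia]|].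
      destruct (frame_add_functional l (dmk _ (pullback_bounded N)) Gl) as (l' & G' & H1 & H2).
      exists l'. split; [exact G'|]. intros w Hw k Hk'. destruct (Nat.eq_dec k N) as [->|]; [exact (H2 w Hw)|].
      apply IH; [auto|lia]. }
    destruct Hl as (l & Gl & Hl). exists (kr l). split; [apply kr_subspace|]. split; [apply kr_closed|].
    split; [now apply kr_finite_codim|]. intros w Hw.
    assert (H1 := part_flip N (T x) (T w) (Hl w Hw)). set (p := part N (T x)) in *.
    assert (H2 : vnorm (vsub (T x) (T w)) <= vnorm (vsub p (T w)) + eta).
    { replace (vsub (T x) (T w)) with (vsub (vsub p (T w)) (vsub p (T x))) by vlin.
      eapply Rle_trans; [apply nrm_sub|]. lra. }
    assert (H3 : vnorm (vadd p (T w)) <= vnorm (vadd (T x) (T w)) + eta).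
    { replace (vadd p (T w)) with (vadd (vadd (T x) (T w)) (vsub p (T x))) by vlin.
      eapply Rle_trans; [apply nrm_add|]. lra. }
    assert (H4 : 2 * vnorm p <= vnorm (vadd p (T w)) + vnorm (vsub p (T w))).
    { rewrite <- nrm_scal_pos by lra. replace (vscal 2 p) with (vadd (vadd p (T w)) (vsub p (T w))) by vlin. apply nrm_add. }
    assert (H5 : c <= vnorm p + eta).
    { unfold c. eapply Rle_trans; [apply (nrm_le_sub (T x) p)|]. rewrite nrm_subC. lra. }
    set (S := vnorm (vadd (T x) (T w))) in *.
    assert (H6 : vnorm (vsub (T x) (T w)) <= (1 + kap) * S) by (unfold eta in *; nra).
    assert (HS : S <= a * vnorm (vadd x w)).
    { unfold S. rewrite <- (proj1 HT). apply Ha. }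
    assert (H7 := Hb (vsub x w)). rewrite T_sub in H7.
    assert (Hv := nrm_ge0 (vadd x w)).
    apply Rle_trans with (b * ((1 + kap) * (a * vnorm (vadd x w)))).
    + eapply Rle_trans; [exact H7|]. apply Rmult_le_compat_l; [exact Hb0|].
      eapply Rle_trans; [exact H6|]. apply Rmult_le_compat_l; lra.
    + replace (b * ((1 + kap) * (a * vnorm (vadd x w)))) with ((a * b) * (1 + kap) * vnorm (vadd x w)) by ring.
      apply Rmult_le_compat_r; [exact Hv|]. apply Rle_trans with ((1 + delta / 2) * (1 + kap)); [|lra].
      apply Rmult_le_compat_r; lra.
Qed.

Hypothesis Hshr : is_basis (Dual Y) es.

(** The alternating sums even stay bounded. In [Y], each chosen convex block is a truncation of [xi]
    with multipliers in [[0, 1]], up to a summable error. *)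
Lemma wabs_of_subspace_seq (x : nat -> X) M : (forall n, vnorm (x n) <= M) ->
  exists y : nat -> X, convex_block x y /\ exists K, 0 <= K /\ forall n r,
    (forall j, (S j < n)%nat -> (r j < r (S j))%nat) -> vnorm (alt y r n) <= K.
Proof.
  intros HxM. set (C := Rabs a * M).
  assert (HM0 : 0 <= M) by (eapply Rle_trans; [apply (nrm_ge0 (x O))|apply HxM]).
  assert (HTx : forall n, vnorm (T (x n)) <= C).
  { intros n. eapply Rle_trans; [apply Ha|]. assert (H := nrm_ge0 (x n)). assert (H1 := Rle_abs a).
    unfold C. specialize (HxM n). assert (H2 := Rabs_pos a). nra. }
  assert (HC0 : 0 <= C) by (eapply Rle_trans; [apply (nrm_ge0 (T (x O)))|apply HTx]).
  destruct (diag_reals (fun k n => ap (es k) (T (x n)))) as (s & xi & Hs & Hxi).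
  { intros k. exists (vnorm (es k) * C). intros n. apply ap_le_bd; [lra|apply HTx]. }
  set (z := fun n => T (x (s n))).
  assert (Hcoef : forall n eta, 0 < eta -> exists N, forall m, (N <= m)%nat ->
     vnorm (vsub (part n (z m)) (comb xi n)) <= eta).
  { intros n eta Heta.
    assert (Hc : Un_cv (fun m => rsum (fun k => Rabs (ap (es k) (z m) - xi k) * vnorm (e k)) n) (rsum (fun k => Rabs (xi k - xi k) * vnorm (e k)) n)).
    { apply rsum_cv. intros k. apply CV_mult.
      - apply cv_cvabs. apply CV_minus; [apply Hxi|apply Un_cv_const].
      - apply Un_cv_const. }
    rewrite (rsum_0 (fun k => Rabs (xi k - xi k) * _)) in Hc by (intros; rewrite Rminus_diag, Rabs_R0; ring).
    destruct (Hc eta Heta) as [N HN]. exists N. intros m Hm. specialize (HN m Hm). unfold R_dist in HN.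
    rewrite Rminus_0_r in HN. apply Rabs_def2 in HN. unfold part. rewrite <- comb_sub.
    eapply Rle_trans; [apply nrm_vsum|]. left. eapply Rle_lt_trans; [|apply HN]. apply rsum_le. intros k _.
    rewrite nrm_scal. lra. }
  assert (Hxin : forall n, vnorm (comb xi n) <= C).
  { intros n. apply le_epsilon. intros eps Heps. destruct (Hcoef n eps Heps) as [N HN]. specialize (HN N (le_n N)).
    assert (H1 := nrm_le_sub (comb xi n) (part n (z N))). rewrite nrm_subC in H1.
    assert (H2 := part_le n (z N)). specialize (HTx (s N)). unfold z in *. lra. }
  (* A gliding hump. The term [w j] agrees with [xi] before [N j] and is negligible after [N (S j)],
     both up to [(/ 2) ^ j]. In between it is [block N d j]. *)
  set (Q := fun (j : nat) (u : nat * nat) => vnorm (vsub (part (fst u) (z (snd u))) (comb xi (fst u))) <= (/ 2) ^ j).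
  set (R' := fun (j : nat) (u v : nat * nat) => (fst u < fst v)%nat /\ (snd u < snd v)%nat /\
     vnorm (vsub (part (fst v) (z (snd u))) (z (snd u))) <= (/ 2) ^ j).
  destruct (dep_choice Q R' (O, O)) as (u & Eu & Hu).
  { unfold Q. cbn [fst snd]. change (vnorm (vsub (vzero : Y) vzero) <= (/ 2) ^ 0).
    replace (vsub vzero vzero) with (vzero : Y) by vlin. rewrite nrm_0. simpl. lra. }
  { intros j [N i] _. destruct (part_approx (z i) _ (half_pow_pos j)) as [N' HN'].
    destruct (Hcoef (max (S N) N') _ (half_pow_pos (S j))) as [i' Hi'].
    exists (max (S N) N', max (S i) i'). unfold Q, R'. cbn [fst snd].
    split; [apply Hi'; lia|]. split; [lia|]. split; [lia|apply HN'; lia]. }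
  set (N := fun j => fst (u j)). set (w := fun j => z (snd (u j))).
  assert (HN : forall j, (N j < N (S j))%nat) by (intros j; apply (Hu j)).
  assert (HN0 : N O = O) by (unfold N; now rewrite Eu).
  assert (Hi : forall j, (snd (u j) < snd (u (S j)))%nat) by (intros j; apply (Hu j)).
  assert (Hw1 : forall j, vnorm (vsub (part (N j) (w j)) (comb xi (N j))) <= (/ 2) ^ j) by (intros j; apply (Hu j)).
  assert (Hw2 : forall j, vnorm (vsub (part (N (S j)) (w j)) (w j)) <= (/ 2) ^ j) by (intros j; apply (Hu j)).
  destruct (block_index N HN0 HN) as [bi Hbi].
  set (d := fun k => ap (es k) (w (bi k))).
  assert (Hblock : forall j, block N d j = vsub (part (N (S j)) (w j)) (part (N j) (w j))).
  { intros j. unfold part, comb. assert (H := HN j). replace (N (S j)) with (N j + (N (S j) - N j))%nat by lia.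
    rewrite vsum_split. unfold block. rewrite (vsum_ext _ (fun k => vscal (ap (es (N j + k)%nat) (w j)) (e (N j + k)%nat))); [vlin|].
    intros k Hk. unfold d. rewrite (Hbi j) by lia. reflexivity. }
  assert (Hblk : forall j, vnorm (block N d j) <= 2 * C).
  { intros j. rewrite Hblock. eapply Rle_trans; [apply nrm_sub|].
    assert (H1 := part_le (N (S j)) (w j)). assert (H2 := part_le (N j) (w j)).
    assert (H3 : vnorm (w j) <= C) by apply HTx. lra. }
  assert (Hsmall : forall Jn : nat * nat, exists p', exists y', (fst Jn < p')%nat /\ blk (block N d) (fst Jn) p' y' /\ vnorm y' < (/ 2) ^ (snd Jn)).
  { intros [J n]. exact (small_block_combination N d (2 * C) Hshr HN0 HN Hblk J _ (half_pow_pos n)). }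
  destruct (func_choice _ Hsmall) as [pf Hpf].
  set (p := fix p n := match n with O => O | S n => pf (p n, n) end).
  assert (Hp : forall n, (p n < p (S n))%nat) by (intros n; destruct (Hpf (p n, n)) as (y' & H1 & _); exact H1).
  set (xs := fun j => x (s (snd (u j)))).
  (* A convex combination of blocks is lifted to the same combination of the vectors. The
     truncations of [xi] mix into the multiplier [th], which is 1 before the first block and 0 from
     the end of the last one. *)
  assert (Htrans : forall J b' y', (J < b')%nat -> blk (block N d) J b' y' -> exists y th, blk xs J b' y /\
     (forall k, 0 <= th k <= 1) /\ (forall k, (k < N J)%nat -> th k = 1) /\ (forall k, (N b' <= k)%nat -> th k = 0) /\
     forall K, (N b' <= K)%nat -> vnorm (vsub (vsub (T y) (comb (fun k => th k * xi k) K)) y') <= 2 * (/ 2) ^ J).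
  { intros J b' y' HJ Hy'. induction Hy' as [v (j & Hj & ->)|t v1 v2 Ht _ IH1 _ IH2].
    - exists (xs j), (fun k => if Nat.ltb k (N j) then 1 else 0).
      assert (HJj : (N J <= N j)%nat) by (apply incr_le; auto; lia).
      assert (Hjb : (N j <= N b')%nat) by (apply incr_le; auto; lia).
      split; [apply conv_base; exists j; auto|]. split; [intros k; destruct (Nat.ltb k (N j)); lra|].
      split; [intros k Hk; destruct (Nat.ltb_spec k (N j)); [reflexivity|lia]|].
      split; [intros k Hk; destruct (Nat.ltb_spec k (N j)); [lia|reflexivity]|].
      intros K HK. change (T (xs j)) with (w j). rewrite Hblock.
      rewrite (comb_extend _ (N j) K); [|lia|intros k Hk; destruct (Nat.ltb_spec k (N j)); [lia|ring]].
      rewrite (comb_ext _ xi) by (intros k Hk; destruct (Nat.ltb_spec k (N j)); [ring|lia]).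
      replace (vsub _ _) with (vsub (vsub (part (N j) (w j)) (comb xi (N j))) (vsub (part (N (S j)) (w j)) (w j))) by vlin.
      eapply Rle_trans; [apply nrm_sub|]. specialize (Hw1 j). specialize (Hw2 j).
      assert (H := half_pow_le J j ltac:(lia)). lra.
    - destruct IH1 as (y1 & th1 & A1 & A2 & A3 & A4 & A5). destruct IH2 as (y2 & th2 & B1 & B2 & B3 & B4 & B5).
      exists (vadd (vscal t y1) (vscal (1 - t) y2)), (fun k => t * th1 k + (1 - t) * th2 k).
      split; [now apply conv_mix|]. split; [intros k; specialize (A2 k); specialize (B2 k); nra|].
      split; [intros k Hk; rewrite A3, B3 by exact Hk; ring|].
      split; [intros k Hk; rewrite A4, B4 by exact Hk; ring|].
      intros K HK. specialize (A5 K HK). specialize (B5 K HK).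
      rewrite (comb_ext _ (fun k => t * (th1 k * xi k) + (1 - t) * (th2 k * xi k))) by (intros; ring).
      rewrite comb_add, !comb_scal, (proj1 HT), !(proj2 HT).
      set (E1 := vsub (vsub (T y1) (comb (fun k => th1 k * xi k) K)) v1) in *.
      set (E2 := vsub (vsub (T y2) (comb (fun k => th2 k * xi k) K)) v2) in *.
      replace (vsub _ _) with (vadd (vscal t E1) (vscal (1 - t) E2)) by (unfold E1, E2; vlin).
      eapply Rle_trans; [apply nrm_add|]. rewrite !nrm_scal_pos by lra. nra. }
  assert (Hy : forall n, exists yt : X * (nat -> R), blk xs (p n) (p (S n)) (fst yt) /\
     (forall k, 0 <= snd yt k <= 1) /\ (forall k, (k < N (p n))%nat -> snd yt k = 1) /\ (forall k, (N (p (S n)) <= k)%nat -> snd yt k = 0) /\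
     forall K, (N (p (S n)) <= K)%nat -> vnorm (vsub (T (fst yt)) (comb (fun k => snd yt k * xi k) K)) <= 3 * (/ 2) ^ n).
  { intros n. destruct (Hpf (p n, n)) as (y' & H1 & H2 & H3). change (pf (p n, n)) with (p (S n)) in *. cbn [fst snd] in *.
    destruct (Htrans _ _ _ H1 H2) as (y & th & A1 & A2 & A3 & A4 & A5). exists (y, th). cbn [fst snd].
    repeat split; auto; try (intros; apply A2). intros K HK. specialize (A5 K HK).
    assert (H4 := nrm_le_sub (vsub (T y) (comb (fun k => th k * xi k) K)) y').
    assert (H5 := half_pow_le n (p n) (incr_ge p Hp n)). lra. }
  destruct (func_choice _ Hy) as [yt Hyt]. set (y := fun n => fst (yt n)). set (th := fun n => snd (yt n)).
  exists y. split.
  - set (idx := fun j => s (snd (u j))).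
    assert (Hidx : forall j, (idx j < idx (S j))%nat) by (intros j; apply (incr_lt s); auto).
    (* A convex block sequence has to start at the index 0, so the first block is extended to the
       left. *)
    apply (blk_convex_block x y (fun n => match n with O => O | S m => idx (p (S m)) end) eq_refl).
    + intros [|n]; [|apply incr_lt; auto]. assert (H := incr_ge idx Hidx (p 1%nat)). assert (H1 := Hp O). lia.
    + assert (Hbk : forall n, blk x (idx (p n)) (idx (p (S n))) (y n)).
      { intros n. destruct (Hyt n) as (A1 & _). unfold blk in *. revert A1. apply conv_sub.
        intros v (j & Hj & ->). exists (idx j). split; [|reflexivity].
        split; [apply incr_le; auto; lia|apply incr_lt; auto; lia]. }
      intros [|n]; [|apply Hbk]. apply (blk_sub x (idx (p O)) (idx (p 1%nat))); [lia|lia|apply Hbk].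
  (* [C] bounds the part along [xi], and 6 is the sum of the errors [3 * (/ 2) ^ j]. *)
  - exists (b * (C + 6)). split; [nra|]. intros n r Hr.
    assert (Hrj : forall j, (j < n)%nat -> (j <= r j)%nat).
    { induction j as [|j IH]; intros Hj; [lia|]. specialize (IH ltac:(lia)). specialize (Hr j Hj). lia. }
    assert (Hrm : forall i j, (i < j < n)%nat -> (r i < r j)%nat).
    { intros i j [Hij Hjn]. induction Hij as [|j Hij IH]; [apply Hr; lia|]. specialize (IH ltac:(lia)). specialize (Hr j Hjn). lia. }
    assert (HK : exists K, forall j, (j < n)%nat -> (N (p (S (r j))) <= K)%nat).
    { clear. induction n as [|n [K IH]]; [exists O; lia|]. exists (max K (N (p (S (r n))))). intros j Hj.
      destruct (Nat.eq_dec j n) as [->|]; [lia|]. specialize (IH j ltac:(lia)). lia. }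
    destruct HK as [K HK].
    eapply Rle_trans; [apply Hb|]. apply Rmult_le_compat_l; [exact Hb0|].
    unfold alt. rewrite T_sum.
    set (V := fun j => comb (fun k => th (r j) k * xi k) K).
    assert (HV : vnorm (vsum (fun j => vscal ((-1) ^ S j) (V j)) n) <= C).
    { assert (E : vsum (fun j => vscal ((-1) ^ S j) (V j)) n = comb (fun k => rsum (fun j => (-1) ^ S j * th (r j) k) n * xi k) K).
      { clear HK Hrm Hrj Hr. induction n as [|n IH].
        - simpl. unfold comb. rewrite vsum_0; [reflexivity|]. intros k _. vlin.
        - cbn [vsum rsum]. rewrite IH. unfold V at 1. rewrite <- comb_scal, <- comb_add. apply comb_ext. intros k _. ring. }
      (* At a fixed coordinate [k] the multipliers increase with the block: before a later block
         starts its multiplier is 1, and once [k] has passed that start, all the earlier multipliers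
         are 0. *)
      rewrite E. eapply Rle_trans; [|apply (Hxin K)]. apply comb_multiplier. intros k _.
      apply alternating_monotone.
      - intros j Hj. apply (Hyt (r j)).
      - intros i j Hij. destruct (le_lt_dec (N (p (r j))) k) as [Hle|Hlt].
        + destruct (Hyt (r i)) as (_ & _ & _ & A4 & _). unfold th. rewrite A4; [apply (Hyt (r j))|].
          eapply Nat.le_trans; [|exact Hle]. apply incr_le; auto. apply incr_le; auto. apply (Hrm i j Hij).
        + destruct (Hyt (r j)) as (_ & _ & A3 & _). unfold th. rewrite A3 by exact Hlt. apply (Hyt (r i)). }
    assert (HD : vnorm (vsub (vsum (fun j => T (vscal ((-1) ^ S j) (y (r j)))) n) (vsum (fun j => vscal ((-1) ^ S j) (V j)) n)) <= 6).
    { rewrite <- vsum_sub. eapply Rle_trans; [apply nrm_vsum|].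
      apply Rle_trans with (rsum (fun j => 6 * (/ 2) ^ (S j)) n).
      - apply rsum_le. intros j Hj. rewrite (proj2 HT).
        replace (vsub _ _) with (vscal ((-1) ^ S j) (vsub (T (y (r j))) (V j))) by vlin.
        rewrite nrm_sign by apply sign_pow. destruct (Hyt (r j)) as (_ & _ & _ & _ & A5).
        eapply Rle_trans; [apply A5; now apply HK|]. assert (H := half_pow_le j (r j) (Hrj j Hj)). simpl. lra.
      - rewrite rsum_scal. assert (H := rsum_geometric n). lra. }
    assert (H := nrm_le_sub (vsum (fun j => T (vscal ((-1) ^ S j) (y (r j)))) n) (vsum (fun j => vscal ((-1) ^ S j) (V j)) n)). lra.
Qed.
End Subspace.
End UnconditionalBasis.

Lemma WABS_of_bounded_alternating (X : NSpace) : is_normed X ->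
  (forall (x : nat -> X) M, (forall n, vnorm (x n) <= M) -> exists y, convex_block x y /\ exists K, 0 <= K /\ forall n r,
    (forall j, (S j < n)%nat -> (r j < r (S j))%nat) -> vnorm (alt y r n) <= K) -> WABS X.
Proof.
  intros HX H x [M HM]. destruct (H x M HM) as (y & Hy & K & HK & Hb). exists y. split; [exact Hy|].
  intros eps Heps. destruct (INR_unbounded (K / eps)) as [N HN]. exists N. intros n Hn1 Hn r Hr.
  fold (alt y r n). specialize (Hb n r Hr). assert (Hp : 0 < INR n) by (apply lt_0_INR; lia).
  rewrite nrm_scal_pos by (left; now apply Rinv_0_lt_compat).
  apply Rmult_le_reg_l with (INR n); [exact Hp|]. rewrite <- Rmult_assoc, Rinv_r, Rmult_1_l by lra.
  apply le_INR in Hn. apply Rmult_lt_compat_r with (r := eps) in HN; [|exact Heps].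
  unfold Rdiv in HN. rewrite Rmult_assoc, Rinv_l in HN by lra. nra.
Qed.

Theorem theorem6p4 (X : NSpace) (HX : Banach X) (HXsep : separable X) :
  (prop_au X /\ WABS X) <->
  (forall delta : R, 0 < delta ->
     exists (Y : NSpace) (e : nat -> Y) (Xd : Y -> Prop),
       Banach Y /\ shrinking Y e /\ one_unconditional Y e /\
       subspace Xd /\ banach_mazur_lt X Y Xd (1 + delta)).
Proof.
  destruct HX as [HXn _]. split.
  - intros [Hau HW]. now apply embedding_of_au_wabs.
  - intros H. split.
    + intros x delta Hdelta.
      destruct (H (delta / 2)) as (Y & e & Xd & [HY _] & (Hbas & es & Hbio & _) & (_ & Hunc) & _ & T & a & b & HT & _ & _ & _ & Hb0 & Ha & Hb & Hab); [lra|].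
      exact (au_of_subspace e es Hbas Hbio Hunc T a b HT Hb0 Ha Hb x delta Hdelta Hab).
    + apply WABS_of_bounded_alternating; [exact HXn|]. intros x M HM.
      (* (WABS) is stable under isomorphism, so a single value of [delta] suffices here, whereas
         (au) needs distances close to 1. *)
      destruct (H 1) as (Y & e & Xd & [HY _] & (Hbas & es & Hbio & Hshr) & (_ & Hunc) & _ & T & a & b & HT & _ & _ & _ & Hb0 & Ha & Hb & Hab); [lra|].
      exact (wabs_of_subspace_seq e es Hbas Hbio Hunc T a b HT Hb0 Ha Hb Hshr x M HM).
Qed.
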